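(* Let $m\ge 2$ and let $G\le \mathrm{SU}(m-1)$ be an admissible subgroup. Then there exists a linear embedding $\Psi:\mathbb{C}^2\to\mathbb{C}^m$ such that the following holds. Let $I_1,I_2\subseteq\mathbb{R}$ be open intervals containing $0$, let $a\in\mathbb{R}$, and let $\gamma:I_1\to\mathbb{C}$, $\xi:I_2\to\mathbb{C}$ be smooth curves satisfying $$\vec{\kappa}_{\gamma} - (m-2)\frac{\gamma^{\perp}}{|\gamma|^{2}} = a\gamma^{\perp},\qquad \vec{\kappa}_{\xi} - (m-2)\frac{\xi^{\perp}}{|\xi|^{2}} = -a\xi^{\perp}.$$ Define $$\check F:I_1\times I_2\to\mathbb{C}^2,\quad \check F(x,y)=\Big(\gamma(x)\xi(y),\ \int_0^y\overline{\xi(s)}\,\xi'(s)\,ds-\int_0^x\overline{\gamma(s)}\,\gamma'(s)\,ds\Big),$$ $$F:G\times I_1\times I_2\to\mathbb{C}^m,\quad F(g,x,y)=g\cdot\Psi(\check F(x,y)).$$ Then: (i) if $a>0$, the image of $F$ is an exact Lagrangian translator (immersed away from $\{0\}\times\mathbb{C}\subset\mathbb{C}^{m-1}\times\mathbb{C}$); (ii) if $a=0$, the image of $F$ is an exact special Lagrangian (immersed away from $\{0\}\times\mathbb{C}$).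
   Context: $\mathbb{C}^m$ carries its standard metric $g_0$, Kähler form $\omega_0=\sum dx_i\wedge dy_i$, complex structure $J$ and holomorphic volume form $\Omega_0=dz_1\wedge\dots\wedge dz_m$. $G\le \mathrm{SU}(m-1)$ acts on $\mathbb{C}^m=\mathbb{C}^{m-1}\times\mathbb{C}$ by its standard action on the first factor and trivially on the last coordinate. Standard moment map: $\mu:\mathbb{C}^{m-1}\to\mathfrak g$, $\mu(z)=-\tfrac12\pi_{\mathfrak g}(i z\bar z^T)$, where $z$ is a column vector and $\pi_{\mathfrak g}:\mathfrak u(m-1)\to\mathfrak g$ is orthogonal projection with respect to an Ad-invariant inner product. A $G$-invariant submanifold $M$ of dimension $n$ is cohomogeneity-$k$ if all its points have the same isotropy type $(H)$ (stabilisers all conjugate to a fixed $H\le G$) and $\dim(G/H)=n-k$. A compact connected $G\le \mathrm{SU}(m-1)$ is admissible if $\mu^{-1}(0)\subset\mathbb{C}^{m-1}$ contains a cohomogeneity-one ($G$-invariant) Lagrangian submanifold of $\mathbb{C}^{m-1}$. Curves are regular (immersed); $\vec\kappa_\gamma$ is the curvature vector and $\gamma^\perp$ the component of the position vector normal to the curve. For a straight line through the origin, $\gamma^\perp\equiv0$ and the term $\gamma^\perp/|\gamma|^2$ is understood to be $0$. A Lagrangian immersion is a Lagrangian translator (translating soliton) if its mean curvature vector satisfies $\vec H=T^\perp$ for some nonzero constant vector $T\in\mathbb{C}^m$, where $\perp$ denotes the normal component. It is special Lagrangian if $\vec H=0$ (equivalently its Lagrangian angle is locally constant). It is exact if the pullback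 of the Liouville form $\lambda=\frac{1}{2i}\sum_i(\bar z_idz_i-z_id\bar z_i)$ is exact. The map $F$ descends to $(G/H)\times I_1\times I_2$, where $H$ is the common stabiliser of the points $\Psi(\check F(x,y))$ with $\gamma(x)\xi(y)\neq 0$, and ''immersed'' refers to this descended map. *)

(* Defs.v *)
From HB Require Import structures.
From mathcomp Require Import all_boot all_order all_algebra.
From mathcomp Require Import complex.
From mathcomp Require Import all_classical all_reals all_analysis.

Set Implicit Arguments.
Unset Strict Implicit.
Unset Printing Implicit Defensive.

Import Order.TTheory GRing.Theory Num.Theory.
Import numFieldNormedType.Exports.

Local Open Scope classical_set_scope.
Local Open Scope ring_scope.

Section CurvesAndIntegrals.
Variable R : realType.
Local Notation C := R[i].

Definition smooth_on (I : set R) (f : R -> R) : Prop :=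
  forall (k : nat) (t : R), I t -> derivable (derive1n k f) t 1.

Definition smooth_ccurve (I : set R) (c : R -> C) : Prop :=
  smooth_on I (fun t => complex.Re (c t)) /\
  smooth_on I (fun t => complex.Im (c t)).

Definition smooth_mxcurve (p q : nat) (I : set R) (c : R -> 'M[C]_(p, q)) :
  Prop := forall i j, smooth_ccurve I (fun t => c t i j).

Definition cderiv (c : R -> C) (t : R) : C :=
  (derive1 (fun s => complex.Re (c s)) t
   +i* derive1 (fun s => complex.Im (c s)) t)%C.

Definition mxderiv (p q : nat) (c : R -> 'M[C]_(p, q)) (t : R) :
  'M[C]_(p, q) := \matrix_(i, j) cderiv (fun s => c s i j) t.

(* The integral from 0 to b, with its sign when b < 0. *)
Definition int0 (f : R -> R) (b : R) : R :=
  if 0 <= b then \int[lebesgue_measure]_(s in `[0, b]) f s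
  else - \int[lebesgue_measure]_(s in `[b, 0]) f s.

Definition cint0 (f : R -> C) (b : R) : C :=
  (int0 (fun s => complex.Re (f s)) b +i* int0 (fun s => complex.Im (f s)) b)%C.

End CurvesAndIntegrals.

Section RealStructure.
Variables (R : realType) (p q : nat).
Local Notation C := R[i].
Implicit Types (u v : 'M[C]_(p, q)) (S : set 'M[C]_(p, q)).

(* On column vectors this is g_0; on square matrices it is Re tr(u v^* ), whose
   restriction to u(n) is Ad-invariant. *)
Definition mxinner u v : R :=
  \sum_i \sum_j (complex.Re (u i j) * complex.Re (v i j)
                 + complex.Im (u i j) * complex.Im (v i j)).

Definition realify u : 'rV[R]_(p * q + p * q) :=
  row_mx (mxvec (map_mx (@complex.Re R) u)) (mxvec (map_mx (@complex.Im R) u)).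

(* S is a real linear subspace of real dimension k. *)
Definition has_dim S (k : nat) : Prop :=
  exists B : 'M[R]_(k, p * q + p * q),
    row_free B /\ forall u, S u <-> (realify u <= B)%MS.

(* Total; meaningful when S is a real linear subspace. *)
Definition orth_proj S v : 'M[C]_(p, q) :=
  xget 0 [set w | S w /\ forall u, S u -> mxinner (v - w) u = 0].

Definition normal_part S v : 'M[C]_(p, q) := v - orth_proj S v.

End RealStructure.

Section Velocities.
Variables (R : realType) (p q : nat).
Local Notation C := R[i].

(* D is the family of smooth curves of a parameter space P; for P a manifold and
   F smooth, [velocities D F x] is the image of dF at x. *)
Definition velocities (P : Type) (D : set (R -> P)) (F : P -> 'M[C]_(p, q))
    (x : P) : set 'M[C]_(p, q) :=
  [set v | exists c : R -> P, [/\ D c, c 0 = x & v = mxderiv (F \o c) 0]].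

Definition curves_in (A : set 'M[C]_(p, q)) : set (R -> 'M[C]_(p, q)) :=
  [set c | exists2 e : R, 0 < e &
     smooth_mxcurve `]-e, e[ c /\ forall t, - e < t < e -> A (c t)].

Definition tangent_space (A : set 'M[C]_(p, q)) (a : 'M[C]_(p, q)) :
  set 'M[C]_(p, q) := velocities (curves_in A) id a.

End Velocities.

Section SymplecticForms.
Variables (R : realType) (n : nat).
Local Notation C := R[i].
Implicit Types z u v : 'cV[C]_n.

Definition omega0 u v : R :=
  \sum_i (complex.Re (u i 0) * complex.Im (v i 0)
          - complex.Im (u i 0) * complex.Re (v i 0)).

(* dz_i (v) = v_i and d(conj z_i) (v) = conj v_i; the value is real. *)
Definition liouville z v : R :=
  complex.Re ((2 * 'i%C)^-1 *
    \sum_i ((z i 0)^* * v i 0 - z i 0 * (v i 0)^* )).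

End SymplecticForms.

Section Submanifolds.
Variable R : realType.

(* C^oo: all iterated directional derivatives are Frechet differentiable. *)
Definition iterated_derive (V W : normedModType R) (vs : seq V) (f : V -> W) :
  V -> W := foldr (fun v g => fun x => 'D_v g x) f vs.

Definition smooth_map_on (V W : normedModType R) (U : set V) (f : V -> W) :
  Prop := forall (vs : seq V) (x : V), U x ->
    differentiable (iterated_derive vs f) x.

(* Near each point, S is the image of a smooth immersion of an open subset of
   R^k which is a homeomorphism onto its image. *)
Definition embedded_submanifold (N k : nat) (S : set 'rV[R]_N) : Prop :=
  S !=set0 /\
  forall z, S z ->
    exists (W : set 'rV[R]_N) (U : set 'rV[R]_k)
           (phi : 'rV[R]_k -> 'rV[R]_N) (psi : 'rV[R]_N -> 'rV[R]_k),
      [/\ open W /\ W z,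
          open U /\ phi @` U = S `&` W,
          smooth_map_on U phi,
          forall x v, U x -> 'D_v phi x = 0 -> v = 0 &
          {within S `&` W, continuous psi} /\ forall x, U x -> psi (phi x) = x].

End Submanifolds.

Section Groups.
Variables (R : realType) (n : nat).
Local Notation C := R[i].
Implicit Types (G H : set 'M[C]_n) (L : set 'cV[C]_n).

Definition subgroup_SU G : Prop :=
  [/\ G 1%:M,
      forall g h, G g -> G h -> G (g *m h),
      forall g, G g -> G (invmx g) &
      forall g, G g -> g \is unitarymx /\ \det g = 1].

(* T_1 G, as the set of velocities at 1 of smooth curves in G. *)
Definition lie G : set 'M[C]_n := tangent_space G 1%:M.

Definition stabiliser (k : nat) G (act : 'M[C]_n -> 'cV[C]_k -> 'cV[C]_k)
  (z : 'cV[C]_k) : set 'M[C]_n := [set g | G g /\ act g z = z].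

Definition moment_map G (z : 'cV[C]_n) : 'M[C]_n :=
  - 2^-1 *: orth_proj (lie G) ('i%C *: (z *m (map_mx Num.conj z)^T)).

Definition Lagrangian_submanifold L : Prop :=
  embedded_submanifold n (@realify R n 1 @` L) /\
  forall z u v, L z -> tangent_space L z u -> tangent_space L z v ->
    omega0 u v = 0.

(* d is the dimension of M. *)
Definition cohomogeneity (k d : nat) G (M : set 'cV[C]_n) : Prop :=
  (forall g z, G g -> M z -> M (g *m z)) /\
  exists H : set 'M[C]_n,
    [/\ subgroup_SU H /\ H `<=` G,
        forall z, M z -> exists2 g, G g &
          stabiliser G mulmx z = [set g *m h *m invmx g | h in H] &
        exists dG dH : nat,
          [/\ has_dim (lie G) dG, has_dim (lie H) dH & (dG - dH = d - k)%N]].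

Definition admissible G : Prop :=
  [/\ compact (@realify R n n @` G),
      connected (@realify R n n @` G) &
      exists L : set 'cV[C]_n,
        [/\ L `<=` [set z | moment_map G z = 0],
            Lagrangian_submanifold L &
            cohomogeneity 1 n G L]].

End Groups.

Section PlaneCurves.
Variable R : realType.
Local Notation C := R[i].

Definition regular_curve (I : set R) (c : R -> C) : Prop :=
  smooth_ccurve I c /\ forall t, I t -> cderiv c t != 0.

(* Derivative of the unit tangent with respect to arc length. *)
Definition curvature (c : R -> C) (t : R) : C :=
  cderiv (fun s => cderiv c s / `|cderiv c s|) t / `|cderiv c t|.

Definition position_perp (c : R -> C) (t : R) : C :=
  let v := cderiv c t in
  c t - (complex.Re (c t * v^* ))%:C%C / `|v| ^+ 2 * v.

(* As x / 0 = 0, the term position_perp / |c|^2 is 0 at a zero of c, which is the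
   convention used for lines through the origin. *)
Definition curve_equation (m : nat) (a : R) (I : set R) (c : R -> C) : Prop :=
  forall t, I t ->
    curvature c t - (m - 2)%N%:R * (position_perp c t / `|c t| ^+ 2)
    = a%:C%C * position_perp c t.

End PlaneCurves.

Section Construction.
(* C^m is C^(n+1) with n = m-1, split as C^n x C. *)
Variables (R : realType) (n : nat).
Local Notation C := R[i].
Local Notation param := ('M[C]_n * R * R)%type.

Definition Fcheck (gamma xi : R -> C) (x y : R) : 'cV[C]_2 :=
  \col_(i < 2)
    if i == 0 then gamma x * xi y
    else cint0 (fun s => (xi s)^* * cderiv xi s) y
         - cint0 (fun s => (gamma s)^* * cderiv gamma s) x.

Definition actC (g : 'M[C]_n) (z : 'cV[C]_(n + 1)) : 'cV[C]_(n + 1) :=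
  block_mx g 0 0 1%:M *m z.

Definition Fmap (Psi : 'cV[C]_2 -> 'cV[C]_(n + 1)) (gamma xi : R -> C)
  (p : param) : 'cV[C]_(n + 1) :=
  actC p.1.1 (Psi (Fcheck gamma xi p.1.2 p.2)).

Definition common_stabiliser (G : set 'M[C]_n) (I1 I2 : set R)
    (Psi : 'cV[C]_2 -> 'cV[C]_(n + 1)) (gamma xi : R -> C) : set 'M[C]_n :=
  [set g | G g /\ forall x y, I1 x -> I2 y -> gamma x * xi y != 0 ->
     actC g (Psi (Fcheck gamma xi x y)) = Psi (Fcheck gamma xi x y)].

Definition param_space (G : set 'M[C]_n) (I1 I2 : set R) : set param :=
  [set p | [/\ G p.1.1, I1 p.1.2 & I2 p.2]].

Definition param_curves (G : set 'M[C]_n) (I1 I2 : set R) : set (R -> param) :=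
  [set c | exists2 e : R, 0 < e &
     [/\ smooth_mxcurve `]-e, e[ (fun t => (c t).1.1),
         smooth_on `]-e, e[ (fun t => (c t).1.2),
         smooth_on `]-e, e[ (fun t => (c t).2) &
         forall t, - e < t < e -> param_space G I1 I2 (c t)]].

(* Here F is a right H-invariant map on G x I1 x I2, i.e. a map on
   (G/H) x I1 x I2. *)
Section Immersions.
Variables (G H : set 'M[C]_n) (I1 I2 : set R) (N : nat).
Variable F : param -> 'cV[C]_N.

Local Notation D := (param_curves G I1 I2).
Local Notation T_ p := (velocities D F p).

Definition right_invariant (A : Type) (f : param -> A) : Prop :=
  forall g h x y, param_space G I1 I2 (g, x, y) -> H h ->
    f (g *m h, x, y) = f (g, x, y).

(* T_[g](G/H) is T_g G modulo g *m lie H, so this is injectivity at p of the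
   differential of the descended map. *)
Definition immersed_at (p : param) : Prop :=
  forall c, D c -> c 0 = p -> mxderiv (F \o c) 0 = 0 ->
    [/\ lie H (invmx p.1.1 *m mxderiv (fun t => (c t).1.1) 0),
        derive1 (fun t => (c t).1.2) 0 = 0 &
       derive1 (fun t => (c t).2) 0 = 0].

Definition Lagrangian_at (p : param) : Prop :=
  has_dim (T_ p) N /\ forall u v, T_ p u -> T_ p v -> omega0 u v = 0.

(* h is the trace of the second fundamental form over an orthonormal basis of
   the tangent space: II(e, e) is the normal part of the acceleration of any
   curve in the submanifold with velocity e. *)
Definition mean_curvature_at (p : param) (h : 'cV[C]_N) : Prop :=
  exists (d : nat) (c : 'I_d -> R -> param),
    [/\ has_dim (T_ p) d,
        forall i, D (c i) /\ c i 0 = p,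
        forall i j, mxinner (mxderiv (F \o c i) 0) (mxderiv (F \o c j) 0)
                    = (i == j)%:R &
        h = \sum_i normal_part (T_ p) (mxderiv (mxderiv (F \o c i)) 0)].

(* F^* lambda = df, tested on the velocities of all smooth curves. A function f
   all of whose derivatives along smooth curves are given by a smooth 1-form is
   automatically smooth. *)
Definition exact_map : Prop :=
  exists f : param -> R, right_invariant f /\
    forall c, D c ->
      is_derive (0 : R) (1 : R) (f \o c)
                (liouville (F (c 0)) (mxderiv (F \o c) 0)).

End Immersions.

Section Conclusions.
Variables (G : set 'M[C]_n) (I1 I2 : set R).
Variables (Psi : 'cV[C]_2 -> 'cV[C]_(n + 1)) (gamma xi : R -> C).

Local Notation F := (Fmap Psi gamma xi).
Local Notation H := (common_stabiliser G I1 I2 Psi gamma xi).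

(* The points of G x I1 x I2 that F maps outside {0} x C. *)
Definition regular_points : set param :=
  [set p | param_space G I1 I2 p /\ usubmx (F p) != 0].

Definition exact_Lagrangian_immersion : Prop :=
  [/\ forall x y, I1 x -> I2 y -> gamma x * xi y != 0 ->
        stabiliser G actC (Psi (Fcheck gamma xi x y)) = H,
      right_invariant G H I1 I2 F,
      forall p, regular_points p -> immersed_at G H I1 I2 F p,
      forall p, regular_points p -> Lagrangian_at G I1 I2 F p &
      exact_map G H I1 I2 F].

Definition exact_Lagrangian_translator : Prop :=
  exact_Lagrangian_immersion /\
  exists2 T : 'cV[C]_(n + 1), T != 0 &
    forall p, regular_points p ->
      mean_curvature_at G I1 I2 F p
        (normal_part (velocities (param_curves G I1 I2) F p) T).

Definition exact_special_Lagrangian : Prop :=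
  exact_Lagrangian_immersion /\
  forall p, regular_points p -> mean_curvature_at G I1 I2 F p 0.

End Conclusions.
End Construction.

(* Main.v *)
(* Pick a nonzero point of the Lagrangian submanifold in the zero level of the
   moment map, normalise it to a unit vector z, and put Psi (u, w) = (u z, w).
   For X, Y in Lie G, isotropy of the orbit says that <X z, Y z> is real, and
   mu (z) = 0 says that <z, X z> = 0; since the cohomogeneity is one, the orbit
   has dimension m - 2, so an orthonormal basis of Lie G z together with z is a
   unitary basis of C^(m-1).  Hence the velocities of F in the directions of the
   orbit, of gamma and of xi are pairwise Hermitian-orthogonal; normalised, they
   form a unitary basis of C^m whose real span is the tangent space of F.  A
   vector v is therefore tangent iff Im <e, v> = 0 for every e in this basis.
   For T = (0, - a), the equation H = T^perp becomes Im <e, A - T> = 0 for all e,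
   where A is the sum of the accelerations of curves tangent to the basis.  For e
   along gamma or xi this is the imaginary part of the curve equation, and for e
   along the orbit it says that the trace of an element of su(m-1) vanishes.
   That elements of Lie G generate one-parameter subgroups of G, needed for the
   dimension of the orbit and for the immersion property, follows from
   exp (t X) = lim c (t / k)^k for any curve c in G with velocity X at 1. *)

Require Import Defs.
From mathcomp Require Import all_boot all_order all_algebra.
From mathcomp Require Import complex ring spectral sesquilinear.
From mathcomp Require Import all_classical all_reals all_analysis.

Set Implicit Arguments.
Unset Strict Implicit.
Unset Printing Implicit Defensive.

Import Order.TTheory GRing.Theory Num.Theory.
Import numFieldNormedType.Exports.

Local Open Scope classical_set_scope.
Local Open Scope ring_scope.

(** * Derivatives of complex curves *)

(** Normalising z may take it out of the Lagrangian submanifold. This is harmless, since only the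
    isotropy of the orbit, <z, X z> = 0 and the stabiliser are used, and all three survive scaling.
    The integrals in the last coordinate of [Fcheck] make the x- and y-velocities
    Hermitian-orthogonal, not merely orthogonal. A unitary frame then exists at every regular point,
    and testing against Im <e, .> discards all tangential terms, so no arc-length parametrisation of
    the curves is needed. The coefficient m - 2 counts the orbit directions: each contributes <z, X
    X z> = - |X z|^2 = - 1. The vector T is found from the last coordinates of the two velocities, -
    conj (gamma) gamma' and conj (xi) xi'. Their opposite signs are matched by the opposite signs of
    a in the two curve equations. Exactness is proved with an explicit primitive. With A and B the
    integrals of conj (gamma) gamma' and conj (xi) xi', the mixed terms of the pulled-back Liouville
    form integrate because d |gamma|^2 = 2 Re dA and d |xi|^2 = 2 Re dB. *)

Section Complex.
Variable R : realType.
Implicit Types (a b : R) (z w : R[i]).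

Lemma ReD z w : complex.Re (z + w) = complex.Re z + complex.Re w.
Proof. by case: z w => [? ?] [? ?]. Qed.

Lemma ImD z w : complex.Im (z + w) = complex.Im z + complex.Im w.
Proof. by case: z w => [? ?] [? ?]. Qed.

Lemma ReN z : complex.Re (- z) = - complex.Re z.
Proof. by case: z => [? ?]. Qed.

Lemma ImN z : complex.Im (- z) = - complex.Im z.
Proof. by case: z => [? ?]. Qed.

Lemma ReM z w : complex.Re (z * w) =
  complex.Re z * complex.Re w - complex.Im z * complex.Im w.
Proof. by case: z w => [? ?] [? ?]. Qed.

Lemma ImM z w : complex.Im (z * w) =
  complex.Re z * complex.Im w + complex.Im z * complex.Re w.
Proof. by case: z w => [? ?] [? ?]. Qed.

Lemma Re_conj z : complex.Re z^* = complex.Re z.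
Proof. by case: z => [? ?]. Qed.

Lemma Im_conj z : complex.Im z^* = - complex.Im z.
Proof. by case: z => [? ?]. Qed.

Lemma ReC a : complex.Re a%:C%C = a. Proof. by []. Qed.
Lemma ImC a : complex.Im a%:C%C = 0. Proof. by []. Qed.
Lemma Re0 : complex.Re (0 : R[i]) = 0. Proof. by []. Qed.
Lemma Im0 : complex.Im (0 : R[i]) = 0. Proof. by []. Qed.
Lemma Re1 : complex.Re (1 : R[i]) = 1. Proof. by []. Qed.
Lemma Im1 : complex.Im (1 : R[i]) = 0. Proof. by []. Qed.

Lemma ReI : complex.Re ('i%C : R[i]) = 0. Proof. by []. Qed.
Lemma ImI : complex.Im ('i%C : R[i]) = 1. Proof. by []. Qed.
(* [ReI] and [ImI] come before the rules for constants, whose left-hand sides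
   unify with ['i] up to conversion. *)
Definition ReImE := (ReD, ImD, ReN, ImN, ReM, ImM, Re_conj, Im_conj, ReI, ImI,
  Re1, Im1, Re0, Im0, ReC, ImC).

Lemma complexP z w : complex.Re z = complex.Re w ->
  complex.Im z = complex.Im w -> z = w.
Proof. by case: z w => [? ?] [? ?] /= -> ->. Qed.

Lemma Re_sum (I : Type) (r : seq I) (P : pred I) (F : I -> R[i]) :
  complex.Re (\sum_(i <- r | P i) F i) = \sum_(i <- r | P i) complex.Re (F i).
Proof. exact: (big_morph _ ReD Re0). Qed.

Lemma Im_sum (I : Type) (r : seq I) (P : pred I) (F : I -> R[i]) :
  complex.Im (\sum_(i <- r | P i) F i) = \sum_(i <- r | P i) complex.Im (F i).
Proof. exact: (big_morph _ ImD Im0). Qed.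

End Complex.

Section ComplexDerivatives.
Variable R : realType.
Local Notation C := R[i].
Implicit Types (t : R) (c : R -> C).

(** A relation that includes existence, since [cderiv] is total and has a value even where the curve
    is not differentiable. *)
Definition is_cderive c t (d : C) : Prop :=
  is_derive t 1 (fun s => complex.Re (c s)) (complex.Re d) /\
  is_derive t 1 (fun s => complex.Im (c s)) (complex.Im d).

Lemma is_derive_ext (f g : R -> R) t (df dg : R) : is_derive t 1 f df ->
  f =1 g -> df = dg -> is_derive t 1 g dg.
Proof. by move=> + /funext <- <-. Qed.

Lemma is_deriveMr (f g : R -> R) t (df dg : R) : is_derive t 1 f df ->
  is_derive t 1 g dg ->
  is_derive t 1 (fun s => f s * g s) (df * g t + f t * dg).
Proof.
move=> Df Dg; apply: (is_derive_ext (is_deriveM Df Dg)) => //.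
by rewrite /GRing.scale /= addrC mulrC.
Qed.

Lemma derivable1_is_derive (f : R -> R) t : derivable f t 1 ->
  is_derive t 1 f (derive1 f t).
Proof. by move=> Df; rewrite derive1E; exact: derivableP. Qed.

Lemma is_derive1_derive1 (f : R -> R) t d : is_derive t 1 f d -> derive1 f t = d.
Proof. by move=> Df; rewrite derive1E; exact: derive_val. Qed.

Lemma is_cderive_cderiv c t d : is_cderive c t d -> cderiv c t = d.
Proof.
by case=> D1 D2; rewrite /cderiv (is_derive1_derive1 D1) (is_derive1_derive1 D2);
  case: d {D1 D2}.
Qed.

Lemma smooth_is_cderive (I : set R) c t : smooth_ccurve I c -> I t ->
  is_cderive c t (cderiv c t).
Proof.
by case=> Sr Si It; split; apply: derivable1_is_derive; [exact: (Sr 0%N)|exact: (Si 0%N)].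
Qed.

Lemma smooth_cderiv (I : set R) c : smooth_ccurve I c ->
  smooth_ccurve I (cderiv c).
Proof.
by case=> Sr Si; split => k t It; [have := Sr k.+1 t It|have := Si k.+1 t It];
  rewrite derive1Sn.
Qed.

Lemma is_cderive_near c1 c2 t d : (\near t, c1 t = c2 t) ->
  is_cderive c1 t d -> is_cderive c2 t d.
Proof.
by move=> E [D1 D2]; split; [apply: near_eq_is_derive D1|apply: near_eq_is_derive D2];
  apply: filterS E => s ->.
Qed.

Lemma is_cderive_eq c1 c2 t d1 d2 : is_cderive c1 t d1 -> c1 =1 c2 ->
  d1 = d2 -> is_cderive c2 t d2.
Proof. by move=> + /funext <- <-. Qed.

Lemma is_cderive_cst z t : is_cderive (fun=> z) t 0.
Proof. by split; exact: is_derive_cst. Qed.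

Lemma is_cderive_realfun (f : R -> R) t d : is_derive t 1 f d ->
  is_cderive (fun s => (f s)%:C%C) t d%:C%C.
Proof. by split => //; exact: is_derive_cst. Qed.

Lemma is_cderiveD c1 c2 t d1 d2 : is_cderive c1 t d1 -> is_cderive c2 t d2 ->
  is_cderive (fun s => c1 s + c2 s) t (d1 + d2).
Proof.
move=> [Dr1 Di1] [Dr2 Di2]; split.
  by apply: (is_derive_ext (is_deriveD Dr1 Dr2)) => [s|]; rewrite ReImE.
by apply: (is_derive_ext (is_deriveD Di1 Di2)) => [s|]; rewrite ReImE.
Qed.

Lemma is_cderiveN c t d : is_cderive c t d -> is_cderive (fun s => - c s) t (- d).
Proof.
move=> [Dr Di]; split.
  by apply: (is_derive_ext (is_deriveN Dr)) => [s|]; rewrite ReImE.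
by apply: (is_derive_ext (is_deriveN Di)) => [s|]; rewrite ReImE.
Qed.

Lemma is_cderiveB c1 c2 t d1 d2 : is_cderive c1 t d1 -> is_cderive c2 t d2 ->
  is_cderive (fun s => c1 s - c2 s) t (d1 - d2).
Proof. by move=> D1 D2; apply: is_cderiveD => //; exact: is_cderiveN. Qed.

Lemma is_cderiveM c1 c2 t d1 d2 : is_cderive c1 t d1 -> is_cderive c2 t d2 ->
  is_cderive (fun s => c1 s * c2 s) t (d1 * c2 t + c1 t * d2).
Proof.
move=> [Dr1 Di1] [Dr2 Di2]; split.
  apply: (is_derive_ext (is_deriveB (is_deriveMr Dr1 Dr2) (is_deriveMr Di1 Di2)))
    => [s|]; rewrite !ReImE //; ring.
apply: (is_derive_ext (is_deriveD (is_deriveMr Dr1 Di2) (is_deriveMr Di1 Dr2)))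
  => [s|]; rewrite !ReImE //; ring.
Qed.

Lemma is_cderiveZ z c t d : is_cderive c t d -> is_cderive (fun s => z * c s) t (z * d).
Proof.
move=> D; apply: (is_cderive_eq (is_cderiveM (is_cderive_cst z t) D)) => //.
by rewrite mul0r add0r.
Qed.

Lemma is_cderive_conj c t d : is_cderive c t d ->
  is_cderive (fun s => (c s)^*) t d^*.
Proof.
move=> [Dr Di]; split; first by apply: (is_derive_ext Dr) => [s|]; rewrite Re_conj.
by apply: (is_derive_ext (is_deriveN Di)) => [s|]; rewrite Im_conj.
Qed.

Lemma is_cderive_sum (I : Type) (r : seq I) (P : pred I) (c : I -> R -> C) t
    (d : I -> C) : (forall i, is_cderive (c i) t (d i)) ->
  is_cderive (fun s => \sum_(i <- r | P i) c i s) t (\sum_(i <- r | P i) d i).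
Proof.
move=> D; elim: r => [|i r IH].
  by apply: (is_cderive_eq (is_cderive_cst 0 t)) => [s|]; rewrite big_nil.
case Pi: (P i); last by apply: (is_cderive_eq IH) => [s|]; rewrite big_cons Pi.
by apply: (is_cderive_eq (is_cderiveD (D i) IH)) => [s|]; rewrite big_cons Pi.
Qed.

Lemma is_cderive_comp c (f : R -> R) t d df : is_cderive c (f t) d ->
  is_derive t 1 f df -> is_cderive (fun s => c (f s)) t (df%:C%C * d).
Proof.
move=> [Dr Di] Df; split; rewrite !ReImE mul0r ?subr0 ?addr0.
  by apply: (is_derive_ext (is_derive1_comp Dr Df)) => //; rewrite mulrC.
by apply: (is_derive_ext (is_derive1_comp Di Df)) => //; rewrite mulrC.
Qed.

End ComplexDerivatives.

Section MatrixDerivatives.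
Variable R : realType.
Local Notation C := R[i].

Definition is_mxderive (p q : nat) (c : R -> 'M[C]_(p, q)) (t : R)
    (D : 'M[C]_(p, q)) : Prop :=
  forall i j, is_cderive (fun s => c s i j) t (D i j).

Lemma is_mxderive_mxderiv p q (c : R -> 'M[C]_(p, q)) t D :
  is_mxderive c t D -> mxderiv c t = D.
Proof.
by move=> H; apply/matrixP => i j; rewrite mxE; exact: is_cderive_cderiv.
Qed.

Lemma smooth_is_mxderive p q (I : set R) (c : R -> 'M[C]_(p, q)) t :
  smooth_mxcurve I c -> I t -> is_mxderive c t (mxderiv c t).
Proof. by move=> Sc It i j; rewrite mxE; exact: smooth_is_cderive (Sc i j) It. Qed.

Lemma is_mxderive_near p q (c1 c2 : R -> 'M[C]_(p, q)) t D :
  (\near t, c1 t = c2 t) -> is_mxderive c1 t D -> is_mxderive c2 t D.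
Proof.
by move=> E D1 i j; apply: is_cderive_near (D1 i j); apply: filterS E => s ->.
Qed.

Lemma is_mxderive_eq p q (c1 c2 : R -> 'M[C]_(p, q)) t D1 D2 :
  is_mxderive c1 t D1 -> c1 =1 c2 -> D1 = D2 -> is_mxderive c2 t D2.
Proof. by move=> + /funext <- <-. Qed.

Lemma is_mxderive_cst p q (A : 'M[C]_(p, q)) t : is_mxderive (fun=> A) t 0.
Proof. by move=> i j; rewrite mxE; exact: is_cderive_cst. Qed.

Lemma is_mxderiveD p q (c1 c2 : R -> 'M[C]_(p, q)) t D1 D2 :
  is_mxderive c1 t D1 -> is_mxderive c2 t D2 ->
  is_mxderive (fun s => c1 s + c2 s) t (D1 + D2).
Proof.
move=> H1 H2 i j.
by apply: (is_cderive_eq (is_cderiveD (H1 i j) (H2 i j))) => [s|]; rewrite mxE.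
Qed.

Lemma is_mxderiveB p q (c1 c2 : R -> 'M[C]_(p, q)) t D1 D2 :
  is_mxderive c1 t D1 -> is_mxderive c2 t D2 ->
  is_mxderive (fun s => c1 s - c2 s) t (D1 - D2).
Proof.
move=> H1 H2 i j.
by apply: (is_cderive_eq (is_cderiveB (H1 i j) (H2 i j))) => [s|]; rewrite !mxE.
Qed.

Lemma is_mxderiveZ p q (f : R -> C) (c : R -> 'M[C]_(p, q)) t d D :
  is_cderive f t d -> is_mxderive c t D ->
  is_mxderive (fun s => f s *: c s) t (d *: c t + f t *: D).
Proof.
move=> H1 H2 i j.
by apply: (is_cderive_eq (is_cderiveM H1 (H2 i j))) => [s|]; rewrite !mxE.
Qed.

Lemma is_mxderiveM p q r (c1 : R -> 'M[C]_(p, q)) (c2 : R -> 'M[C]_(q, r)) t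
    D1 D2 : is_mxderive c1 t D1 -> is_mxderive c2 t D2 ->
  is_mxderive (fun s => c1 s *m c2 s) t (D1 *m c2 t + c1 t *m D2).
Proof.
move=> H1 H2 i j.
have H l := is_cderiveM (H1 i l) (H2 l j).
apply: (is_cderive_eq (is_cderive_sum (index_enum 'I_q) xpredT H)) => [s|];
  by rewrite !mxE // -big_split.
Qed.

Lemma is_mxderiveMl p q r (A : 'M[C]_(p, q)) (c : R -> 'M[C]_(q, r)) t D :
  is_mxderive c t D -> is_mxderive (fun s => A *m c s) t (A *m D).
Proof.
move=> H; apply: (is_mxderive_eq (is_mxderiveM (is_mxderive_cst A t) H)) => //.
by rewrite mul0mx add0r.
Qed.

Lemma is_mxderiveMr p q r (c : R -> 'M[C]_(p, q)) (A : 'M[C]_(q, r)) t D :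
  is_mxderive c t D -> is_mxderive (fun s => c s *m A) t (D *m A).
Proof.
move=> H; apply: (is_mxderive_eq (is_mxderiveM H (is_mxderive_cst A t))) => //.
by rewrite mulmx0 addr0.
Qed.

Lemma is_mxderive_adj p q (c : R -> 'M[C]_(p, q)) t D : is_mxderive c t D ->
  is_mxderive (fun s => (c s)^t*%sesqui) t (D^t*)%sesqui.
Proof.
move=> H i j.
by apply: (is_cderive_eq (is_cderive_conj (H j i))) => [s|]; rewrite !mxE.
Qed.

End MatrixDerivatives.

(** * Smoothness of affine, trigonometric and matrix-valued curves *)

Section Smoothness.
Variable R : realType.
Local Notation C := R[i].
Implicit Types (I : set R) (f g : R -> R).

(** A class stable under differentiation contains all iterated derivatives of its members, so
    exhibiting such a class replaces an induction on the order of differentiation. *)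
Lemma smooth_on_derivation_closed (P : (R -> R) -> Prop) I f :
  (forall f, P f -> exists2 g, P g & forall t : R, is_derive t 1 f (g t)) ->
  P f -> smooth_on I f.
Proof.
move=> HP Pf.
have {}HP h : P h -> (forall t, derivable h t 1) /\ P (derive1 h).
  move=> /HP[g Pg Dg]; split; first by move=> t; apply: ex_derive.
  suff -> : derive1 h = g by [].
  by apply/funext => t; exact: is_derive1_derive1.
move=> k t _; suff: P (derive1n k f) by move=> /HP[+ _]; apply.
by elim: k => // k IH; rewrite derive1nS; exact: (HP _ IH).2.
Qed.

Lemma smooth_on_affine I (x r : R) : smooth_on I (fun t => x + t * r).
Proof.
apply: (@smooth_on_derivation_closed
  (fun f => exists x r : R, f = (fun t => x + t * r))); last by exists x, r.
move=> _ [y [s ->]]; exists (fun t => s + t * 0); first by exists s, 0.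
move=> t.
apply: (is_derive_ext (is_deriveD (is_derive_cst y t 1)
  (is_deriveMr (is_derive_id t 1) (is_derive_cst s t 1)))) => //; cbn; ring.
Qed.

Lemma is_derive_cos_scale (th t : R) :
  is_derive t 1 (fun s => cos (s * th)) (- sin (t * th) * th).
Proof.
have D : is_derive t 1 (fun s => s * th) th.
  apply: (is_derive_ext (is_deriveMr (is_derive_id t 1) (is_derive_cst th t 1))) => //.
  by rewrite mulr0 addr0 mul1r.
exact: (is_derive1_comp (is_derive_cos _) D).
Qed.

Lemma is_derive_sin_scale (th t : R) :
  is_derive t 1 (fun s => sin (s * th)) (cos (t * th) * th).
Proof.
have D : is_derive t 1 (fun s => s * th) th.
  apply: (is_derive_ext (is_deriveMr (is_derive_id t 1) (is_derive_cst th t 1))) => //.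
  by rewrite mulr0 addr0 mul1r.
exact: (is_derive1_comp (is_derive_sin _) D).
Qed.

Lemma smooth_on_trig I (th a b : R) :
  smooth_on I (fun t => a * cos (t * th) + b * sin (t * th)).
Proof.
apply: (@smooth_on_derivation_closed
  (fun f => exists a b : R, f = (fun t => a * cos (t * th) + b * sin (t * th))));
  last by exists a, b.
move=> _ [{}a [{}b ->]].
exists (fun t => (b * th) * cos (t * th) + (- a * th) * sin (t * th)).
  by exists (b * th), (- a * th).
move=> t.
apply: (is_derive_ext (is_deriveD (is_deriveZ a (is_derive_cos_scale th t))
   (is_deriveZ b (is_derive_sin_scale th t)))) => //.
by rewrite /GRing.scale /=; ring.
Qed.

Section OpenDomain.
Variable I : set R.
Hypothesis oI : open I.

(** The iterated derivatives add up only on I. Openness of I turns equality on I into equality near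
    each of its points, which the next differentiation requires. *)
Lemma smooth_onD f g : smooth_on I f -> smooth_on I g ->
  smooth_on I (fun t => f t + g t).
Proof.
move=> Sf Sg.
have E k : forall t, I t ->
    derive1n k (fun t => f t + g t) t = derive1n k f t + derive1n k g t.
  elim: k => // k IH t It.
  rewrite !derive1nS; apply: is_derive1_derive1.
  have D := is_deriveD (derivable1_is_derive (Sf k t It))
                       (derivable1_is_derive (Sg k t It)).
  apply: near_eq_is_derive D.
  by have := open_nbhs_nbhs (conj oI It); apply: filterS => s Is; rewrite IH.
move=> k t It; apply: ex_derive.
  apply: near_eq_is_derive (is_deriveD (derivable1_is_derive (Sf k t It))
                       (derivable1_is_derive (Sg k t It))).
by have := open_nbhs_nbhs (conj oI It); apply: filterS => s Is; rewrite E.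
Qed.

Lemma smooth_onZ (a : R) f : smooth_on I f -> smooth_on I (fun t => a * f t).
Proof.
move=> Sf.
have E k : forall t, I t ->
    derive1n k (fun t => a * f t) t = a * derive1n k f t.
  elim: k => // k IH t It.
  rewrite !derive1nS; apply: is_derive1_derive1.
  have D := is_deriveZ a (derivable1_is_derive (Sf k t It)).
  apply: near_eq_is_derive D.
  by have := open_nbhs_nbhs (conj oI It); apply: filterS => s Is; rewrite IH.
move=> k t It; apply: ex_derive.
  apply: near_eq_is_derive (is_deriveZ a (derivable1_is_derive (Sf k t It))).
by have := open_nbhs_nbhs (conj oI It); apply: filterS => s Is; rewrite E.
Qed.

Lemma smooth_ccurveD (c1 c2 : R -> C) : smooth_ccurve I c1 ->
  smooth_ccurve I c2 -> smooth_ccurve I (fun t => c1 t + c2 t).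
Proof.
move=> [S1 T1] [S2 T2]; split.
  by under eq_fun do rewrite ReD; exact: smooth_onD.
by under eq_fun do rewrite ImD; exact: smooth_onD.
Qed.

Lemma smooth_ccurveZ (z : C) c : smooth_ccurve I c ->
  smooth_ccurve I (fun t => z * c t).
Proof.
move=> [S1 S2]; split.
  under eq_fun do rewrite ReM -mulNr; apply: smooth_onD; exact: smooth_onZ.
under eq_fun do rewrite ImM; apply: smooth_onD; exact: smooth_onZ.
Qed.

Lemma smooth_ccurve_cst (z : C) : smooth_ccurve I (fun=> z).
Proof.
have H (x : R) : smooth_on I (fun=> x).
  by have := @smooth_on_affine I x 0; under eq_fun do rewrite mulr0 addr0.
by split; exact: H.
Qed.

Lemma smooth_ccurve_sum (J : Type) (r : seq J) (P : pred J) (c : J -> R -> C) :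
  (forall j, smooth_ccurve I (c j)) ->
  smooth_ccurve I (fun t => \sum_(j <- r | P j) c j t).
Proof.
move=> H; elim: r => [|j r IH].
  by under eq_fun do rewrite big_nil; exact: smooth_ccurve_cst.
under eq_fun do rewrite big_cons.
by case: (P j); [exact: smooth_ccurveD|exact: IH].
Qed.

Lemma smooth_mxcurveMl p q r (A : 'M[C]_(p, q)) (c : R -> 'M[C]_(q, r)) :
  smooth_mxcurve I c -> smooth_mxcurve I (fun t => A *m c t).
Proof.
move=> H i j; under eq_fun do rewrite mxE.
by apply: smooth_ccurve_sum => l; exact: smooth_ccurveZ.
Qed.

Lemma smooth_mxcurveMr p q r (c : R -> 'M[C]_(p, q)) (A : 'M[C]_(q, r)) :
  smooth_mxcurve I c -> smooth_mxcurve I (fun t => c t *m A).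
Proof.
move=> H i j; under eq_fun do rewrite mxE.
apply: smooth_ccurve_sum => l; under eq_fun do rewrite mulrC.
exact: smooth_ccurveZ.
Qed.

End OpenDomain.
End Smoothness.

(** * The signed integral *)

Section SignedIntegral.
Variable R : realType.
Local Notation mu := (@lebesgue_measure R).

Lemma open_interval_around (I : set R) x y : open I -> I x -> I y ->
  exists a b, [/\ I a, I b, a < Num.min x y & Num.max x y < b].
Proof.
move=> oI.
have key z : I z -> exists a b, [/\ I a, I b, a < z & z < b].
  move=> Iz; have /nbhs_ballP[e /= e0 He] := open_nbhs_nbhs (conj oI Iz).
  exists (z - e / 2), (z + e / 2); split; last 2 first.
  - by rewrite ltrBlDr ltrDl divr_gt0.
  - by rewrite ltrDl divr_gt0.
  - apply: He; rewrite /ball /= opprB addrC subrK gtr0_norm ?divr_gt0 //.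
    by rewrite ltr_pdivrMr // ltr_pMr // ltr1n.
  - apply: He; rewrite /ball /= opprD addrA subrr sub0r normrN gtr0_norm ?divr_gt0 //.
    by rewrite ltr_pdivrMr // ltr_pMr // ltr1n.
by move=> Ix Iy; case: (leP x y) => _; [have [a [b [Ia Ib ax xb]]] := key x Ix;
  have [a' [b' [Ia' Ib' ax' xb']]] := key y Iy; exists a, b'
 |have [a [b [Ia Ib ax xb]]] := key y Iy;
  have [a' [b' [Ia' Ib' ax' xb']]] := key x Ix; exists a, b'].
Qed.

(** With a base point a to the left of both 0 and x, the signed integral is P t - P 0, where P t is
    the integral from a. This absorbs the sign convention and the change of definition at 0. *)
Lemma is_derive_int0 (I : set R) (f : R -> R) (x : R) :
  open I -> is_interval I -> I 0 -> (forall t, I t -> {for t, continuous f}) ->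
  I x -> is_derive x 1 (int0 f) (f x).
Proof.
move=> oI iI I0 cf Ix.
have [a [b [Ia Ib]]] := open_interval_around oI I0 Ix.
rewrite lt_min gt_max => /andP[a0 ax] /andP[b0 xb].
have sub t : a <= t <= b -> I t by move=> atb; exact: iI atb.
have intf : mu.-integrable `[a, b] (EFin \o f).
  apply: continuous_compact_integrable; first exact: segment_compact.
  apply: continuous_in_subspaceT => t.
  by rewrite inE /= in_itv /= => /sub/cf.
pose P t := \int[mu]_(s in `[a, t]) f s.
have DP t : a < t < b -> is_derive t 1 P (f t).
  move=> /andP[at_ tb].
  have It : I t by apply: sub; rewrite !ltW.
  have [dP <-] := continuous_FTC1_closed tb intf at_ (cf t It).
  exact: derivable1_is_derive.
have cP t : a < t < b -> {for t, continuous P}.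
  by move=> atb; apply/differentiable_continuous/derivable1_diffP; apply: ex_derive; exact: DP.
have key u v : a < u -> u <= v -> v < b ->
    \int[mu]_(s in `[u, v]) f s = P v - P u.
  move=> au; rewrite le_eqVlt => /orP[/eqP-> _|uv vb].
    by rewrite set_itv1 Rintegral_set1 subrr.
  have := @continuous_FTC2 R f P u v uv.
  rewrite /Rintegral => -> //.
  - apply: continuous_in_subspaceT => t; rewrite inE /= in_itv /= => /andP[ut tv].
    by apply/cf/sub; rewrite (le_trans (ltW au) ut) (le_trans tv (ltW vb)).
  - split.
    + move=> t; rewrite in_itv /= => /andP[ut tv]; apply: ex_derive.
      by apply: DP; rewrite (lt_trans au ut) (lt_trans tv vb).
    + by apply: cvg_at_right_filter; apply: cP; rewrite au (lt_trans uv vb).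
    + by apply: cvg_at_left_filter; apply: cP; rewrite vb (lt_trans au uv).
  - move=> t; rewrite in_itv /= => /andP[ut tv]; apply: is_derive1_derive1.
    by apply: DP; rewrite (lt_trans au ut) (lt_trans tv vb).
apply: near_eq_is_derive; last first.
  have axb : a < x < b by rewrite ax.
  rewrite -[f x]subr0; exact: (is_deriveB (DP x axb) (is_derive_cst (P 0) x 1)).
have oab : open `]a, b[%classic by exact: interval_open.
have : nbhs x `]a, b[%classic.
  by apply: open_nbhs_nbhs; split => //=; rewrite in_itv /= ax.
apply: filterS => t; rewrite /= in_itv /= => /andP[at_ tb].
rewrite /int0; case: ifPn => t0.
  by rewrite key.
by rewrite key ?ltW // ?ltNge //= opprB.
Qed.

End SignedIntegral.

(** * Real linear algebra on complex matrices *)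

Section RealLinearAlgebra.
Variable R : realType.
Local Notation C := R[i].

Lemma gram_schmidt k N (B : 'M[R]_(k, N)) : row_free B ->
  exists2 Q : 'M[R]_(k, N), Q *m Q^T = 1%:M & (Q :=: B)%MS.
Proof.
elim: k B => [|k IH] B fB.
  by exists 0; [apply/matrixP => - []|rewrite (flatmx0 B)].
move: (B) fB; rewrite -[k.+1]/(1 + k)%N => {}B fB.
pose r := usubmx B; pose B' := dsubmx B.
have defB : B = col_mx r B' by rewrite vsubmxK.
have fB' : row_free B'.
  rewrite -kermx_eq0; apply/eqP/row_matrixP => i; rewrite row0.
  apply/eqP; have /eqP : row_mx 0 (row i (kermx B')) *m B = 0.
    rewrite defB mul_row_col mul0mx add0r; apply/eqP.
    by rewrite -row_mul mulmx_ker row0.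
  rewrite mulmx_free_eq0 // => /eqP /(congr1 rsubmx).
  by rewrite row_mxKr => ->; rewrite linear0.
have [Q QQ QB] := IH B' fB'.
pose q := r - r *m Q^T *m Q.
have qQ : q *m Q^T = 0 by rewrite mulmxBl -[_ *m Q *m _]mulmxA QQ mulmx1 subrr.
have q0 : q != 0.
  apply/negP => /eqP /subr0_eq rE.
  have : (r <= B')%MS by rewrite rE -QB submxMl.
  move=> /submxP[D rD].
  have /eqP : row_mx 1%:M (- D) *m B = 0.
    by rewrite defB mul_row_col mul1mx mulNmx rD subrr.
  rewrite mulmx_free_eq0 // => /eqP /(congr1 lsubmx).
  by rewrite row_mxKl linear0 => /eqP; rewrite oner_eq0.
pose s := (q *m q^T) 0 0.
have sE : q *m q^T = s%:M by rewrite [LHS]mx11_scalar.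
have sqE : s = \sum_j q 0 j ^+ 2.
  by rewrite /s [LHS]mxE; apply: eq_bigr => j _; rewrite [q^T _ _]mxE.
have s_gt0 : 0 < s.
  rewrite lt_def sqE sumr_ge0 ?andbT => [|i _]; last exact: sqr_ge0.
  apply: contra q0; rewrite psumr_eq0 => [/allP H|i _]; last exact: sqr_ge0.
  apply/eqP/rowP => j; have /= := H j (mem_index_enum _).
  by rewrite sqrf_eq0 [RHS]mxE => /eqP.
pose c := (Num.sqrt s)^-1.
have c0 : c != 0 by rewrite invr_eq0 gt_eqF // sqrtr_gt0.
exists (col_mx (c *: q) Q).
  have E1 : (c *: q) *m (c *: q)^T = 1%:M.
    rewrite linearZ /= -scalemxAl -scalemxAr sE !scale_scalar_mx mulrA.
    by rewrite /c -invfM -expr2 sqr_sqrtr ?ltW // mulVf ?gt_eqF.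
  have E2 : (c *: q) *m Q^T = 0 by rewrite -scalemxAl qQ scaler0.
  have E3 : Q *m (c *: q)^T = 0.
    by apply: trmx_inj; rewrite trmx_mul trmxK E2 trmx0.
  by rewrite tr_col_mx mul_col_row QQ E1 E2 E3 -scalar_mx_block.
apply/eqmxP/andP; split.
  rewrite col_mx_sub scalemx_sub; last first.
    rewrite /q addmx_sub ?eqmx_opp //; first by rewrite defB -addsmxE addsmxSl.
    by rewrite (submx_trans (submxMl _ _)) // QB defB -addsmxE addsmxSr.
  by rewrite QB defB -addsmxE addsmxSr.
have QB2 : (B' <= Q)%MS by rewrite QB.
rewrite {1}defB col_mx_sub -!addsmxE (submx_trans QB2 (addsmxSr _ _)) andbT.
have -> : r = c^-1 *: (c *: q) + r *m Q^T *m Q.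
  by rewrite scalerA mulVf // scale1r /q subrK.
apply: addmx_sub; first by rewrite scalemx_sub // addsmxSl.
by rewrite (submx_trans (submxMl _ _)) // addsmxSr.
Qed.

Section Realify.
Variables p q : nat.
Implicit Types u v : 'M[C]_(p, q).

Lemma realifyD u v : realify (u + v) = realify u + realify v.
Proof.
rewrite /realify add_row_mx -!linearD /=; congr (row_mx (mxvec _) (mxvec _));
  by apply/matrixP => i j; rewrite !mxE ReImE.
Qed.

Lemma realifyZ (a : R) u : realify (a%:C%C *: u) = a *: realify u.
Proof.
rewrite /realify scale_row_mx -!linearZ /=; congr (row_mx (mxvec _) (mxvec _));
  by apply/matrixP => i j; rewrite !mxE ReImE mul0r ?subr0 ?addr0.
Qed.

Lemma realify_inj : injective (@realify R p q).
Proof.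
move=> u v /eq_row_mx[/(can_inj mxvecK) E1 /(can_inj mxvecK) E2].
apply/matrixP => i j; apply: complexP.
  by move/matrixP/(_ i j) : E1; rewrite !mxE.
by move/matrixP/(_ i j) : E2; rewrite !mxE.
Qed.

Lemma realify_surj (r : 'rV[R]_(p * q + p * q)) : exists u, realify u = r.
Proof.
exists (\matrix_(i, j) (vec_mx (lsubmx r) i j +i* vec_mx (rsubmx r) i j)%C).
rewrite /realify -[RHS]hsubmxK -[lsubmx r in RHS]vec_mxK -[rsubmx r in RHS]vec_mxK.
by congr (row_mx (mxvec _) (mxvec _)); apply/matrixP => i j; rewrite !mxE.
Qed.

Lemma realify0 : realify (0 : 'M[C]_(p, q)) = 0.
Proof.
have := realifyZ 0 0; rewrite scaler0 => ->; exact: scale0r.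
Qed.

Lemma mxinner_realify u v : mxinner u v = (realify u *m (realify v)^T) 0 0.
Proof.
have key (A B : 'M[R]_(p, q)) :
    (mxvec A *m (mxvec B)^T) 0 0 = \sum_i \sum_j A i j * B i j.
  rewrite mxE pair_bigA /= (reindex _ (curry_mxvec_bij _ _)) /=.
  by apply: eq_bigr => - [i j] _; rewrite mxE !mxvecE.
rewrite /realify tr_row_mx mul_row_col mxE !key -big_split /=.
by apply: eq_bigr => i _; rewrite -big_split; apply: eq_bigr => j _; rewrite !mxE.
Qed.

Lemma mxinnerDl u v w : mxinner (u + v) w = mxinner u w + mxinner v w.
Proof. by rewrite !mxinner_realify realifyD mulmxDl mxE. Qed.

Lemma mxinnerZl (a : R) u w : mxinner (a%:C%C *: u) w = a * mxinner u w.
Proof. by rewrite !mxinner_realify realifyZ -scalemxAl mxE. Qed.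

Lemma mxinnerC u v : mxinner u v = mxinner v u.
Proof.
by apply: eq_bigr => i _; apply: eq_bigr => j _; congr (_ + _); rewrite mulrC.
Qed.

Lemma mxinner_eq0 u : mxinner u u = 0 -> u = 0.
Proof.
have ge0 i j : 0 <= complex.Re (u i j) * complex.Re (u i j)
                    + complex.Im (u i j) * complex.Im (u i j).
  by rewrite addr_ge0 // -expr2 sqr_ge0.
move=> /eqP; rewrite psumr_eq0 => [/allP H|i _]; last exact: sumr_ge0.
apply/matrixP => i j; have /= := H i (mem_index_enum _).
rewrite psumr_eq0 // => /allP/(_ j (mem_index_enum _)) /=.
rewrite paddr_eq0 -?expr2 ?sqr_ge0 // !sqrf_eq0 => /andP[/eqP Er /eqP Ei].
by apply: complexP; rewrite mxE.
Qed.

Section Combinations.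
Variable k : nat.
Implicit Types (r s : 'I_k -> R) (e : 'I_k -> 'M[C]_(p, q)).

Definition rlincomb r e := \sum_i (r i)%:C%C *: e i.

Lemma realify_rlincomb r e :
  realify (rlincomb r e) = (\row_i r i) *m \matrix_i realify (e i).
Proof.
rewrite mulmx_sum_row (big_morph _ realifyD realify0).
by apply: eq_bigr => i _; rewrite realifyZ mxE rowK.
Qed.

Lemma mxinner_rlincomb r e u : mxinner (rlincomb r e) u = \sum_i r i * mxinner (e i) u.
Proof.
rewrite /rlincomb; have H0 : mxinner 0 u = 0.
  by rewrite mxinner_realify realify0 mul0mx mxE.
rewrite (big_morph (fun x => mxinner x u) (fun x y => mxinnerDl x y u) H0).
by apply: eq_bigr => i _; rewrite mxinnerZl.
Qed.

Definition rorthonormal e := forall i j, mxinner (e i) (e j) = (i == j)%:R.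

Lemma rlincomb_coord r e i : rorthonormal e -> mxinner (rlincomb r e) (e i) = r i.
Proof.
move=> oe; rewrite mxinner_rlincomb (bigD1 i) //= oe eqxx mulr1 big1 ?addr0 // => j.
by move=> ji; rewrite oe (negbTE ji) mulr0.
Qed.

Lemma has_dim_rlincomb (S : set 'M[C]_(p, q)) e : rorthonormal e ->
  (forall u, S u <-> exists r, u = rlincomb r e) -> has_dim S k.
Proof.
move=> oe HS; exists (\matrix_i realify (e i)); split.
  apply/row_freeP; exists (\matrix_i realify (e i))^T.
  apply/matrixP => i j; rewrite !mxE -oe mxinner_realify mxE.
  by apply: eq_bigr => l _; rewrite !mxE.
move=> u; split => [/HS[r ->]|/submxP[D uD]]; first by rewrite realify_rlincomb submxMl.
apply/HS; exists (D 0); apply: realify_inj; rewrite uD realify_rlincomb.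
by congr (_ *m _); apply/rowP => i; rewrite mxE.
Qed.

Lemma rlincomb_delta e i : rlincomb (fun j => (j == i)%:R) e = e i.
Proof.
rewrite /rlincomb (bigD1 i) //= eqxx big1 ?addr0; last first.
  by move=> j /negbTE ->; exact: scale0r.
exact: scale1r.
Qed.

Lemma mxinnerBl u v w : mxinner (u - v) w = mxinner u w - mxinner v w.
Proof. by apply/eqP; rewrite eq_sym subr_eq -mxinnerDl subrK. Qed.

(** [orth_proj] is picked by [xget]. On the span of an orthonormal family its defining property has
    a unique solution, which makes the choice explicit. *)
Lemma orth_proj_rlincomb (S : set 'M[C]_(p, q)) e v : rorthonormal e ->
  (forall u, S u <-> exists r, u = rlincomb r e) ->
  orth_proj S v = rlincomb (fun i => mxinner v (e i)) e.
Proof.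
move=> oe HS; apply: xget_unique => [|y [/HS[s ->] H]].
  split; first by apply/HS; eexists.
  move=> _ /HS[r ->]; rewrite mxinnerC mxinner_rlincomb big1 // => i _.
  by rewrite mxinnerC mxinnerBl rlincomb_coord // subrr mulr0.
congr (rlincomb _ e); apply/funext => i; apply/esym/eqP; rewrite -subr_eq0.
have Se : S (e i) by apply/HS; exists (fun j => (j == i)%:R); rewrite rlincomb_delta.
by rewrite -(H _ Se) mxinnerBl rlincomb_coord.
Qed.

Lemma rlincomb_row r (M : 'M[R]_(k, p * q + p * q)) e :
  (forall i, realify (e i) = row i M) ->
  realify (rlincomb r e) = (\row_i r i) *m M.
Proof.
move=> eM; rewrite realify_rlincomb; congr (_ *m _).
by apply/row_matrixP => i; rewrite rowK eM.
Qed.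

End Combinations.

Lemma has_dim_basis (S : set 'M[C]_(p, q)) k : has_dim S k ->
  exists2 e : 'I_k -> 'M[C]_(p, q), rorthonormal e &
    forall u, S u <-> exists r, u = rlincomb r e.
Proof.
case=> B [/gram_schmidt[Q QQ QB] SB].
have [e eQ] : exists e : 'I_k -> 'M[C]_(p, q), forall i, realify (e i) = row i Q.
  have /choice : forall i, exists u : 'M[C]_(p, q), realify u = row i Q.
    by move=> i; exact: realify_surj.
  by case=> e eQ; exists e.
exists e.
  move=> i j; rewrite mxinner_realify !eQ.
  have /matrixP/(_ i j) := QQ; rewrite !mxE => <-.
  by apply: eq_bigr => l _; rewrite !mxE.
move=> u; rewrite SB; split.
  rewrite -QB => /submxP[D uD]; exists (D 0); apply: realify_inj.
  by rewrite (rlincomb_row _ eQ) uD; congr (_ *m _); apply/rowP => i; rewrite mxE.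
by case=> r ->; rewrite (rlincomb_row _ eQ) -QB submxMl.
Qed.

Lemma has_dim_rlincomb_closed (S : set 'M[C]_(p, q)) d k (r : 'I_k -> R)
    (X : 'I_k -> 'M[C]_(p, q)) : has_dim S d -> (forall j, S (X j)) ->
  S (rlincomb r X).
Proof.
move=> [B [_ SB]] SX; apply/SB; rewrite realify_rlincomb; apply: submx_trans (submxMl _ _) _.
by apply/row_subP => j; rewrite rowK; exact/SB.
Qed.

End Realify.

Section RankNullity.
Variables p q p' q' : nat.
Variable phi : 'M[C]_(p, q) -> 'M[C]_(p', q').
Hypothesis phiD : {morph phi : u v / u + v}.
Hypothesis phiZ : forall (a : R) u, phi (a%:C%C *: u) = a%:C%C *: phi u.

Lemma phi_rlincomb k (r : 'I_k -> R) e : phi (rlincomb r e) = rlincomb r (phi \o e).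
Proof.
rewrite /rlincomb (big_morph phi phiD (id1 := 0)).
  by apply: eq_bigr => i _; rewrite phiZ.
by have := phiZ 0 0; rewrite [_ *: 0]scaler0 => ->; exact: scale0r.
Qed.

(** In an orthonormal basis of S the map becomes a real matrix M, and the coordinates L of a basis
    of the kernel span [kermx M]. The inequality b <= a, which the truncated subtraction asks for,
    comes out of b = a - rank M. *)
Lemma has_dim_rank_nullity (S : set 'M[C]_(p, q)) a b :
  has_dim S a -> has_dim [set u | S u /\ phi u = 0] b ->
  has_dim (phi @` S) (a - b).
Proof.
move=> /has_dim_basis[e oe Se] /has_dim_basis[f of_ Sf].
pose M : 'M[R]_(a, _) := \matrix_i realify (phi (e i)).
pose L : 'M[R]_(b, a) := \matrix_(i, j) mxinner (f i) (e j).
have fE i : f i = rlincomb (L i) e.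
  have [/Se[r fr] _] : S (f i) /\ phi (f i) = 0.
    by apply/(Sf (f i)); exists (fun j => (j == i)%:R); rewrite rlincomb_delta.
  by rewrite fr; congr rlincomb; apply/funext => j; rewrite mxE fr rlincomb_coord.
have phiM r : realify (phi (rlincomb r e)) = (\row_i r i) *m M.
  rewrite phi_rlincomb; apply: rlincomb_row => i; by rewrite rowK.
have LL : L *m L^T = 1%:M.
  apply/matrixP => i j; rewrite !mxE -of_ [in RHS](fE i) mxinner_rlincomb.
  by apply: eq_bigr => l _; rewrite !mxE (mxinnerC (e l)).
have fL : row_free L by apply/row_freeP; exists L^T.
have kerM : (kermx M :=: L)%MS.
  apply/eqmxP/andP; split; apply/rV_subP => v.
    move=> /sub_kermxP vM.
    have : S (rlincomb (v 0) e) /\ phi (rlincomb (v 0) e) = 0.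
      split; first by apply/Se; eexists.
      apply: realify_inj; rewrite phiM realify0 -vM; congr (_ *m _).
      by apply/rowP => i; rewrite mxE.
    move=> /Sf[s vs]; apply/submxP; exists (\row_i s i).
    apply/rowP => j; rewrite -[LHS](@rlincomb_coord _ _ _ _ e j oe) vs.
    by rewrite mxinner_rlincomb mxE; apply: eq_bigr => i _; rewrite !mxE.
  move=> /submxP[D ->]; apply/sub_kermxP.
  rewrite -mulmxA; have -> : L *m M = 0; last by rewrite mulmx0.
  apply/row_matrixP => i; rewrite row_mul row0.
  have [_ fi0] : S (f i) /\ phi (f i) = 0.
    by apply/(Sf (f i)); exists (fun j => (j == i)%:R); rewrite rlincomb_delta.
  have := phiM (L i); rewrite -fE fi0 realify0 => E; rewrite [RHS]E; congr (_ *m _).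
have rkM : (\rank M = a - b)%N.
  have := mxrank_ker M; rewrite kerM (eqP fL) => ->.
  by rewrite subKn // rank_leq_row.
rewrite -rkM; exists (row_base M); split; first exact: row_base_free.
move=> w; rewrite eq_row_base; split.
  by move=> [u /Se[r ->] <-]; rewrite phiM submxMl.
move=> /submxP[D wD]; exists (rlincomb (D 0) e); first by apply/Se; eexists.
by apply: realify_inj; rewrite phiM wD; congr (_ *m _); apply/rowP => i; rewrite mxE.
Qed.

End RankNullity.

Lemma has_dim0 p q : has_dim [set (0 : 'M[C]_(p, q))] 0.
Proof.
apply: (@has_dim_rlincomb _ _ _ _ (fun=> 0)) => [|u]; first by case.
split=> [->|[r ->]]; first by exists (fun=> 0); rewrite /rlincomb big_ord0.
by rewrite /= /rlincomb big_ord0.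
Qed.

Lemma has_dim_inj_image p q p' q' (phi : 'M[C]_(p, q) -> 'M[C]_(p', q'))
    (S : set 'M[C]_(p, q)) k : {morph phi : u v / u + v} ->
  (forall (a : R) u, phi (a%:C%C *: u) = a%:C%C *: phi u) ->
  (forall u, S u -> phi u = 0 -> u = 0) -> S 0 ->
  has_dim S k -> has_dim (phi @` S) k.
Proof.
move=> phiD phiZ phi0 S0 Sk; rewrite -[k]subn0.
apply: has_dim_rank_nullity => //.
suff -> : [set u | S u /\ phi u = 0] = [set 0] by exact: has_dim0.
apply/seteqP; split => u /=; first by case; exact: phi0.
move=> ->; split => //; have := phiZ 0 0; rewrite [_ *: 0]scaler0 => ->.
exact: scale0r.
Qed.

End RealLinearAlgebra.

(** * Exponentials of skew-Hermitian matrices *)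

Section OneParameterGroup.
Local Open Scope sesquilinear_scope.
Variable R : realType.
Local Notation C := R[i].

Definition cis (x : R) : C := (cos x +i* sin x)%C.

Lemma cis0 : cis 0 = 1.
Proof. by rewrite /cis cos0 sin0. Qed.

Lemma cisD x y : cis (x + y) = cis x * cis y.
Proof.
rewrite /cis cosD sinD; apply: complexP; rewrite ReImE //=; ring.
Qed.

Lemma cis_conjK x : cis x * (cis x)^* = 1.
Proof.
apply: complexP; rewrite !ReImE /=; last by ring.
by rewrite mulrN opprK -!expr2 cos2Dsin2.
Qed.

Lemma is_cderive_cis (th t : R) :
  is_cderive (fun s => cis (s * th)) t ('i%C * th%:C%C * cis (t * th)).
Proof.
split; rewrite /= !(mul0r, mul1r, mulr0, sub0r, subr0, add0r, addr0).
  apply: (is_derive_ext (is_derive_cos_scale th t)) => //; ring.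
apply: (is_derive_ext (is_derive_sin_scale th t)) => //; ring.
Qed.

Lemma smooth_cis (I : set R) th : smooth_ccurve I (fun t => cis (t * th)).
Proof.
split => /=.
  have := @smooth_on_trig R I th 1 0.
  by under eq_fun do rewrite mul1r mul0r addr0.
have := @smooth_on_trig R I th 0 1.
by under eq_fun do rewrite mul1r mul0r add0r.
Qed.

Section DiagonalExponential.
Variables (n : nat) (P : 'M[C]_n) (th : 'I_n -> R).
Hypothesis unitP : P \is unitarymx.

Definition diag_exp (t : R) : 'M[C]_n :=
  P^t* *m diag_mx (\row_j cis (t * th j)) *m P.

Definition diag_generator : 'M[C]_n :=
  P^t* *m diag_mx (\row_j ('i%C * (th j)%:C%C)) *m P.

Let PPt : P *m P^t* = 1%:M.
Proof. exact/unitarymxP. Qed.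

Let PtP : P^t* *m P = 1%:M.
Proof. exact: mulmx1C PPt. Qed.

Let conjM (d e : 'rV[C]_n) : (P^t* *m diag_mx d *m P) *m (P^t* *m diag_mx e *m P) =
  P^t* *m diag_mx (\row_j (d 0 j * e 0 j)) *m P.
Proof.
by rewrite -mulmx_diag !mulmxA -[_ *m P *m P^t*]mulmxA PPt mulmx1.
Qed.

Lemma diag_exp0 : diag_exp 0 = 1%:M.
Proof.
rewrite /diag_exp.
have -> : \row_j cis (0 * th j) = const_mx 1.
  by apply/rowP => j; rewrite !mxE mul0r cis0.
by rewrite diag_const_mx mulmx1.
Qed.

Lemma diag_expD s t : diag_exp (s + t) = diag_exp s *m diag_exp t.
Proof.
rewrite /diag_exp conjM; suff -> : \row_j cis ((s + t) * th j) =
  \row_j ((\row_j cis (s * th j)) 0 j * (\row_j cis (t * th j)) 0 j) by [].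
by apply/rowP => j; rewrite !mxE mulrDl cisD.
Qed.

Lemma diag_exp_unitary t : diag_exp t \is unitarymx.
Proof.
have unitD : diag_mx (\row_j cis (t * th j)) \is unitarymx.
  apply/unitarymxP; rewrite tr_diag_mx map_diag_mx mulmx_diag.
  rewrite -[RHS]diag_const_mx; congr diag_mx; apply/rowP => j.
  by rewrite !mxE cis_conjK.
have unitPt : P^t* \is unitarymx by rewrite trmxC_unitary.
exact: (mul_unitarymx (mul_unitarymx unitPt unitD) unitP).
Qed.

Lemma smooth_diag_exp (I : set R) : open I -> smooth_mxcurve I diag_exp.
Proof.
move=> oI; apply: smooth_mxcurveMr => //; apply: smooth_mxcurveMl => // i j.
under eq_fun do rewrite !mxE.
case: (i == j); last exact: smooth_ccurve_cst.
exact: smooth_cis.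
Qed.

Lemma det_diag_exp t : \det (diag_exp t) = cis (t * \sum_j th j).
Proof.
rewrite /diag_exp !det_mulmx mulrAC -det_mulmx PtP det1 mul1r det_diag mulr_sumr.
rewrite (big_morph cis cisD cis0).
by apply: eq_bigr => j _; rewrite mxE.
Qed.

Lemma is_mxderive_diag_exp t :
  is_mxderive diag_exp t (diag_generator *m diag_exp t).
Proof.
have D : is_mxderive (fun s => diag_mx (\row_j cis (s * th j))) t
   (diag_mx (\row_j ('i%C * (th j)%:C%C * cis (t * th j)))).
  move=> i j; rewrite !mxE; case: (eqVneq i j) => [<-|/negbTE ij].
    by apply: (is_cderive_eq (is_cderive_cis (th i) t)) => [s|//]; rewrite !mxE eqxx.
  by apply: (is_cderive_eq (is_cderive_cst 0 t)) => [s|//]; rewrite !mxE ij.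
rewrite /diag_generator /diag_exp conjM.
suff -> : (\row_j ((\row_j0 ('i%C * (th j0)%:C%C)) 0 j * (\row_j0 cis (t * th j0)) 0 j)) =
  \row_j ('i%C * (th j)%:C%C * cis (t * th j)).
  exact: (is_mxderiveMr P (is_mxderiveMl (P^t*) D)).
by apply/rowP => j; rewrite !mxE.
Qed.

Lemma diag_exp_comm t :
  diag_generator *m diag_exp t = diag_exp t *m diag_generator.
Proof.
rewrite /diag_generator /diag_exp !conjM.
set d := (\row_j _ in LHS); suff -> : d = (\row_j (cis (t * th j) * ('i%C * (th j)%:C%C))).
  suff <- : (\row_j (cis (t * th j) * ('i%C * (th j)%:C%C))) =
    \row_j ((\row_j0 cis (t * th j0)) 0 j * (\row_j0 ('i%C * (th j0)%:C%C)) 0 j) by [].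
  by apply/rowP => j; rewrite !mxE.
by apply/rowP => j; rewrite !mxE mulrC.
Qed.

Lemma mxtrace_diag_generator :
  \tr diag_generator = 'i%C * (\sum_j th j)%:C%C.
Proof.
rewrite /diag_generator mxtrace_mulC mulmxA PPt mul1mx mxtrace_diag.
rewrite (big_morph (fun x : R => x%:C%C : C) (id1 := 0) (op1 := +%R)) //; last first.
  by move=> x y; apply: complexP; rewrite !ReImE ?addr0.
by rewrite mulr_sumr; apply: eq_bigr => j _; rewrite mxE.
Qed.

End DiagonalExponential.

Section SkewExponential.
Variables (n : nat) (X : 'M[C]_n).

(* [- i X] is Hermitian when [X] is skew-Hermitian, so the exponential of [t X]
   is read off a unitary diagonalisation. *)
Let A := - 'i%C *: X.
Let P := spectralmx A.
(** Real parts make [skew_exp] unitary whatever X is. For skew-Hermitian X the spectrum of A is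
    already real, so nothing is lost. *)
Let th j := complex.Re (spectral_diag A 0 j).

Definition skew_exp : R -> 'M[C]_n := diag_exp P th.

Let unitP : P \is unitarymx.
Proof. exact: spectral_unitarymx. Qed.

Lemma skew_exp0 : skew_exp 0 = 1%:M.
Proof. exact: diag_exp0. Qed.

Lemma skew_expD s t : skew_exp (s + t) = skew_exp s *m skew_exp t.
Proof. exact: diag_expD. Qed.

Lemma skew_exp_unitary t : skew_exp t \is unitarymx.
Proof. exact: diag_exp_unitary. Qed.

Lemma smooth_skew_exp (I : set R) : open I -> smooth_mxcurve I skew_exp.
Proof. exact: smooth_diag_exp. Qed.

Hypothesis skewX : X^t* = - X.

Let XE : X = diag_generator P th.
Proof.
have hA : A \is hermsymmx.
  apply/is_hermitianmxP; rewrite expr0 scale1r; apply/matrixP => i j.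
  have /matrixP/(_ i j) := skewX; rewrite !mxE => E.
  rewrite rmorphM /= E mulrN rmorphN /= mulNr; congr (- _).
  by congr (_ * _); apply: complexP; rewrite !ReImE ?oppr0 ?opprK.
have /orthomx_spectralP AE := hermitian_normalmx hA.
have -> : X = 'i%C *: A.
  rewrite scalerA mulrN; have -> : - ('i%C * 'i%C) = 1 :> C.
    by apply: complexP; rewrite !ReImE; ring.
  by rewrite scale1r.
have E : 'i%C *: diag_mx (spectral_diag A) = diag_mx (\row_j ('i%C * (th j)%:C%C)).
  apply/matrixP => i j; rewrite !mxE -mulrnAr; suff <- : spectral_diag A 0 i = (th i)%:C%C by [].
  apply/esym/RRe_real; exact: mxOverP (hermitian_spectral_diag_real hA) 0 i.
by rewrite {1}AE invmx_unitary ?spectral_unitarymx // scalemxAl scalemxAr E.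
Qed.

Lemma is_mxderive_skew_exp t : is_mxderive skew_exp t (X *m skew_exp t).
Proof. by rewrite {1}XE; exact: is_mxderive_diag_exp. Qed.

Lemma skew_exp_comm t : X *m skew_exp t = skew_exp t *m X.
Proof. by have := diag_exp_comm th unitP t; rewrite -XE. Qed.

Lemma is_mxderive_skew_exp0 : is_mxderive skew_exp 0 X.
Proof. by have := is_mxderive_skew_exp 0; rewrite skew_exp0 mulmx1. Qed.

(** The determinant is [cis (t * S)] with tr X = i S. If it is constantly 1, then sin (t S) vanishes
    for all t, and its derivative at 0 is S. *)
Lemma skew_trace0 : (forall t, \det (skew_exp t) = 1) -> \tr X = 0.
Proof.
move=> det1; rewrite XE mxtrace_diag_generator //; set S := \sum_j th j.
have E t : sin (t * S) = 0 by have := det1 t; rewrite det_diag_exp // => - [].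
have D := is_derive_sin_scale S 0.
have D0 : is_derive (0 : R) (1 : R) (fun s => sin (s * S)) 0.
  by apply: (is_derive_ext (is_derive_cst (0 : R) (0 : R) 1)) => // s; rewrite E.
have := is_derive1_derive1 D; rewrite (is_derive1_derive1 D0) mul0r cos0 mul1r.
by move=> <-; exact: mulr0.
Qed.

(** The curve exp (s X) z has derivative exp (s X) X z = 0, hence is constant. This turns a linear
    condition on X into membership of exp (t X) in a stabiliser. *)
Lemma skew_exp_fix q (z : 'M[C]_(n, q)) t : X *m z = 0 -> skew_exp t *m z = z.
Proof.
move=> Xz0.
have D s : is_mxderive (fun s => skew_exp s *m z) s 0.
  apply: (is_mxderive_eq (is_mxderiveMr z (is_mxderive_skew_exp s))) => //.
  by rewrite skew_exp_comm -mulmxA Xz0 mulmx0.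
apply/matrixP => i j; rewrite -[in RHS](mul1mx z) -skew_exp0.
apply: complexP.
  by apply: (@is_derive_0_is_cst R (fun s => complex.Re ((skew_exp s *m z) i j))) => s;
    have := (D s i j).1; rewrite mxE.
by apply: (@is_derive_0_is_cst R (fun s => complex.Im ((skew_exp s *m z) i j))) => s;
  have := (D s i j).2; rewrite mxE.
Qed.

End SkewExponential.
End OneParameterGroup.

(** * One-parameter subgroups *)

Section ClosedSubgroup.
Local Open Scope sesquilinear_scope.
Variable R : realType.
Local Notation C := R[i].

Lemma nbhs0_itv (e : R) (P : R -> Prop) : 0 < e ->
  (forall t, - e < t < e -> P t) -> \forall t \near (0 : R), P t.
Proof.
move=> e0 H; apply/nbhs_ballP; exists e => //= t.
by rewrite /ball /= sub0r normrN ltr_norml => /H.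
Qed.

Lemma lie_curve n (G : set 'M[C]_n) X : lie G X ->
  exists c e, [/\ 0 < e, smooth_mxcurve `]-e, e[ c,
    forall t, - e < t < e -> G (c t), c 0 = 1%:M & is_mxderive c 0 X].
Proof.
move=> [c [[e e0 [Sc Gc]] c0 XE]]; exists c, e; split => //.
rewrite XE; apply: smooth_is_mxderive Sc _.
by rewrite /= in_itv /= oppr_lt0 e0.
Qed.

(** Differentiate c c^* = 1 at 0. *)
Lemma lie_skew n (G : set 'M[C]_n) X : G `<=` [set g | g \is unitarymx] ->
  lie G X -> X^t* = - X.
Proof.
move=> GU /lie_curve[c [e [e0 _ Gc c0 Dc]]].
have D := is_mxderiveM Dc (is_mxderive_adj Dc).
have D0 : is_mxderive (fun s => c s *m (c s)^t*) 0 0.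
  apply: is_mxderive_near (is_mxderive_cst 1%:M 0).
  apply: (nbhs0_itv e0) => t /Gc/GU/unitarymxP ->; exact: erefl.
have := is_mxderive_mxderiv D; rewrite (is_mxderive_mxderiv D0) c0 mul1mx.
by rewrite trmx1 map_mx1 mulmx1 => /esym/eqP; rewrite addrC addr_eq0 => /eqP.
Qed.

Lemma normc_le_ReIm (z : C) (a : R) : `|complex.Re z| <= a ->
  `|complex.Im z| <= a -> `|z| <= (a *+ 2)%:C%C.
Proof.
move=> Ra Ia; have -> : z = (complex.Re z)%:C%C + 'i%C * (complex.Im z)%:C%C.
  apply: complexP; rewrite !ReImE; ring.
apply: le_trans (ler_normD _ _) _; rewrite normrM.
have -> : `|'i%C : C| = 1.
  by rewrite normc_def !ReImE expr0n /= expr1n add0r sqrtr1.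
rewrite mul1r mulr2n rmorphD /=.
have Cnorm (x : R) : `|x%:C%C : C| = `|x|%:C%C by rewrite normc_def !ReImE expr0n addr0 sqrtr_sqr.
by rewrite !Cnorm lerD // lecR.
Qed.

Lemma is_derive0_small (f : R -> R) (eta : R) : 0 < eta -> f 0 = 0 ->
  is_derive (0 : R) (1 : R) f 0 -> \forall t \near (0 : R), `|f t| <= eta * `|t|.
Proof.
move=> eta0 f0 Df.
have : h^-1 *: (f (h *: 1 + 0) - f 0) @[h --> 0^'] --> (0 : R).
  case: Df => dD vD.
  suff : h^-1 *: (f (h *: 1 + 0) - f 0) @[h --> 0^'] --> 'D_1 f 0 by rewrite vD.
  exact: dD.
move=> /cvgrPdist_le/(_ eta eta0) /nbhs_ballP[d /= d0 H].
apply/nbhs_ballP; exists d => //= h hd.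
have [->|h0] := eqVneq h 0; first by rewrite f0 normr0 mulr0.
have := H h hd h0; rewrite f0 subr0 addr0 /GRing.scale /= mulr1 sub0r normrN normrM normfV.
by rewrite ler_pdivrMl ?normr_gt0 // mulrC.
Qed.

Lemma is_mxderive0_small p q (D : R -> 'M[C]_(p, q)) (eta : R) : 0 < eta ->
  D 0 = 0 -> is_mxderive D 0 0 ->
  \forall t \near (0 : R), forall i j, `|D t i j| <= (eta * `|t|)%:C%C.
Proof.
move=> eta0 D0 DD.
(* Half of eta for each of the real and imaginary parts, to pay for the factor 2 in
   [normc_le_ReIm]. *)
have eta20 : 0 < eta / 2 by rewrite divr_gt0.
have small i j : \forall t \near (0 : R), `|D t i j| <= (eta * `|t|)%:C%C.
  have [Dr Di] := DD i j; rewrite mxE in Dr Di.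
  have Er : complex.Re (D 0 i j) = 0 by rewrite D0 mxE.
  have Ei : complex.Im (D 0 i j) = 0 by rewrite D0 mxE.
  have := is_derive0_small eta20 Er Dr; have := is_derive0_small eta20 Ei Di.
  apply: filterS2 => t Ht1 Ht2.
  have -> : eta * `|t| = (eta / 2 * `|t|) *+ 2 by rewrite mulr2n -mulrDl -splitr.
  exact: normc_le_ReIm.
apply: (@filter_forall _ _
  (fun i t => forall j, `|D t i j| <= (eta * `|t|)%:C%C) (nbhs (0 : R)) _) => i.
exact: (@filter_forall _ _ (fun j t => `|D t i j| <= (eta * `|t|)%:C%C)
  (nbhs (0 : R)) _ (small i)).
Qed.

Section EntryBounds.
Variable n : nat.
Implicit Types (A B U V M : 'M[C]_n) (eps : C).

Lemma unitary_entry_le1 U i j : U \is unitarymx -> `|U i j| <= 1.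
Proof.
move=> /unitarymxP/matrixP/(_ i i); rewrite !mxE eqxx mulr1n => E.
rewrite -(@expr_le1 _ 2) // -E (bigD1 j) //= !mxE -normCK lerDl.
by apply: sumr_ge0 => l _; rewrite !mxE -normCK exprn_ge0.
Qed.

(** Each of the two products is a sum of n terms with one factor an entry of a unitary matrix, of
    modulus at most 1. This accounts for the two factors n. *)
Lemma unitary_conj_bound U V M eps : U \is unitarymx -> V \is unitarymx ->
  (forall i j, `|M i j| <= eps) ->
  forall i j, `|(U *m M *m V) i j| <= (n * n)%:R * eps.
Proof.
move=> uU uV ME i j.
have key (F : 'I_n -> C) (d : C) : (forall l, `|F l| <= d) ->
    `|\sum_l F l| <= n%:R * d.
  move=> Fd; apply: le_trans (ler_norm_sum _ _ _) _.
  apply: le_trans (ler_sum _ (fun l _ => Fd l)) _.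
  by rewrite sumr_const card_ord mulr_natl.
rewrite mxE natrM -mulrA; apply: (key) => l; rewrite normrM.
apply: le_trans (ler_piMr _ (unitary_entry_le1 _ _ uV)) _ => //.
rewrite mxE; apply: (key) => h; rewrite normrM.
exact: le_trans (ler_piMl _ (unitary_entry_le1 _ _ uU)) (ME h l).
Qed.

Definition mxpow A k : 'M[C]_n := iter k (mulmx A) 1%:M.

Lemma mxpow_unitary A k : A \is unitarymx -> mxpow A k \is unitarymx.
Proof.
move=> uA; elim: k => [|k IH]; last exact: (mul_unitarymx uA IH).
by apply/unitarymxP; rewrite mul1mx trmx1 map_mx1.
Qed.

(** Telescoping: A^(k+1) - B^(k+1) = A (A^k - B^k) + (A - B) B^k. The unitary prefix U absorbs the
    powers of A, so the induction adds one error term per step instead of multiplying the error by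
    n; the bound stays linear in k. *)
Lemma mxpow_bound A B eps k : A \is unitarymx -> B \is unitarymx ->
  (forall i j, `|(A - B) i j| <= eps) -> forall U, U \is unitarymx ->
  forall i j, `|(U *m (mxpow A k - mxpow B k)) i j| <= k%:R * ((n * n)%:R * eps).
Proof.
move=> uA uB ABe; elim: k => [|k IH] U uU i j.
  by rewrite subrr mulmx0 mxE normr0 mul0r.
have -> : U *m (mxpow A k.+1 - mxpow B k.+1) =
    U *m A *m (mxpow A k - mxpow B k) + U *m (A - B) *m mxpow B k.
  rewrite /mxpow !iterS !mulmxBr !mulmxBl !mulmxA addrA.
  by rewrite subrK.
rewrite mxE -natr1 mulrDl mul1r; apply: le_trans (ler_normD _ _) (lerD _ _).
  exact: (IH _ (mul_unitarymx uU uA) i j).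
exact: (unitary_conj_bound uU (mxpow_unitary k uB) ABe).
Qed.

End EntryBounds.

Lemma skew_exp_pow n (X : 'M[C]_n) t k :
  mxpow (skew_exp X t) k = skew_exp X (t *+ k).
Proof.
elim: k => [|k IH]; first by rewrite mulr0n skew_exp0.
by rewrite /mxpow iterS -/(mxpow _ k) IH mulrS skew_expD.
Qed.

Lemma mxball_realify p q (A B : 'M[C]_(p, q)) (eps : R) :
  (forall i j, `|(A - B) i j| < eps%:C%C) -> 0 < eps ->
  ball (realify B) eps (realify A).
Proof.
move=> H e0.
have Hr i j : `|complex.Re (A i j) - complex.Re (B i j)| < eps.
  have := H i j; rewrite !mxE -ltcR; apply: le_lt_trans.
  by have := normc_ge_Re (A i j - B i j); rewrite ReD ReN.
have Hi i j : `|complex.Im (A i j) - complex.Im (B i j)| < eps.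
  have := H i j; rewrite !mxE -ltcR; apply: le_lt_trans.
  have := normc_ge_Re (- 'i%C * (A i j - B i j)); rewrite normrM normrN.
  have -> : `|'i%C : C| = 1.
    by rewrite normc_def !ReImE expr0n /= expr1n add0r sqrtr1.
  by rewrite mul1r !ReImE oppr0 mul0r mulNr mul1r sub0r opprK.
split => // i j; rewrite /ball /= distrC /realify (ord1 i).
case: (splitP j) => l jl.
  have -> : j = lshift (p * q) l by exact: val_inj.
  by rewrite !row_mxEl; case/mxvec_indexP: l {jl} => a b; rewrite !mxvecE !mxE.
have -> : j = rshift (p * q) l by exact: val_inj.
by rewrite !row_mxEr; case/mxvec_indexP: l {jl} => a b; rewrite !mxvecE !mxE.
Qed.

(* If [c] is a curve in the group with velocity [X] at [1], then
   [c (t / k) ^ k] tends to [skew_exp X t] as [k] grows. *)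
Lemma lie_skew_exp n (G : set 'M[C]_n) X t :
  G 1%:M -> (forall g h, G g -> G h -> G (g *m h)) ->
  G `<=` [set g | g \is unitarymx] -> closed (@realify R n n @` G) ->
  lie G X -> G (skew_exp X t).
Proof.
move=> G1 GM GU clG lieX.
have skX := lie_skew GU lieX.
have [c [e [e0 _ Gc c0 Dc]]] := lie_curve lieX.
suff : (@realify R n n @` G) (realify (skew_exp X t)).
  by case=> g Gg /(@realify_inj _ _ _) <-.
apply: clG => B /nbhs_ballP[eps /= eps0 Be].
pose D s := c s - skew_exp X s.
have D0 : D 0 = 0 by rewrite /D c0 skew_exp0 subrr.
have DD : is_mxderive D 0 0.
  have := is_mxderiveB Dc (is_mxderive_skew_exp0 skX).
  by rewrite subrr.
(* If c and exp (. X) differ by at most eta |t / k| at t / k, their k-th powers differ by at most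
   n^2 eta |t|. With eta = eps / N this is below eps; the summand 1 gives strictness and N > 0. *)
pose N : R := (n * n)%:R * `|t| + 1.
have N0 : 0 < N by rewrite ltr_wpDl // mulr_ge0.
have eta0 : 0 < eps / N by rewrite divr_gt0.
have /nbhs_ballP[d /= d0 Hd] := is_mxderive0_small eta0 D0 DD.
pose de := Num.min d e.
have de0 : 0 < de by rewrite lt_min d0.
pose k := (Num.truncn (`|t| / de)).+1.
have k0 : 0 < (k%:R : R) by rewrite ltr0n.
have tk : `|t / k%:R| < de.
  rewrite normrM normfV (gtr0_norm k0) ltr_pdivrMr // mulrC -ltr_pdivrMr //.
  exact: truncnS_gt.
have [tkd tke] : `|t / k%:R| < d /\ `|t / k%:R| < e.
  by split; apply: lt_le_trans tk _; rewrite ge_min lexx ?orbT.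
have GA : G (c (t / k%:R)) by apply: Gc; rewrite -ltr_norml.
have Gpow g l : G g -> G (mxpow g l).
  by move=> Gg; elim: l => // l IH; exact: GM.
have bnd := @mxpow_bound n (c (t / k%:R)) (skew_exp X (t / k%:R)) _ k (GU _ GA)
  (skew_exp_unitary _ _) (Hd (t / k%:R) _) 1%:M.
exists (realify (mxpow (c (t / k%:R)) k)); split.
  by exists (mxpow (c (t / k%:R)) k) => //; exact: Gpow.
apply: Be; apply: mxball_realify => // i j.
have E : mxpow (skew_exp X (t / k%:R)) k = skew_exp X t.
  by rewrite skew_exp_pow -[_ *+ _]mulr_natr divfK // gt_eqF.
rewrite E in bnd.
have u1 : (1%:M : 'M[C]_n) \is unitarymx.
  by apply/unitarymxP; rewrite mul1mx trmx1 map_mx1.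
have tkb : ball (0 : R) d (t / k%:R) by rewrite /ball /= sub0r normrN.
have := bnd tkb u1 i j; rewrite mul1mx => /le_lt_trans; apply.
rewrite -!(rmorph_nat (real_complex R)) -!rmorphM /= ltcR.
rewrite normrM normfV (gtr0_norm k0).
have -> : k%:R * ((n * n)%:R * (eps / N * (`|t| / k%:R))) =
   eps * (((n * n)%:R * `|t|) / N) by field; rewrite ?gt_eqF.
by rewrite -[ltRHS]mulr1 ltr_pM2l // ltr_pdivrMr // mul1r ltrDl.
Qed.

End ClosedSubgroup.

(** * Hermitian products and unitary frames *)

Section HermitianProduct.
Local Open Scope sesquilinear_scope.
Variables (R : realType) (n : nat).
Local Notation C := R[i].
Implicit Types (u v w : 'cV[C]_n) (A : 'M[C]_n).

Definition hdot u v : C := \sum_i (u i 0)^* * v i 0.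

Lemma hdotE u v : hdot u v = (u^t* *m v) 0 0.
Proof. by rewrite mxE; apply: eq_bigr => i _; rewrite !mxE. Qed.

Lemma hdotDr u v w : hdot u (v + w) = hdot u v + hdot u w.
Proof. by rewrite !hdotE mulmxDr mxE. Qed.

Lemma hdotNr u v : hdot u (- v) = - hdot u v.
Proof. by rewrite !hdotE mulmxN mxE. Qed.

Lemma hdotZr u (a : C) v : hdot u (a *: v) = a * hdot u v.
Proof. by rewrite !hdotE -scalemxAr mxE. Qed.

Lemma hdot0r u : hdot u 0 = 0.
Proof. by rewrite hdotE mulmx0 mxE. Qed.

Lemma hdot_conj u v : (hdot u v)^* = hdot v u.
Proof.
by rewrite rmorph_sum; apply: eq_bigr => i _; rewrite rmorphM /= conjCK mulrC.
Qed.

Lemma hdotNl u v : hdot (- u) v = - hdot u v.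
Proof. by rewrite -hdot_conj hdotNr rmorphN /= hdot_conj. Qed.

Lemma hdotZl (a : C) u v : hdot (a *: u) v = a^* * hdot u v.
Proof. by rewrite -hdot_conj hdotZr rmorphM /= hdot_conj. Qed.

Lemma hdot_sumr (I : Type) (r : seq I) (P : pred I) u (F : I -> 'cV[C]_n) :
  hdot u (\sum_(i <- r | P i) F i) = \sum_(i <- r | P i) hdot u (F i).
Proof. exact: (big_morph _ (hdotDr u) (hdot0r u)). Qed.

Lemma hdotMr u A v : hdot u (A *m v) = hdot (A^t* *m u) v.
Proof.
by rewrite !hdotE trmx_mul map_mxM /= trmxCK mulmxA.
Qed.

Lemma hdot_skew u A v : A^t* = - A -> hdot u (A *m v) = - hdot (A *m u) v.
Proof. by move=> skA; rewrite hdotMr skA mulNmx hdotNl. Qed.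

Lemma hdot_unitary A u v : A \is unitarymx -> hdot (A *m u) (A *m v) = hdot u v.
Proof.
by move=> /unitarymxP/mulmx1C AA; rewrite hdotMr mulmxA AA mul1mx.
Qed.

Lemma Re_hdot u v : complex.Re (hdot u v) = mxinner u v.
Proof.
rewrite Re_sum; apply: eq_bigr => i _; rewrite big_ord1 !ReImE; ring.
Qed.

Lemma Im_hdot u v : complex.Im (hdot u v) = omega0 u v.
Proof.
rewrite Im_sum; apply: eq_bigr => i _; rewrite !ReImE; ring.
Qed.

Lemma Im_hdotC u v : complex.Im (hdot u v) = - complex.Im (hdot v u).
Proof. by rewrite -hdot_conj ReImE. Qed.

Lemma hdotvv v : hdot v v = (mxinner v v)%:C%C.
Proof.
apply: complexP; rewrite ?Re_hdot ?ReImE //.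
by have /eqP := Im_hdotC v v; rewrite -addr_eq0 -mulr2n mulrn_eq0 => /eqP.
Qed.

Lemma liouvilleE u v : liouville u v = complex.Im (hdot u v).
Proof.
rewrite /liouville /hdot sumrB.
set a := \sum_i (u i 0)^* * v i 0.
have -> : \sum_i u i 0 * (v i 0)^* = a^*.
  by rewrite rmorph_sum; apply: eq_bigr => i _; rewrite rmorphM /= conjCK.
have -> : (2 * 'i%C)^-1 = - 'i%C / 2 :> C.
  rewrite invfM mulrC; congr (_ / _); apply: (@mulIf _ 'i%C).
    by apply/eqP => - [] /eqP; rewrite oner_eq0.
  rewrite mulVf; last by apply/eqP => - [] /eqP; rewrite oner_eq0.
  apply: complexP; rewrite !ReImE; ring.
have -> : a - a^* = 'i%C * (complex.Im a)%:C%C * 2.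
  by apply: complexP; rewrite !mulr2n !mulrDr !mulr1 !ReImE; ring.
set x := (complex.Im a)%:C%C.
have -> : - 'i%C / 2 * ('i%C * x * 2) = - ('i%C * 'i%C) * x :> C by field.
rewrite !ReImE; ring.
Qed.

Definition orthonormal_frame k (e : 'I_k -> 'cV[C]_n) :=
  forall i j, hdot (e i) (e j) = (i == j)%:R.

Section Frame.
Variable e : 'I_n -> 'cV[C]_n.
Hypothesis oe : orthonormal_frame e.

Let V : 'M[C]_n := \matrix_(i, j) e j i 0.

Let VtV : V^t* *m V = 1%:M.
Proof.
apply/matrixP => i j; rewrite [RHS]mxE -oe mxE.
by apply: eq_bigr => l _; rewrite !mxE.
Qed.

Let VVt : V *m V^t* = 1%:M.
Proof. exact: mulmx1C VtV. Qed.

Lemma frame_expansion v : v = \sum_i hdot (e i) v *: e i.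
Proof.
rewrite -[LHS](mul1mx v) -VVt -mulmxA; apply/colP => i; rewrite mxE summxE.
apply: eq_bigr => j _; rewrite !mxE mulrC; congr (_ * _).
by apply: eq_bigr => l _; rewrite !mxE.
Qed.

Lemma frame_trace A : \tr A = \sum_i hdot (e i) (A *m e i).
Proof.
rewrite -[in LHS](mulmx1 A) -VVt mulmxA mxtrace_mulC; apply: eq_bigr => i _.
rewrite hdotE mxE [RHS]mxE; apply: eq_bigr => j _.
have -> : (A *m V) j i = (A *m e i) j 0.
  by rewrite !mxE; apply: eq_bigr => l _; rewrite mxE.
by rewrite !mxE.
Qed.

End Frame.

End HermitianProduct.

(** * The Lie algebra of a closed subgroup of SU(n) *)

Section LieAlgebra.
Local Open Scope sesquilinear_scope.
Variables (R : realType) (n : nat) (G : set 'M[R[i]]_n).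
Local Notation C := R[i].
Implicit Types (X Y W : 'M[C]_n) (z : 'cV[C]_n).
Hypothesis sG : subgroup_SU G.

Lemma SU_unitary : G `<=` [set g | g \is unitarymx].
Proof. by case: sG => _ _ _ GU g /GU[]. Qed.

Lemma lie_velocity (H : set 'M[C]_n) c e X : 0 < e -> smooth_mxcurve `]-e, e[ c ->
  (forall t, - e < t < e -> H (c t)) -> c 0 = 1%:M -> is_mxderive c 0 X -> lie H X.
Proof.
move=> e0 Sc Hc c0 Dc; exists c; split => //; first by exists e.
by rewrite (is_mxderive_mxderiv Dc).
Qed.

Lemma open_itv (e : R) : open `]-e, e[%classic.
Proof. exact: interval_open. Qed.

Lemma lie_mono (H : set 'M[C]_n) X : H `<=` G -> lie H X -> lie G X.
Proof.
move=> HG /lie_curve[c [e [e0 Sc Hc c0 Dc]]].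
by apply: lie_velocity e0 Sc _ c0 Dc => t /Hc/HG.
Qed.

Lemma lie_conj (H K : set 'M[C]_n) (g g' : 'M[C]_n) X : g *m g' = 1%:M ->
  (forall h, H h -> K (g *m h *m g')) -> lie H X -> lie K (g *m X *m g').
Proof.
move=> gg' HK /lie_curve[c [e [e0 Sc Hc c0 Dc]]].
apply: (@lie_velocity _ (fun t => g *m c t *m g') _ _ e0).
- apply: smooth_mxcurveMr; first exact: open_itv.
  refine (smooth_mxcurveMl (@open_itv e) _ Sc).
- by move=> t /Hc/HK.
- by rewrite c0 mulmx1.
- exact: is_mxderiveMr (is_mxderiveMl _ Dc).
Qed.

Lemma SU_adj g : G g -> G (g^t*).
Proof.
move=> Gg; rewrite -invmx_unitary; last exact: SU_unitary.
by case: sG => _ _ + _; apply.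
Qed.

Lemma lie_adjoint g X : G g -> lie G X -> lie G (g *m X *m g^t*).
Proof.
move=> Gg; apply: lie_conj; first exact/unitarymxP/SU_unitary.
case: sG => _ GM _ _ h Gh; exact: (GM _ _ (GM _ _ Gg Gh) (SU_adj Gg)).
Qed.

Hypothesis clG : closed (@realify R n n @` G).

Lemma skew_exp_in_SU X t : lie G X -> G (skew_exp X t).
Proof.
by case: (sG) => G1 GM _ _ lX; apply: lie_skew_exp => //; exact: SU_unitary.
Qed.

Lemma lie_trace0 X : lie G X -> \tr X = 0.
Proof.
move=> lX; apply: skew_trace0; first exact: lie_skew SU_unitary lX.
by move=> t; case: (sG) => _ _ _ /(_ _ (skew_exp_in_SU t lX)) [].
Qed.

(** The curve that witnesses [lie G X] need not have its conjugates in H, so the one-parameter group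
    of X takes its place. *)
Lemma lie_stabiliser (H : set 'M[C]_n) (g g' : 'M[C]_n) X : g' *m g = 1%:M ->
  (forall t, H (g' *m skew_exp X t *m g)) -> lie G X -> lie H (g' *m X *m g).
Proof.
move=> g'g HX lX.
apply: (@lie_velocity _ (fun t => g' *m skew_exp X t *m g) 1) => //.
- apply: smooth_mxcurveMr; first exact: open_itv.
  refine (smooth_mxcurveMl (@open_itv 1) _ (smooth_skew_exp X (@open_itv 1))).
- by rewrite skew_exp0 mulmx1.
- apply: is_mxderiveMr; apply: is_mxderiveMl; apply: is_mxderive_skew_exp0.
  exact: lie_skew SU_unitary lX.
Qed.

Section Isotropic.
Variable z : 'cV[C]_n.
Hypothesis iso : forall X Y, lie G X -> lie G Y ->
  complex.Im (hdot (X *m z) (Y *m z)) = 0.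

(* Differentiates [Im (hdot (W z) (c t Y c t^* z)) = 0] along a curve [c] with
   velocity [X]. *)
Lemma Im_hdot_bracket X Y W : lie G X -> lie G Y -> lie G W ->
  complex.Im (hdot (W *m z) (X *m (Y *m z))) =
  complex.Im (hdot (W *m z) (Y *m (X *m z))).
Proof.
move=> lX lY lW; have [c [e [e0 _ Gc c0 Dc]]] := lie_curve lX.
have skX := lie_skew SU_unitary lX.
have D := is_mxderiveM (is_mxderiveMr Y Dc) (is_mxderive_adj Dc).
have {D} := is_mxderiveMl ((W *m z)^t*) (is_mxderiveMr z D).
rewrite c0 trmx1 map_mx1 mulmx1 mul1mx skX => /(_ 0 0) [_].
have D0 : is_derive (0 : R) (1 : R) (fun s : R =>
   complex.Im (((W *m z)^t* *m (c s *m Y *m (c s)^t* *m z)) 0 0)) 0.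
  apply: near_eq_is_derive (is_derive_cst (0 : R) (0 : R) 1).
  apply: (nbhs0_itv e0) => t /Gc Gct.
  by rewrite -hdotE iso //; exact: lie_adjoint.
move=> D; have := is_derive1_derive1 D; rewrite (is_derive1_derive1 D0).
rewrite -hdotE mulmxDl mulmxN mulNmx hdotDr hdotNr !ReImE -!mulmxA.
by move=> /esym/eqP; rewrite subr_eq0 => /eqP.
Qed.

Lemma hdot_lie_real X : lie G X -> complex.Re (hdot z (X *m z)) = 0.
Proof.
move=> lX; have skX := lie_skew SU_unitary lX.
have /(congr1 (@complex.Re R)) := hdot_skew z z skX.
rewrite -hdot_conj !ReImE => /eqP.
by rewrite -addr_eq0 -mulr2n mulrn_eq0 => /eqP.
Qed.

End Isotropic.

(** The real part vanishes because X is skew. The imaginary part is the inner product of X with i z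
    z^*, and mu (z) = 0 says that i z z^* is orthogonal to [lie G]. The dimension hypothesis makes
    [lie G] a real subspace, on which the projection is meaningful. *)
Lemma hdot_moment_map dG z X : has_dim (lie G) dG -> moment_map G z = 0 ->
  lie G X -> hdot z (X *m z) = 0.
Proof.
move=> /has_dim_basis[e oe He] mz lX; apply: complexP; first exact: hdot_lie_real.
have {mz} : orth_proj (lie G) ('i%C *: (z *m (map_mx Num.conj z)^T)) = 0.
  move/eqP : mz; rewrite scaler_eq0 oppr_eq0 invr_eq0 pnatr_eq0 /= => /eqP //.
rewrite (orth_proj_rlincomb _ oe He) => P0.
have coord i : mxinner ('i%C *: (z *m (map_mx Num.conj z)^T)) (e i) = 0.
  have := rlincomb_coord (fun i => mxinner ('i%C *: (z *m (map_mx Num.conj z)^T)) (e i)) i oe.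
  rewrite P0 => <-; by rewrite mxinner_realify realify0 mul0mx mxE.
have : mxinner X ('i%C *: (z *m (map_mx Num.conj z)^T)) = 0.
  have [r ->] := (He X).1 lX; rewrite mxinner_rlincomb big1 // => i _.
  by rewrite mxinnerC coord mulr0.
move=> H; rewrite -[RHS]H /hdot Im_sum; apply: eq_bigr => a _.
rewrite mxE mulr_sumr Im_sum; apply: eq_bigr => b _.
rewrite !mxE big_ord1 !mxE !ReImE; ring.
Qed.

End LieAlgebra.

(** * A unit vector and a frame along its orbit, from admissibility *)

Section AdmissibleFrame.
Local Open Scope sesquilinear_scope.
Variable R : realType.
Local Notation C := R[i].

(** Were S reduced to 0, a local parametrisation would be constant on an open set, and its
    derivative in the nonzero direction [const_mx 1] would vanish, against the immersion
    condition. *)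
Lemma embedded_submanifold_neq0 N k (S : set 'rV[R]_N) :
  embedded_submanifold k.+1 S -> exists2 v, S v & v != 0.
Proof.
move=> [[v Sv] HS]; apply: contrapT => nS.
have S0 w : S w -> w = 0.
  by move=> Sw; apply/eqP; apply: contrapT => /negP w0; apply: nS; exists w.
have [W [U [phi [psi [[oW Wv] [oU phiU] _ imm _]]]]] := HS v Sv.
have : (S `&` W) v by [].
rewrite -phiU => -[x Ux _].
have phi0 y : U y -> phi y = 0.
  by move=> Uy; have : (S `&` W) (phi y); [rewrite -phiU; exists y|case => /S0].
have /(_ (const_mx 1)) := imm x _ Ux.
have -> : 'D_(const_mx 1) phi x = 0.
  have D : is_derive x (const_mx 1) phi 0.
    apply: near_eq_is_derive (is_derive_cst (0 : 'rV[R]_N) x (const_mx 1)).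
    by have := open_nbhs_nbhs (conj oU Ux); apply: filterS => y /phi0.
  exact: (@derive_val _ _ _ _ _ _ _ D).
by move=> /(_ erefl) /rowP/(_ 0); rewrite !mxE => /eqP; rewrite oner_eq0.
Qed.

(** The kernel of Y |-> Y z in [lie G] is the conjugate by g of [lie H]. One inclusion exponentiates
    Y, which puts exp (t Y) in the stabiliser of z; the other differentiates the constancy of g c(t)
    g^* z for a curve c in H. Conjugation preserves the dimension. *)
Lemma has_dim_lie_conj n (G H : set 'M[C]_n) (g : 'M[C]_n) (z : 'cV[C]_n) dH :
  subgroup_SU G -> closed (@realify R n n @` G) -> G g ->
  H `<=` G -> stabiliser G mulmx z = [set g *m h *m invmx g | h in H] ->
  has_dim (lie H) dH -> has_dim [set Y | lie G Y /\ Y *m z = 0] dH.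
Proof.
move=> sG clG Gg HG stab dimH.
have Ug : g \is unitarymx := SU_unitary sG Gg.
have gtg : g^t* *m g = 1%:M by apply: mulmx1C; exact/unitarymxP.
have ggt : g *m g^t* = 1%:M by exact/unitarymxP.
rewrite (invmx_unitary Ug) in stab.
have Hstab h : H h -> g *m h *m g^t* *m z = z.
  move=> Hh; have : stabiliser G mulmx z (g *m h *m g^t*) by rewrite stab; exists h.
  by case.
have -> : [set Y | lie G Y /\ Y *m z = 0] =
    [set g *m Y *m g^t* | Y in lie H].
  apply/seteqP; split => [Y [lY Yz]|_ [Y lY <-]] /=.
    exists (g^t* *m Y *m g).
      apply: (lie_stabiliser sG gtg _ lY) => t.
      have : stabiliser G mulmx z (skew_exp Y t).
        split; first exact: skew_exp_in_SU.
        exact: skew_exp_fix (lie_skew (SU_unitary sG) lY) _ _ _ Yz.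
      rewrite stab => -[h Hh <-].
      by rewrite !mulmxA gtg mul1mx -mulmxA gtg mulmx1.
    by rewrite !mulmxA ggt mul1mx -mulmxA ggt mulmx1.
  split.
    apply: (lie_adjoint sG Gg); exact: lie_mono lY.
  have [c [e [e0 _ Hc c0 Dc]]] := lie_curve lY.
  have D := is_mxderiveMr z (is_mxderiveMr (g^t*) (is_mxderiveMl g Dc)).
  rewrite -(is_mxderive_mxderiv D); apply: is_mxderive_mxderiv.
  apply: is_mxderive_near (is_mxderive_cst z 0).
  by apply: (nbhs0_itv e0) => t /Hc/Hstab.
apply: (@has_dim_inj_image R n n n n (fun Y => g *m Y *m g^t*)) => //.
- by move=> u v; rewrite mulmxDr mulmxDl.
- by move=> a u; rewrite -scalemxAr -scalemxAl.
- move=> u _ /(congr1 (fun A => g^t* *m A *m g)).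
  by rewrite !mulmxA gtg mul1mx -mulmxA gtg mulmx1 mulmx0 mul0mx.
(* The constant curve 1 shows that 0 is in [lie H]; it stays in H because 1 fixes z. *)
- exists (fun=> 1%:M); split => //; last by rewrite (is_mxderive_mxderiv (is_mxderive_cst _ 0)).
  exists 1 => //; split => [i j|t _]; first exact: smooth_ccurve_cst.
  have : stabiliser G mulmx z 1%:M.
    by split; [case: sG|rewrite mul1mx].
  rewrite stab => -[h Hh] /(congr1 (fun A => g^t* *m A *m g)).
  by rewrite !mulmxA gtg mul1mx -mulmxA gtg !mulmx1 gtg => <-.
Qed.

(** By invariance c(t) z stays in L for a curve c in G, so X z and Y z are tangent to L at z. *)
Lemma Lagrangian_isotropic n (G : set 'M[C]_n) (L : set 'cV[C]_n) z :
  Lagrangian_submanifold L -> (forall g z, G g -> L z -> L (g *m z)) -> L z ->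
  forall X Y, lie G X -> lie G Y -> complex.Im (hdot (X *m z) (Y *m z)) = 0.
Proof.
move=> [_ LL] GL Lz X Y lX lY; rewrite Im_hdot; suff tan W : lie G W -> tangent_space L z (W *m z).
  by apply: (LL z _ _ Lz); exact: tan.
move=> /lie_curve[c [e [e0 Sc Gc c0 Dc]]].
exists (fun t => c t *m z); split.
- exists e => //; split=> [|t /Gc Gct]; last exact: GL.
  refine (smooth_mxcurveMr (@open_itv _ e) _ Sc).
- by rewrite c0 mul1mx.
- by rewrite (is_mxderive_mxderiv (is_mxderiveMr z Dc)).
Qed.

(* [lie_frame_minimal] expresses that the orbit of [z], an isotropic submanifold
   of the unit sphere, has mean curvature orthogonal to [i] times its tangent
   space. *)
Record lie_frame k (G : set 'M[C]_k.+1) (z : 'cV[C]_k.+1)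
    (X : 'I_k -> 'M[C]_k.+1) : Prop := LieFrame {
  lie_frame_unit : hdot z z = 1;
  lie_frame_moment : forall Y, lie G Y -> hdot z (Y *m z) = 0;
  lie_frame_lie : forall r, lie G (rlincomb r X);
  lie_frame_orthonormal : orthonormal_frame (fun j => X j *m z);
  lie_frame_span : forall Y, lie G Y ->
    exists r, Y *m z = rlincomb r (fun j => X j *m z);
  lie_frame_minimal : forall Y, lie G Y ->
    complex.Im (hdot (Y *m z) (\sum_j X j *m (X j *m z))) = 0
}.

(* With [f j = X j z], [Im (hdot (Y z) (X j f j)) = Im (hdot (f j) (Y f j))] by
   isotropy of the orbit, and the [f j] together with [z] form a unitary frame,
   so the sum over [j] is [Im (tr Y - hdot z (Y z)) = 0]. *)
Lemma isotropic_orbit_minimal k (G : set 'M[C]_k.+1) z (X : 'I_k -> 'M[C]_k.+1) :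
  subgroup_SU G -> closed (@realify R k.+1 k.+1 @` G) ->
  (forall X Y, lie G X -> lie G Y -> complex.Im (hdot (X *m z) (Y *m z)) = 0) ->
  hdot z z = 1 -> (forall Y, lie G Y -> hdot z (Y *m z) = 0) ->
  (forall j, lie G (X j)) -> orthonormal_frame (fun j => X j *m z) ->
  forall Y, lie G Y -> complex.Im (hdot (Y *m z) (\sum_j X j *m (X j *m z))) = 0.
Proof.
move=> sG clG iso zz mom lX oX Y lY.
pose e (i : 'I_k.+1) := if unlift ord0 i is Some j then X j *m z else z.
have e0 : e ord0 = z by rewrite /e unlift_none.
have eS j : e (lift ord0 j) = X j *m z by rewrite /e liftK.
have oe : orthonormal_frame e.
  move=> i j; rewrite /e; case: unliftP => [i'|] ->; case: unliftP => [j'|] -> //=.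
  - by rewrite -hdot_conj mom // conjC0.
  - by rewrite mom.
have tr0 := congr1 (@complex.Im R) (frame_trace oe Y).
rewrite (lie_trace0 sG clG lY) big_ord_recl e0 (mom _ lY) add0r Im_sum in tr0.
rewrite hdot_sumr Im_sum [RHS]tr0; apply: eq_bigr => j _; rewrite eS.
have GU := SU_unitary sG.
rewrite (hdot_skew _ _ (lie_skew GU (lX j))) ImN -Im_hdotC.
exact: (Im_hdot_bracket sG iso (lX j) lY (lX j)).
Qed.

Lemma admissible_lie_frame k (G : set 'M[C]_k.+1) : subgroup_SU G ->
  admissible G -> exists z X, lie_frame G z X.
Proof.
move=> sG [cG _ [L [Lmu LL [GL [H [[_ HG] stab [dG [dH [dimG dimH dd]]]]]]]]].
have clG : closed (@realify R k.+1 k.+1 @` G).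
  by apply: compact_closed => //; exact: norm_hausdorff.
have [_ [z0 Lz0 <-] z0N] := embedded_submanifold_neq0 LL.1.
have {}z0N : z0 != 0 by apply: contra z0N => /eqP ->; rewrite realify0.
pose s := mxinner z0 z0.
have s_gt0 : 0 < s.
  rewrite lt_def; apply/andP; split.
    by apply: contra z0N => /eqP/mxinner_eq0 ->.
  rewrite /s /mxinner; do 2 (apply: sumr_ge0 => ? _).
  by rewrite addr_ge0 // -expr2 sqr_ge0.
pose a : C := ((Num.sqrt s)^-1)%:C%C.
pose z := a *: z0.
have aa : a^* * a = (s^-1)%:C%C.
  apply: complexP; rewrite !ReImE; last by ring.
  by rewrite mulr0 subr0 -invfM -expr2 sqr_sqrtr // ltW.
have zz : hdot z z = 1.
  rewrite hdotZl hdotZr mulrA aa hdotvv -/s -rmorphM /= mulVf //.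
  by rewrite gt_eqF.
have a0 : a != 0.
  apply/eqP => a0; have /eqP := zz; rewrite /z a0 scale0r hdot0r eq_sym.
  by rewrite oner_eq0.
have mom Y : lie G Y -> hdot z (Y *m z) = 0.
  move=> lY; rewrite /z -scalemxAr hdotZl hdotZr.
  by rewrite (hdot_moment_map sG dimG (Lmu _ Lz0) lY) !mulr0.
have iso X Y : lie G X -> lie G Y -> complex.Im (hdot (X *m z) (Y *m z)) = 0.
  move=> lX lY; rewrite /z -!scalemxAr hdotZl hdotZr mulrA aa ImM ReC ImC.
  by rewrite (Lagrangian_isotropic LL GL Lz0 lX lY) mulr0 mul0r addr0.
have [g Gg stabz0] := stab _ Lz0.
have stabz : stabiliser G mulmx z = [set g *m h *m invmx g | h in H].
  have hzE h : h *m z = a *: (h *m z0) by rewrite /z -scalemxAr.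
  rewrite -stabz0; apply/seteqP; split => h [Gh hz]; split => //.
    by apply: (scalerI a0); rewrite -hzE.
  by rewrite hzE hz.
have dimk : has_dim ((fun Y : 'M[C]_k.+1 => Y *m z) @` lie G) k.
  (* L has dimension k + 1 and cohomogeneity one. *)
  have dk : (dG - dH)%N = k by rewrite dd subn1.
  suff : has_dim ((fun Y : 'M[C]_k.+1 => Y *m z) @` lie G) (dG - dH) by rewrite dk.
  apply: has_dim_rank_nullity => //.
  - by move=> u v; rewrite mulmxDl.
  - by move=> b u; rewrite -scalemxAl.
  - exact: (has_dim_lie_conj sG clG Gg HG stabz dimH).
have [f of_ fS] := has_dim_basis dimk.
have /choice[X HX] : forall j, exists Y, lie G Y /\ Y *m z = f j.
  move=> j; have [Y lY Yf] : ((fun Y : 'M[C]_k.+1 => Y *m z) @` lie G) (f j).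
    by apply/fS; exists (fun i => (i == j)%:R); rewrite rlincomb_delta.
  by exists Y.
have lX j : lie G (X j) := (HX j).1.
have fE : (fun j => X j *m z) = f by apply/funext => j; rewrite (HX j).2.
(* Real orthonormality together with isotropy is Hermitian orthonormality. *)
have oX : orthonormal_frame (fun j => X j *m z).
  move=> i j; apply: complexP.
    by rewrite Re_hdot (HX i).2 (HX j).2 of_; case: (i == j).
  by rewrite iso //; case: (i == j).
exists z, X; split => //.
- by move=> r; exact: (has_dim_rlincomb_closed _ dimG lX).
- by move=> Y lY; rewrite fE; apply/fS; exists Y.
- exact: isotropic_orbit_minimal.
Qed.

End AdmissibleFrame.

(** * Lagrangian frames and block coordinates *)

Section UnitaryFrame.
Variables (R : realType) (N : nat) (e : 'I_N -> 'cV[R[i]]_N).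
Local Notation C := R[i].
Hypothesis oe : orthonormal_frame e.

Lemma orthonormal_frame_real : rorthonormal e.
Proof. by move=> i j; rewrite -Re_hdot oe; case: (i == j). Qed.

Variable S : set 'cV[C]_N.
Hypothesis HS : forall u, S u <-> exists r, u = rlincomb r e.

Lemma hdot_rlincomb_frame r i : hdot (e i) (rlincomb r e) = (r i)%:C%C.
Proof.
rewrite hdot_sumr (bigD1 i) //= hdotZr oe eqxx mulr1 big1 ?addr0 // => j ji.
by rewrite hdotZr oe eq_sym (negbTE ji) mulr0.
Qed.

Lemma omega0_frame u v : S u -> S v -> omega0 u v = 0.
Proof.
move=> /HS[r ->] /HS[s ->]; rewrite -Im_hdot [rlincomb s e]/rlincomb hdot_sumr Im_sum.
by apply: big1 => i _; rewrite hdotZr -hdot_conj hdot_rlincomb_frame !ReImE oppr0 mulr0 mul0r addr0.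
Qed.

(** The vectors i e_l form a real orthonormal basis of the normal space: real parts of the Hermitian
    coordinates are tangential, imaginary parts normal. *)
Lemma normal_part_frame v :
  normal_part S v = \sum_i ('i%C * (complex.Im (hdot (e i) v))%:C%C) *: e i.
Proof.
rewrite /normal_part (orth_proj_rlincomb v orthonormal_frame_real HS).
rewrite {1}(frame_expansion oe v) /rlincomb -sumrB; apply: eq_bigr => i _.
rewrite -scalerBl; congr (_ *: _); rewrite mxinnerC -Re_hdot.
by apply: complexP; rewrite !ReImE !(mul0r, mul1r, mulr0) ?subrr ?subr0 ?add0r ?sub0r.
Qed.

(** The form in which H = T^perp is proved: one scalar equation per frame vector, with w = T and v
    the accelerations. *)
Lemma sum_normal_part_frame d (v : 'I_d -> 'cV[C]_N) w :
  (forall l, complex.Im (hdot (e l) (\sum_i v i)) = complex.Im (hdot (e l) w)) ->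
  normal_part S w = \sum_i normal_part S (v i).
Proof.
move=> H; under eq_bigr do rewrite normal_part_frame.
rewrite exchange_big normal_part_frame /=; apply: eq_bigr => l _.
rewrite -scaler_suml -mulr_sumr -H hdot_sumr Im_sum.
congr ((_ * _) *: _); apply: complexP; rewrite !(Re_sum, Im_sum) ?ReImE //.
by rewrite big1.
Qed.

End UnitaryFrame.

Section ThreeBlockIndex.
Variable k : nat.

(** With k = m - 2, the m frame vectors are one for gamma, k for the orbit and one for xi, in the
    index type of the coordinates of C^m. *)
Definition idx_x : 'I_(k.+1 + 1) := lshift 1 ord0.
Definition idx_f (j : 'I_k) : 'I_(k.+1 + 1) := lshift 1 (lift ord0 j).
Definition idx_y : 'I_(k.+1 + 1) := rshift k.+1 ord0.

Variables (T : Type) (vx : T) (vf : 'I_k -> T) (vy : T).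

Definition blocks (i : 'I_(k.+1 + 1)) : T :=
  match fintype.split i with
  | inl i' => if unlift ord0 i' is Some j then vf j else vx
  | inr _ => vy
  end.

Lemma blocks_x : blocks idx_x = vx.
Proof. by rewrite /blocks (unsplitK (inl _)) unlift_none. Qed.

Lemma blocks_f j : blocks (idx_f j) = vf j.
Proof. by rewrite /blocks (unsplitK (inl _)) liftK. Qed.

Lemma blocks_y : blocks idx_y = vy.
Proof. by rewrite /blocks (unsplitK (inr _)). Qed.

Lemma blocks_ind (P : 'I_(k.+1 + 1) -> Prop) : P idx_x ->
  (forall j, P (idx_f j)) -> P idx_y -> forall i, P i.
Proof.
move=> Px Pf Py i; rewrite -(splitK i); case: (fintype.split i) => /= [i'|j].
  by case: (unliftP ord0 i') => [j|] ->; [exact: Pf|exact: Px].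
by rewrite (ord1 j).
Qed.

Lemma sum_blocks (V : nmodType) (F : 'I_(k.+1 + 1) -> V) :
  \sum_i F i = F idx_x + \sum_j F (idx_f j) + F idx_y.
Proof. by rewrite big_split_ord big_ord1 big_ord_recl. Qed.

End ThreeBlockIndex.

Section LastCoordinate.
Variables (R : realType) (n : nat).
Local Notation C := R[i].
Implicit Types (u v : 'cV[C]_n) (a b : C).

Definition emb u a : 'cV[C]_(n + 1) := col_mx u a%:M.

Lemma emb_congr u v a b : u = v -> a = b -> emb u a = emb v b.
Proof. by move=> -> ->. Qed.

Lemma embD u v a b : emb u a + emb v b = emb (u + v) (a + b).
Proof. by rewrite /emb add_col_mx raddfD. Qed.

Lemma embZ a u b : a *: emb u b = emb (a *: u) (a * b).
Proof. by rewrite /emb scale_col_mx scale_scalar_mx. Qed.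

Lemma emb0 : emb 0 0 = 0.
Proof. by rewrite /emb raddf0 col_mx0. Qed.

Lemma emb_sum (I : Type) (r : seq I) (P : pred I) (F : I -> 'cV[C]_n) (f : I -> C) :
  \sum_(i <- r | P i) emb (F i) (f i) =
  emb (\sum_(i <- r | P i) F i) (\sum_(i <- r | P i) f i).
Proof.
elim: r => [|i r IH]; first by rewrite !big_nil emb0.
by rewrite !big_cons; case: (P i) => //; rewrite IH embD.
Qed.

Lemma hdot_emb u v a b : hdot (emb u a) (emb v b) = hdot u v + a^* * b.
Proof.
rewrite /hdot big_split_ord big_ord1; congr (_ + _).
  by apply: eq_bigr => i _; rewrite !col_mxEu.
by rewrite !col_mxEd !mxE.
Qed.

Lemma is_mxderive_emb (u : R -> 'cV[C]_n) (a : R -> C) (t : R) du da :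
  is_mxderive u t du -> is_cderive a t da ->
  is_mxderive (fun s => emb (u s) (a s)) t (emb du da).
Proof.
move=> Du Da i j; rewrite (ord1 j); case: (split_ordP i) => l ->.
  rewrite col_mxEu; under eq_fun do rewrite col_mxEu; exact: Du.
rewrite (ord1 l) col_mxEd mxE; under eq_fun do rewrite col_mxEd mxE.
exact: Da.
Qed.

Lemma actC_emb (g : 'M[C]_n) u a : actC g (emb u a) = emb (g *m u) a.
Proof. by rewrite /actC mul_block_col !mul0mx mul1mx addr0 add0r. Qed.

Lemma emb_inj u v a b : emb u a = emb v b -> u = v /\ a = b.
Proof.
move=> /eq_col_mx[-> /matrixP/(_ 0 0)]; rewrite !mxE => E.
by split => //; rewrite -[LHS]mulr1n E.
Qed.

End LastCoordinate.

(** * The curve equation *)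

Section CurveEquation.
Variable R : realType.
Local Notation C := R[i].

(** The squared modulus as an element of R; the norm of a complex number has type [R[i]]. *)
Definition nsq (z : C) : R := complex.Re z ^+ 2 + complex.Im z ^+ 2.

Lemma nsq_gt0 z : z != 0 -> 0 < nsq z.
Proof.
move=> z0; rewrite lt_def addr_ge0 ?sqr_ge0 // andbT.
apply: contra z0; rewrite paddr_eq0 ?sqr_ge0 // !sqrf_eq0 => /andP[/eqP zr /eqP zi].
by apply/eqP/complexP.
Qed.

Lemma nsqE z : (nsq z)%:C%C = `|z| ^+ 2.
Proof. exact: add_Re2_Im2. Qed.

Lemma conj_mul_nsq z : z^* * z = (nsq z)%:C%C.
Proof. by rewrite nsqE normCKC. Qed.

(** Differentiating 1 / |c'| only adds a real multiple of c'. Its coefficient b is left unspecified,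
    as it drops out of Im (conj (c') .). *)
Lemma curvatureE (I : set R) (c : R -> C) (t : R) : open I -> regular_curve I c -> I t ->
  exists b : R, curvature c t =
    (nsq (cderiv c t))^-1%:C%C * cderiv (cderiv c) t + b%:C%C * cderiv c t.
Proof.
move=> oI [Sc rc] It; set v := cderiv c.
have vt0 : 0 < nsq (v t) by apply/nsq_gt0/rc.
have Dv : is_cderive v t (cderiv v t) := smooth_is_cderive (smooth_cderiv Sc) It.
pose f s := (Num.sqrt (nsq (v s)))^-1.
have normE s : `|v s|^-1 = (f s)%:C%C by rewrite normc_def fmorphV.
have [d Df] : exists d : R, is_derive t 1 f d.
  have [Dr Di] := Dv.
  have D2 := is_deriveD (is_deriveMr Dr Dr) (is_deriveMr Di Di).
  have D3 : is_derive t 1 (fun s => nsq (v s))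
     (complex.Re (cderiv v t) * complex.Re (v t) + complex.Re (v t) * complex.Re (cderiv v t)
     + (complex.Im (cderiv v t) * complex.Im (v t) + complex.Im (v t) * complex.Im (cderiv v t))).
    by apply: (is_derive_ext D2).
  have D4 := @is_derive1_comp R (@Num.sqrt R) (fun s => nsq (v s)) t _ _ (is_derive1_sqrt vt0) D3.
  have s0 : (@Num.sqrt R \o (fun s => nsq (v s))) t != 0.
    by rewrite /= gt_eqF // sqrtr_gt0.
  by have D5 := is_deriveV s0 D4; eexists; exact: D5.
have Dtau := is_cderiveM Dv (is_cderive_realfun Df).
exists (f t * d); rewrite /curvature -/v.
have -> : (fun s => v s / `|v s|) = (fun s => v s * (f s)%:C%C).
  by apply/funext => s; rewrite normE.
rewrite (is_cderive_cderiv Dtau) normE.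
have -> : (nsq (v t))^-1 = f t * f t.
  by rewrite /f -invfM -expr2 sqr_sqrtr // ltW.
rewrite !rmorphM /=; ring.
Qed.

(** Applying Im (conj (c') .) removes real multiples of c', both in the curvature and in
    [position_perp], which may be replaced by c. At a zero of c both forms read x / 0 = 0. *)
Lemma curve_equation_Im (m : nat) (a : R) (I : set R) (c : R -> C) (t : R) :
  open I -> regular_curve I c -> curve_equation m a I c -> I t ->
  complex.Im ((cderiv c t)^* * cderiv (cderiv c) t) / nsq (cderiv c t)
  + (m - 2)%N%:R * complex.Im ((c t)^* * cderiv c t) / nsq (c t)
  = - a * complex.Im ((c t)^* * cderiv c t).
Proof.
move=> oI rc eqc It; have [b kE] := curvatureE oI rc It.
have := eqc t It; rewrite kE; set v := cderiv c t; set w := cderiv _ t.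
pose p := complex.Re (c t * v^*) / nsq v.
have -> : position_perp c t = c t - p%:C%C * v.
  by rewrite /position_perp -/v -nsqE -fmorphV -rmorphM.
have realZ (l q : R) (y : C) : l%:C%C * (y * q%:C%C) = (l * q)%:C%C * y.
  by rewrite rmorphM /=; ring.
rewrite -nsqE -fmorphV -(rmorph_nat (real_complex R)) realZ.
have ImZ (x : R) (y : C) : complex.Im (v^* * (x%:C%C * y)) = x * complex.Im (v^* * y).
  by rewrite mulrCA ImM ReC ImC mul0r addr0.
have vv : complex.Im (v^* * v) = 0 by rewrite conj_mul_nsq ImC.
have ImC' : complex.Im (v^* * c t) = - complex.Im ((c t)^* * v).
  by rewrite !ReImE; ring.
move=> /(congr1 (fun z => complex.Im (v^* * z))).
rewrite mulrBr mulrDr ImD ImN ImD !ImZ mulrBr ImD ImN !ImZ vv !mulr0 subr0 addr0 ImC'.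
rewrite mulrN opprK mulrN mulNr => <-.
by rewrite mulrC; congr (_ + _); rewrite mulrAC.
Qed.

End CurveEquation.

(** * Velocities and accelerations of F *)

Section ComplexIntegral.
Variable R : realType.
Local Notation C := R[i].

Lemma is_derive_continuous (f : R -> R) (t d : R) :
  is_derive t 1 f d -> {for t, continuous f}.
Proof.
move=> D; apply/differentiable_continuous/derivable1_diffP.
exact: (@ex_derive _ _ _ _ _ _ _ D).
Qed.

Lemma is_cderive_cint0 (I : set R) (f df : R -> C) x : open I -> is_interval I ->
  I 0 -> (forall t, I t -> is_cderive f t (df t)) -> I x ->
  is_cderive (cint0 f) x (f x).
Proof.
move=> oI iI I0 Df Ix; split.
  apply: (is_derive_int0 oI iI I0 _ Ix) => t It.
  exact: is_derive_continuous (Df t It).1.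
apply: (is_derive_int0 oI iI I0 _ Ix) => t It.
exact: is_derive_continuous (Df t It).2.
Qed.

(** For c smooth on an interval around 0, the real part is half the change of |c|^2 since 0 and the
    imaginary part is twice the signed area swept out by c. *)
Definition lprim (c : R -> C) : R -> C := cint0 (fun s => (c s)^* * cderiv c s).

Lemma is_cderive_conj_mul (I : set R) (c : R -> C) t : smooth_ccurve I c -> I t ->
  is_cderive (fun s => (c s)^* * cderiv c s) t
    ((cderiv c t)^* * cderiv c t + (c t)^* * cderiv (cderiv c) t).
Proof.
move=> Sc It; apply: is_cderiveM.
  exact: is_cderive_conj (smooth_is_cderive Sc It).
exact: smooth_is_cderive (smooth_cderiv Sc) It.
Qed.

Lemma is_cderive_lprim (I : set R) (c : R -> C) x : open I -> is_interval I ->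
  I 0 -> smooth_ccurve I c -> I x ->
  is_cderive (lprim c) x ((c x)^* * cderiv c x).
Proof.
move=> oI iI I0 Sc Ix.
exact: (is_cderive_cint0 oI iI I0 (fun t It => is_cderive_conj_mul Sc It) Ix).
Qed.

Lemma is_derive_affine (x r t : R) : is_derive t 1 (fun s => x + s * r) r.
Proof.
apply: (is_derive_ext (is_deriveD (is_derive_cst x t 1)
  (is_deriveMr (is_derive_id t 1) (is_derive_cst r t 1)))) => //; cbn.
by rewrite mulr0 addr0 add0r mul1r.
Qed.

Lemma is_cderive_affine (c : R -> C) (x r : R) d : is_cderive c x d ->
  is_cderive (fun s => c (x + s * r)) 0 (r%:C%C * d).
Proof.
move=> D; apply: (@is_cderive_comp R c (fun s => x + s * r) 0); last exact: is_derive_affine.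
by rewrite mul0r addr0.
Qed.

Lemma open_affine (I : set R) x r : open I -> I x ->
  exists2 e : R, 0 < e & forall t, - e < t < e -> I (x + t * r).
Proof.
move=> oI Ix; have /nbhs_ballP[d /= d0 Hd] := open_nbhs_nbhs (conj oI Ix).
exists (d / (`|r| + 1)); first by rewrite divr_gt0 // ltr_wpDl.
move=> t; rewrite -ltr_norml ltr_pdivlMr ?ltr_wpDl // => td; apply: Hd.
rewrite /ball /= opprD addrA subrr sub0r normrN normrM.
by apply: le_lt_trans td; rewrite ler_wpM2l // lerDl.
Qed.

End ComplexIntegral.

(** The second product rule for (c d) u, with c', d' and v standing for the first derivatives as
    functions of time. *)
Lemma is_mxderive_emb_product (R : realType) n (c c' d d' m : R -> R[i])
    (u v : R -> 'cV[R[i]]_n) u0 v0 w0 c0 c1 c2 d0 d1 d2 m1 :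
  is_mxderive u 0 v0 -> u 0 = u0 -> is_mxderive v 0 w0 -> v 0 = v0 ->
  is_cderive c 0 c1 -> c 0 = c0 -> is_cderive c' 0 c2 -> c' 0 = c1 ->
  is_cderive d 0 d1 -> d 0 = d0 -> is_cderive d' 0 d2 -> d' 0 = d1 ->
  is_cderive m 0 m1 ->
  is_mxderive (fun s => emb ((c' s * d s + c s * d' s) *: u s + (c s * d s) *: v s) (m s)) 0
    (emb ((c2 * d0 + 2 * (c1 * d1) + c0 * d2) *: u0
          + (2 * (c1 * d0 + c0 * d1)) *: v0 + (c0 * d0) *: w0) m1).
Proof.
move=> Du u0E Dv v0E Dc c0E Dc' c'0E Dd d0E Dd' d'0E Dm.
have D1 := is_mxderiveZ (is_cderiveD (is_cderiveM Dc' Dd) (is_cderiveM Dc Dd')) Du.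
have D2 := is_mxderiveZ (is_cderiveM Dc Dd) Dv.
apply: (is_mxderive_eq (is_mxderive_emb (is_mxderiveD D1 D2) Dm)) => //.
rewrite c0E c'0E d0E d'0E u0E v0E; apply: emb_congr => //.
rewrite [LHS]addrA -[in LHS](addrA (_ *: u0)) -scalerDl.
by congr (_ *: u0 + _ *: v0 + _); ring.
Qed.

Section Construction.
Local Open Scope sesquilinear_scope.
Variables (R : realType) (n : nat) (z : 'cV[R[i]]_n).
Local Notation C := R[i].
Variable Psi : 'cV[C]_2 -> 'cV[C]_(n + 1).
Hypothesis PsiE : forall w, Psi w = emb (w 0 0 *: z) (w 1 0).
Variables (I1 I2 : set R) (gamma xi : R -> C).
Hypotheses (oI1 : open I1) (iI1 : is_interval I1) (I10 : I1 0).
Hypotheses (oI2 : open I2) (iI2 : is_interval I2) (I20 : I2 0).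
Hypotheses (Sg : smooth_ccurve I1 gamma) (Sx : smooth_ccurve I2 xi).

Local Notation F := (Fmap Psi gamma xi).
Local Notation gamma' := (cderiv gamma).
Local Notation xi' := (cderiv xi).

Lemma FmapE g x y :
  F (g, x, y) = emb ((gamma x * xi y) *: (g *m z)) (lprim xi y - lprim gamma x).
Proof. by rewrite /Fmap PsiE actC_emb !mxE /= scalemxAr. Qed.

Definition velocity g x y W (dx dy : R) : 'cV[C]_(n + 1) :=
  emb ((dx%:C%C * gamma' x * xi y + gamma x * (dy%:C%C * xi' y)) *: (g *m z)
       + (gamma x * xi y) *: (W *m z))
      (dy%:C%C * ((xi y)^* * xi' y) - dx%:C%C * ((gamma x)^* * gamma' x)).

Lemma is_mxderive_Fmap (g : R -> 'M[C]_n) (x y : R -> R) (t : R) W dx dy :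
  I1 (x t) -> I2 (y t) -> is_mxderive g t W -> is_derive t 1 x dx ->
  is_derive t 1 y dy ->
  is_mxderive (fun s => F (g s, x s, y s)) t (velocity (g t) (x t) (y t) W dx dy).
Proof.
move=> Ix Iy Dg Dx Dy.
have Dgx := is_cderive_comp (smooth_is_cderive Sg Ix) Dx.
have Dxy := is_cderive_comp (smooth_is_cderive Sx Iy) Dy.
have DA := is_cderive_comp (is_cderive_lprim oI1 iI1 I10 Sg Ix) Dx.
have DB := is_cderive_comp (is_cderive_lprim oI2 iI2 I20 Sx Iy) Dy.
have D1 := is_mxderiveZ (is_cderiveM Dgx Dxy) (is_mxderiveMr z Dg).
by apply: (is_mxderive_eq (is_mxderive_emb D1 (is_cderiveB DB DA))) => [s|//];
  rewrite FmapE.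
Qed.

Variable G : set 'M[C]_n.
Hypothesis sG : subgroup_SU G.
Hypothesis clG : closed (@realify R n n @` G).

(** Left translation by the inverse of the initial group element moves the curve to 1 and puts its
    velocity in [lie G]. *)
Lemma param_curve_velocity c : param_curves G I1 I2 c ->
  exists X dx dy, [/\ lie G X,
    mxderiv (fun t => (c t).1.1) 0 = (c 0).1.1 *m X,
    derive1 (fun t => (c t).1.2) 0 = dx, derive1 (fun t => (c t).2) 0 = dy &
    is_mxderive (F \o c) 0
     (velocity (c 0).1.1 (c 0).1.2 (c 0).2 ((c 0).1.1 *m X) dx dy)].
Proof.
move=> [e e0 [Sg' Sx' Sy' Pc]].
have e00 : - e < 0 < e by rewrite oppr_lt0 e0.
have E0 : `]-e, e[%classic (0 : R) by rewrite /= in_itv.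
set g0 := (c 0).1.1; pose W := mxderiv (fun t => (c t).1.1) 0.
have [Gg0 Ix0 Iy0] := Pc 0 e00.
have Dg : is_mxderive (fun t => (c t).1.1) 0 W := smooth_is_mxderive Sg' E0.
have Ug0 : g0 \is unitarymx := SU_unitary sG Gg0.
have gtg : g0^t* *m g0 = 1%:M by apply: mulmx1C; exact/unitarymxP.
have ggt : g0 *m g0^t* = 1%:M by exact/unitarymxP.
exists (g0^t* *m W), (derive1 (fun t => (c t).1.2) 0), (derive1 (fun t => (c t).2) 0).
split => //; last 1 first.
- rewrite mulmxA ggt mul1mx.
  have D := is_mxderive_Fmap Ix0 Iy0 Dg (derivable1_is_derive (Sx' 0%N _ E0))
    (derivable1_is_derive (Sy' 0%N _ E0)).
  by apply: (is_mxderive_eq D) => // s /=; case: (c s) => - [].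
- have Sgg : smooth_mxcurve `]-e, e[ (fun t => g0^t* *m (c t).1.1).
    refine (smooth_mxcurveMl (@open_itv _ e) _ Sg').
  have Ggg t : - e < t < e -> G (g0^t* *m (c t).1.1).
    by move=> /Pc[Gt _ _]; case: (sG) => _ GM _ _; exact: (GM _ _ (SU_adj sG Gg0) Gt).
  exact: (lie_velocity e0 Sgg Ggg gtg (is_mxderiveMl (g0^t*) Dg)).
- by rewrite mulmxA ggt mul1mx.
Qed.

(** A one-parameter group times straight lines in the parameters; its image under F need not be a
    geodesic. [mean_curvature_at] accepts any curves with orthonormal velocities. *)
Definition geodesic_curve g x y X (dx dy : R) (t : R) : 'M[C]_n * R * R :=
  (g *m skew_exp X t, x + t * dx, y + t * dy).

Lemma geodesic_curve0 g x y X dx dy : geodesic_curve g x y X dx dy 0 = (g, x, y).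
Proof. by rewrite /geodesic_curve skew_exp0 mulmx1 !mul0r !addr0. Qed.

Lemma geodesic_curve_in g x y X dx dy : param_space G I1 I2 (g, x, y) -> lie G X ->
  param_curves G I1 I2 (geodesic_curve g x y X dx dy).
Proof.
move=> [/= Gg Ix Iy] lX.
have [e1 e10 H1] := open_affine dx oI1 Ix; have [e2 e20 H2] := open_affine dy oI2 Iy.
exists (Num.min e1 e2); first by rewrite lt_min e10.
split.
- refine (smooth_mxcurveMl (@open_itv _ _) _ (smooth_skew_exp X (@open_itv _ _))).
- exact: smooth_on_affine.
- exact: smooth_on_affine.
- move=> t; rewrite -ltr_norml lt_min !ltr_norml => /andP[t1 t2]; split => /=.
  + by case: (sG) => _ GM _ _; apply: GM => //; exact: skew_exp_in_SU.
  + exact: H1.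
  + exact: H2.
Qed.

Definition acceleration g x y X (dx dy : R) : 'cV[C]_(n + 1) :=
  let c := gamma x in let c' := dx%:C%C * gamma' x in
  let c'' := dx%:C%C * (dx%:C%C * cderiv gamma' x) in
  let d := xi y in let d' := dy%:C%C * xi' y in
  let d'' := dy%:C%C * (dy%:C%C * cderiv xi' y) in
  emb ((c'' * d + 2 * (c' * d') + c * d'') *: (g *m z)
       + (2 * (c' * d + c * d')) *: (g *m (X *m z))
       + (c * d) *: (g *m (X *m (X *m z))))
      (dy%:C%C * (dy%:C%C * ((xi' y)^* * xi' y + (xi y)^* * cderiv xi' y))
       - dx%:C%C * (dx%:C%C * ((gamma' x)^* * gamma' x + (gamma x)^* * cderiv gamma' x))).

Lemma geodesic_curve_derivatives g x y X dx dy :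
  param_space G I1 I2 (g, x, y) -> lie G X ->
  mxderiv (F \o geodesic_curve g x y X dx dy) 0 =
    velocity g x y (g *m X) dx dy /\
  mxderiv (mxderiv (F \o geodesic_curve g x y X dx dy)) 0 =
    acceleration g x y X dx dy.
Proof.
move=> pgxy lX; have skX := lie_skew (SU_unitary sG) lX.
have [Gg /= Ix Iy] := pgxy.
have [e1 e10 H1] := open_affine dx oI1 Ix; have [e2 e20 H2] := open_affine dy oI2 Iy.
pose E t := skew_exp X t.
have DE t : is_mxderive E t (X *m E t) := is_mxderive_skew_exp skX t.
(* The velocity is computed at all small t, not only at 0, because it is differentiated again. *)
have V t : I1 (x + t * dx) -> I2 (y + t * dy) ->
    is_mxderive (F \o geodesic_curve g x y X dx dy) t
      (velocity (g *m E t) (x + t * dx) (y + t * dy) (g *m (X *m E t)) dx dy).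
  move=> It1 It2.
  exact: (@is_mxderive_Fmap (fun s => g *m E s) (fun s => x + s * dx)
    (fun s => y + s * dy) t _ _ _ It1 It2 (is_mxderiveMl g (DE t))
    (is_derive_affine x dx t) (is_derive_affine y dy t)).
split.
  have := V 0; rewrite !mul0r !addr0 /E skew_exp0 !mulmx1 => /(_ Ix Iy).
  exact: is_mxderive_mxderiv.
have nearV : \forall t \near (0 : R),
    velocity (g *m E t) (x + t * dx) (y + t * dy) (g *m (X *m E t)) dx dy
    = mxderiv (F \o geodesic_curve g x y X dx dy) t.
  apply: (@nbhs0_itv _ (Num.min e1 e2)); first by rewrite lt_min e10.
  move=> t; rewrite -ltr_norml lt_min !ltr_norml => /andP[t1 t2].
  by rewrite (is_mxderive_mxderiv (V t (H1 t t1) (H2 t t2))).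
apply: is_mxderive_mxderiv; apply: is_mxderive_near nearV _.
have E0 : g *m E 0 *m z = g *m z by rewrite /E skew_exp0 mulmx1.
have E1 : g *m (X *m E 0) *m z = g *m (X *m z) by rewrite /E skew_exp0 mulmx1 -mulmxA.
have E2 : g *m (X *m (X *m E 0)) *m z = g *m (X *m (X *m z)).
  by rewrite /E skew_exp0 mulmx1 -!mulmxA.
have x0 : x + 0 * dx = x by rewrite mul0r addr0.
have y0 : y + 0 * dy = y by rewrite mul0r addr0.
have Du : is_mxderive (fun s => g *m E s *m z) 0 (g *m (X *m z)).
  by rewrite -E1; exact: (is_mxderiveMr z (is_mxderiveMl g (DE 0))).
have Dv : is_mxderive (fun s => g *m (X *m E s) *m z) 0 (g *m (X *m (X *m z))).
  by rewrite -E2; exact: (is_mxderiveMr z (is_mxderiveMl g (is_mxderiveMl X (DE 0)))).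
have Dc := is_cderive_affine dx (smooth_is_cderive Sg Ix).
have Dd := is_cderive_affine dy (smooth_is_cderive Sx Iy).
have Dc' := is_cderiveZ dx%:C%C
  (is_cderive_affine dx (smooth_is_cderive (smooth_cderiv Sg) Ix)).
have Dd' := is_cderiveZ dy%:C%C
  (is_cderive_affine dy (smooth_is_cderive (smooth_cderiv Sx) Iy)).
have Dm := is_cderiveB
  (is_cderiveZ dy%:C%C (is_cderive_affine dy (is_cderive_conj_mul Sx Iy)))
  (is_cderiveZ dx%:C%C (is_cderive_affine dx (is_cderive_conj_mul Sg Ix))).
exact: (is_mxderive_emb_product Du E0 Dv E1 Dc (congr1 gamma x0)
  Dc' (congr1 (fun s => dx%:C%C * gamma' s) x0) Dd (congr1 xi y0)
  Dd' (congr1 (fun s => dy%:C%C * xi' s) y0) Dm).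
Qed.

End Construction.

(** * Exactness *)

Section RealParts.
Variable R : realType.
Local Notation C := R[i].

Lemma ReZ (x : R) (z : C) : complex.Re (x%:C%C * z) = x * complex.Re z.
Proof. by rewrite ReM ReC ImC mul0r subr0. Qed.

Lemma ImZ (x : R) (z : C) : complex.Im (x%:C%C * z) = x * complex.Im z.
Proof. by rewrite ImM ReC ImC mul0r addr0. Qed.

Lemma Im_conjM (z w : C) : complex.Im (z^* * w) =
  complex.Re z * complex.Im w - complex.Im z * complex.Re w.
Proof. by rewrite ImM Re_conj Im_conj mulNr. Qed.

Lemma is_derive_ReIm_comp (c : R -> C) (f : R -> R) (t : R) d (df : R) :
  is_cderive c (f t) d -> is_derive t 1 f df ->
  is_derive t 1 (fun s => complex.Re (c (f s))) (df * complex.Re d) /\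
  is_derive t 1 (fun s => complex.Im (c (f s))) (df * complex.Im d).
Proof.
by move=> Dc Df; have [] := is_cderive_comp Dc Df; rewrite ReZ ImZ.
Qed.

Lemma is_derive_nsq (c : R -> C) (t : R) d : is_cderive c t d ->
  is_derive t 1 (fun s => nsq (c s)) (2 * complex.Re ((c t)^* * d)).
Proof.
move=> [Dr Di].
apply: (is_derive_ext (is_deriveD (is_deriveMr Dr Dr) (is_deriveMr Di Di))) => //.
rewrite !ReImE; ring.
Qed.

Lemma is_derive_nsq_comp (c : R -> C) (f : R -> R) (t : R) d (df : R) :
  is_cderive c (f t) d -> is_derive t 1 f df ->
  is_derive t 1 (fun s => nsq (c (f s))) (2 * complex.Re ((c (f t))^* * d) * df).
Proof. by move=> Dc Df; exact: (is_derive1_comp (is_derive_nsq Dc) Df). Qed.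

(** A and B stand for the two [lprim], a and b for their derivatives, Ng and Nh for |gamma|^2 and
    |xi|^2, whose derivatives are 2 Re a and 2 Re b. The left side is the derivative of [primitive]
    along a curve, the right side the pulled-back Liouville form. *)
Lemma primitive_identity (dx dy Ng Nh : R) (A B a b : C) :
  dx * complex.Im a * Nh + complex.Im A * (2 * complex.Re b * dy)
  + (dy * complex.Im b * Ng + complex.Im B * (2 * complex.Re a * dx))
  - (dx * complex.Re a * complex.Im B + complex.Re A * (dy * complex.Im b)
     + (dx * complex.Im a * complex.Re B + complex.Im A * (dy * complex.Re b)))
  + complex.Im (A^* * a) * dx + complex.Im (B^* * b) * dy =
  dx * Nh * complex.Im a + dy * Ng * complex.Im b
  + complex.Im ((B - A)^* * (dy%:C%C * b - dx%:C%C * a)).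
Proof.
rewrite !Im_conjM !(ReD, ImD, ReN, ImN) !(ReZ, ImZ).
move: (complex.Re A) (complex.Im A) (complex.Re B) (complex.Im B).
move: (complex.Re a) (complex.Im a) (complex.Re b) (complex.Im b) => *.
ring.
Qed.

Lemma product_identity (dx dy : R) (g g' h h' : C) :
  (g * h)^* * (dx%:C%C * g' * h + g * (dy%:C%C * h')) =
  (dx * nsq h)%:C%C * (g^* * g') + (dy * nsq g)%:C%C * (h^* * h').
Proof.
rewrite (rmorphM _ dx) (rmorphM _ dy) /= -!conj_mul_nsq rmorphM /=; ring.
Qed.

End RealParts.

Section Exactness.
Variables (R : realType) (n : nat) (z : 'cV[R[i]]_n).
Local Notation C := R[i].
Variable Psi : 'cV[C]_2 -> 'cV[C]_(n + 1).
Hypothesis PsiE : forall w, Psi w = emb (w 0 0 *: z) (w 1 0).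
Variables (I1 I2 : set R) (gamma xi : R -> C).
Hypotheses (oI1 : open I1) (iI1 : is_interval I1) (I10 : I1 0).
Hypotheses (oI2 : open I2) (iI2 : is_interval I2) (I20 : I2 0).
Hypotheses (Sg : smooth_ccurve I1 gamma) (Sx : smooth_ccurve I2 xi).
Variable G : set 'M[C]_n.
Hypothesis sG : subgroup_SU G.
Hypothesis zz : hdot z z = 1.
Hypothesis mom : forall X, lie G X -> hdot z (X *m z) = 0.

Local Notation F := (Fmap Psi gamma xi).

Definition area (c : R -> C) : R -> R :=
  int0 (fun s => complex.Im ((lprim c s)^* * ((c s)^* * cderiv c s))).

Lemma is_derive_area (I : set R) c t : open I -> is_interval I -> I 0 ->
  smooth_ccurve I c -> I t ->
  is_derive t 1 (area c) (complex.Im ((lprim c t)^* * ((c t)^* * cderiv c t))).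
Proof.
move=> oI iI I0 Sc It.
have H s : I s -> {for s, continuous
    (fun s => complex.Im ((lprim c s)^* * ((c s)^* * cderiv c s)))}.
  move=> Is; have D := is_cderiveM (is_cderive_conj (is_cderive_lprim oI iI I0 Sc Is))
    (is_cderive_conj_mul Sc Is).
  exact: is_derive_continuous D.2.
exact: (is_derive_int0 oI iI I0 H It).
Qed.

(* [area] integrates the part of the pulled-back Liouville form that involves a
   single curve; the products integrate the part mixing the two curves. *)
Definition primitive (p : 'M[C]_n * R * R) : R :=
  complex.Im (lprim gamma p.1.2) * nsq (xi p.2)
  + complex.Im (lprim xi p.2) * nsq (gamma p.1.2)
  - (complex.Re (lprim gamma p.1.2) * complex.Im (lprim xi p.2)
     + complex.Im (lprim gamma p.1.2) * complex.Re (lprim xi p.2))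
  + area gamma p.1.2 + area xi p.2.

Lemma hdot_velocity g x y X (dx dy : R) : G g -> lie G X ->
  hdot (F (g, x, y)) (velocity z gamma xi g x y (g *m X) dx dy) =
  (gamma x * xi y)^* * (dx%:C%C * cderiv gamma x * xi y
                        + gamma x * (dy%:C%C * cderiv xi y))
  + (lprim xi y - lprim gamma x)^*
    * (dy%:C%C * ((xi y)^* * cderiv xi y) - dx%:C%C * ((gamma x)^* * cderiv gamma x)).
Proof.
move=> Gg lX; have Ug : g \is unitarymx := SU_unitary sG Gg.
rewrite (FmapE PsiE) hdot_emb hdotDr !hdotZl !hdotZr -mulmxA !(hdot_unitary _ _ Ug).
by rewrite zz (mom lX) !mulr0 addr0 mulr1 mulrC.
Qed.

Lemma exact_map_Fmap H : exact_map G H I1 I2 F.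
Proof.
(* [primitive] ignores the group element, hence is right-invariant. It can do so because <z, X z> =
   0 removes the orbit directions from the form. *)
exists primitive; split=> // c Dc.
have [X [dx [dy [lX _ Ex Ey DF]]]] :=
  param_curve_velocity PsiE oI1 iI1 I10 oI2 iI2 I20 Sg Sx sG Dc.
rewrite (is_mxderive_mxderiv DF).
have [e e0 [_ Sx' Sy' Pc]] := Dc.
have e00 : - e < 0 < e by rewrite oppr_lt0 e0.
have E0 : `]-e, e[%classic (0 : R) by rewrite /= in_itv.
have [Gg0 Ix Iy] := Pc 0 e00.
have Dx : is_derive (0 : R) (1 : R) (fun t => (c t).1.2) dx.
  by rewrite -Ex; exact: derivable1_is_derive (Sx' 0%N _ E0).
have Dy : is_derive (0 : R) (1 : R) (fun t => (c t).2) dy.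
  by rewrite -Ey; exact: derivable1_is_derive (Sy' 0%N _ E0).
have [DAr DAi] := is_derive_ReIm_comp (is_cderive_lprim oI1 iI1 I10 Sg Ix) Dx.
have [DBr DBi] := is_derive_ReIm_comp (is_cderive_lprim oI2 iI2 I20 Sx Iy) Dy.
have Dg := is_derive_nsq_comp (smooth_is_cderive Sg Ix) Dx.
have Dh := is_derive_nsq_comp (smooth_is_cderive Sx Iy) Dy.
have DP := is_derive1_comp (is_derive_area oI1 iI1 I10 Sg Ix) Dx.
have DQ := is_derive1_comp (is_derive_area oI2 iI2 I20 Sx Iy) Dy.
have D := is_deriveD (is_deriveD (is_deriveB
  (is_deriveD (is_deriveMr DAi Dh) (is_deriveMr DBi Dg))
  (is_deriveD (is_deriveMr DAr DBi) (is_deriveMr DAi DBr))) DP) DQ.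
have c0E : c 0 = ((c 0).1.1, (c 0).1.2, (c 0).2) by case: (c 0) => - [].
have LE : liouville (F (c 0)) (velocity z gamma xi (c 0).1.1 (c 0).1.2 (c 0).2
    ((c 0).1.1 *m X) dx dy) =
  dx * nsq (xi (c 0).2) * complex.Im ((gamma (c 0).1.2)^* * cderiv gamma (c 0).1.2)
  + dy * nsq (gamma (c 0).1.2) * complex.Im ((xi (c 0).2)^* * cderiv xi (c 0).2)
  + complex.Im ((lprim xi (c 0).2 - lprim gamma (c 0).1.2)^*
    * (dy%:C%C * ((xi (c 0).2)^* * cderiv xi (c 0).2)
       - dx%:C%C * ((gamma (c 0).1.2)^* * cderiv gamma (c 0).1.2))).
  rewrite {1}c0E liouvilleE (hdot_velocity _ _ _ _ Gg0 lX) product_identity.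
  by rewrite ImD ImD !ImZ.
rewrite LE -primitive_identity.
exact: D.
Qed.

End Exactness.

(** * Mean curvature at a regular point *)

Section ScalarIdentities.
Variable R : realType.
Local Notation C := R[i].
Implicit Types (a l r s : R) (c d : C).

Lemma nsqM c d : nsq (c * d) = nsq c * nsq d.
Proof. rewrite /nsq ReM ImM; ring. Qed.

Lemma nsq_conj c : nsq c^* = nsq c.
Proof. by rewrite /nsq Re_conj Im_conj sqrrN. Qed.

Lemma nsqN c : nsq (- c) = nsq c.
Proof. by rewrite /nsq ReN ImN !sqrrN. Qed.

(* With [c], [c1], [c2] and [d], [d1], [d2] the 2-jets of gamma and xi, the left
   sides below collect [Im <v, II (e, e)>], with [v] the [x]- (resp. [y]-)
   velocity and [e] the unit vectors in the [x], [y] and orbit directions; the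
   right sides are [Im <v, T>] for [T = (0, - a)]. *)
Lemma mean_curvature_x (k : nat) a (c c1 c2 d d1 d2 : C) :
  c != 0 -> d != 0 -> c1 != 0 -> d1 != 0 ->
  complex.Im (c1^* * c2) / nsq c1 + k%:R * complex.Im (c^* * c1) / nsq c =
    - a * complex.Im (c^* * c1) ->
  (nsq c1 * (nsq c + nsq d))^-1 *
    complex.Im ((c1 * d)^* * (c2 * d) + (- (c^* * c1))^* * - (c1^* * c1 + c^* * c2))
  + (nsq d1 * (nsq c + nsq d))^-1 *
    complex.Im ((c1 * d)^* * (c * d2) + (- (c^* * c1))^* * (d1^* * d1 + d^* * d2))
  + (nsq c * nsq d)^-1 * (k%:R * complex.Im (- ((c1 * d)^* * (c * d))))
  = complex.Im ((- (c^* * c1))^* * - a%:C%C).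
Proof.
move=> c0 d0 c10 d10 Hk.
have Nc := nsq_gt0 c0; have Nd := nsq_gt0 d0.
have Nc1 := nsq_gt0 c10; have Nd1 := nsq_gt0 d10.
pose I0 := complex.Im (c^* * c1).
have E1 : complex.Im ((c1 * d)^* * (c2 * d) + (- (c^* * c1))^* * - (c1^* * c1 + c^* * c2))
   = (nsq c + nsq d) * complex.Im (c1^* * c2) - nsq c1 * I0.
  rewrite /I0 /nsq !ReImE; ring.
have E2 : complex.Im ((c1 * d)^* * (c * d2) + (- (c^* * c1))^* * (d1^* * d1 + d^* * d2))
   = nsq d1 * I0.
  rewrite /I0 /nsq !ReImE; ring.
have E3 : complex.Im (- ((c1 * d)^* * (c * d))) = nsq d * I0.
  rewrite /I0 /nsq !ReImE; ring.
have E4 : complex.Im ((- (c^* * c1))^* * - a%:C%C) = - a * I0.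
  rewrite /I0 !ReImE !(mul0r, mulr0, oppr0, addr0, add0r); ring.
(* The x- and y-directions contribute - I0 / (nsq c + nsq d) and + I0 / (nsq c + nsq d), which
   cancel; the rest is the left side of Hk. *)
rewrite E1 E2 E3 E4 -Hk -/I0.
move: Nc Nd Nc1 Nd1; move: (nsq c) (nsq d) (nsq c1) (nsq d1) => x y s r x0 y0 s0 r0.
by field; rewrite !gt_eqF // addr_gt0.
Qed.

Lemma mean_curvature_y (k : nat) a (c c1 c2 d d1 d2 : C) :
  c != 0 -> d != 0 -> c1 != 0 -> d1 != 0 ->
  complex.Im (d1^* * d2) / nsq d1 + k%:R * complex.Im (d^* * d1) / nsq d =
    a * complex.Im (d^* * d1) ->
  (nsq c1 * (nsq c + nsq d))^-1 *
    complex.Im ((c * d1)^* * (c2 * d) + (d^* * d1)^* * - (c1^* * c1 + c^* * c2))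
  + (nsq d1 * (nsq c + nsq d))^-1 *
    complex.Im ((c * d1)^* * (c * d2) + (d^* * d1)^* * (d1^* * d1 + d^* * d2))
  + (nsq c * nsq d)^-1 * (k%:R * complex.Im (- ((c * d1)^* * (c * d))))
  = complex.Im ((d^* * d1)^* * - a%:C%C).
Proof.
move=> c0 d0 c10 d10 Hk.
have Nc := nsq_gt0 c0; have Nd := nsq_gt0 d0.
have Nc1 := nsq_gt0 c10; have Nd1 := nsq_gt0 d10.
pose I0 := complex.Im (d^* * d1).
have E1 : complex.Im ((c * d1)^* * (c2 * d) + (d^* * d1)^* * - (c1^* * c1 + c^* * c2))
   = nsq c1 * I0.
  rewrite /I0 /nsq !ReImE; ring.
have E2 : complex.Im ((c * d1)^* * (c * d2) + (d^* * d1)^* * (d1^* * d1 + d^* * d2))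
   = (nsq c + nsq d) * complex.Im (d1^* * d2) - nsq d1 * I0.
  rewrite /I0 /nsq !ReImE; ring.
have E3 : complex.Im (- ((c * d1)^* * (c * d))) = nsq c * I0.
  rewrite /I0 /nsq !ReImE; ring.
have E4 : complex.Im ((d^* * d1)^* * - a%:C%C) = a * I0.
  rewrite /I0 !ReImE !(mul0r, mulr0, oppr0, addr0, add0r); ring.
rewrite E1 E2 E3 E4 -Hk -/I0.
move: Nc Nd Nc1 Nd1; move: (nsq c) (nsq d) (nsq c1) (nsq d1) => x y s r x0 y0 s0 r0.
by field; rewrite !gt_eqF // addr_gt0.
Qed.

End ScalarIdentities.

Section RegularPoint.
Local Open Scope sesquilinear_scope.
Variables (R : realType) (k : nat) (G : set 'M[R[i]]_k.+1) (z : 'cV[R[i]]_k.+1).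
Variable X : 'I_k -> 'M[R[i]]_k.+1.
Local Notation C := R[i].
Hypotheses (sG : subgroup_SU G) (clG : closed (@realify R k.+1 k.+1 @` G)).
Hypothesis fX : lie_frame G z X.
Variable Psi : 'cV[C]_2 -> 'cV[C]_(k.+1 + 1).
Hypothesis PsiE : forall w, Psi w = emb (w 0 0 *: z) (w 1 0).
Variables (I1 I2 : set R) (gamma xi : R -> C).
Hypotheses (oI1 : open I1) (iI1 : is_interval I1) (I10 : I1 0).
Hypotheses (oI2 : open I2) (iI2 : is_interval I2) (I20 : I2 0).
Hypotheses (rg : regular_curve I1 gamma) (rx : regular_curve I2 xi).
Variables (g : 'M[C]_k.+1) (x y : R).
Hypothesis pgxy : param_space G I1 I2 (g, x, y).
Hypotheses (gx0 : gamma x != 0) (xy0 : xi y != 0).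

Local Notation F := (Fmap Psi gamma xi).
Local Notation T := (velocities (param_curves G I1 I2) F (g, x, y)).
Local Notation c := (gamma x).
Local Notation d := (xi y).
Local Notation c1 := (cderiv gamma x).
Local Notation d1 := (cderiv xi y).
Local Notation vel := (velocity z gamma xi g x y).
Local Notation acc := (acceleration z gamma xi g x y).

Let Gg : G g. Proof. by case: pgxy. Qed.
Let Ix : I1 x. Proof. by case: pgxy. Qed.
Let Iy : I2 y. Proof. by case: pgxy. Qed.
Let Ug : g \is unitarymx. Proof. exact: SU_unitary sG _ Gg. Qed.
Let c10 : c1 != 0. Proof. exact: rg.2. Qed.
Let d10 : d1 != 0. Proof. exact: rx.2. Qed.

Lemma lieZ (a : R) j : lie G (a%:C%C *: X j).
Proof.
have := lie_frame_lie fX (fun i => (i == j)%:R * a).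
rewrite /rlincomb (bigD1 j) //= eqxx mul1r big1 ?addr0 // => i /negbTE ->.
by rewrite mul0r; exact: scale0r.
Qed.

Lemma lie0 : lie G 0.
Proof.
have := lie_frame_lie fX (fun=> 0).
by rewrite /rlincomb big1 // => i _; exact: scale0r.
Qed.

Definition vx : 'cV[C]_(k.+1 + 1) := emb ((c1 * d) *: (g *m z)) (- (c^* * c1)).
Definition vy : 'cV[C]_(k.+1 + 1) := emb ((c * d1) *: (g *m z)) (d^* * d1).
Definition vg Y : 'cV[C]_(k.+1 + 1) := emb ((c * d) *: (g *m (Y *m z))) 0.

Lemma velocityE Y (dx dy : R) :
  vel (g *m Y) dx dy = dx%:C%C *: vx + dy%:C%C *: vy + vg Y.
Proof.
rewrite /vx /vy /vg !embZ !embD /velocity -mulmxA; apply: emb_congr; last first.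
  by rewrite addr0 mulrN addrC.
rewrite !scalerA -scalerDl; congr (_ *: _ + _).
by rewrite -mulrA [gamma x * (_ * _)]mulrCA.
Qed.

Let zz := lie_frame_unit fX.

Lemma hdot_gz_gz : hdot (g *m z) (g *m z) = 1.
Proof. by rewrite hdot_unitary. Qed.

Lemma hdot_gz_gY Y : lie G Y -> hdot (g *m z) (g *m (Y *m z)) = 0.
Proof. by move=> lY; rewrite hdot_unitary // (lie_frame_moment fX). Qed.

Lemma hdot_gY_gz Y : lie G Y -> hdot (g *m (Y *m z)) (g *m z) = 0.
Proof. by move=> lY; rewrite -hdot_conj hdot_gz_gY // conjC0. Qed.

Lemma hdot_gX_gX i j : hdot (g *m (X i *m z)) (g *m (X j *m z)) = (i == j)%:R.
Proof. by rewrite hdot_unitary //; exact: (lie_frame_orthonormal fX). Qed.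

(** [lx], [ly] and [lg] are the inverse lengths of [vx], [vy] and [vg (X j)]. *)
Definition lx : R := (Num.sqrt (nsq c1 * (nsq c + nsq d)))^-1.
Definition ly : R := (Num.sqrt (nsq d1 * (nsq c + nsq d)))^-1.
Definition lg : R := (Num.sqrt (nsq c * nsq d))^-1.

Let Nc := nsq_gt0 gx0. Let Nd := nsq_gt0 xy0.
Let Nc1 := nsq_gt0 c10. Let Nd1 := nsq_gt0 d10.

Let sqrtV_gt0 (s : R) : 0 < s -> 0 < (Num.sqrt s)^-1.
Proof. by move=> s0; rewrite invr_gt0 sqrtr_gt0. Qed.

Let sqrtV_sq (s : R) : 0 < s -> (Num.sqrt s)^-1 * (Num.sqrt s)^-1 = s^-1.
Proof. by move=> s0; rewrite -invfM -expr2 sqr_sqrtr // ltW. Qed.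

Lemma lx_gt0 : 0 < lx. Proof. by apply: sqrtV_gt0; rewrite mulr_gt0 // addr_gt0. Qed.
Lemma ly_gt0 : 0 < ly. Proof. by apply: sqrtV_gt0; rewrite mulr_gt0 // addr_gt0. Qed.
Lemma lg_gt0 : 0 < lg. Proof. by apply: sqrtV_gt0; rewrite mulr_gt0. Qed.
Lemma lx_sq : lx * lx = (nsq c1 * (nsq c + nsq d))^-1.
Proof. by apply: sqrtV_sq; rewrite mulr_gt0 // addr_gt0. Qed.
Lemma ly_sq : ly * ly = (nsq d1 * (nsq c + nsq d))^-1.
Proof. by apply: sqrtV_sq; rewrite mulr_gt0 // addr_gt0. Qed.
Lemma lg_sq : lg * lg = (nsq c * nsq d)^-1.
Proof. by apply: sqrtV_sq; rewrite mulr_gt0. Qed.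

Definition tframe : 'I_(k.+1 + 1) -> 'cV[C]_(k.+1 + 1) :=
  blocks (lx%:C%C *: vx) (fun j => lg%:C%C *: vg (X j)) (ly%:C%C *: vy).

Let conjR (s : R) : (s%:C%C : C)^* = s%:C%C.
Proof. by apply: complexP; rewrite ?Re_conj ?Im_conj ?ReC ?ImC ?oppr0. Qed.

Let hdotZZ (r s : R) (u v : 'cV[C]_(k.+1 + 1)) :
  hdot (r%:C%C *: u) (s%:C%C *: v) = (r * s)%:C%C * hdot u v.
Proof. by rewrite hdotZl hdotZr conjR rmorphM /= mulrA. Qed.

Lemma hdot_vx_vx : hdot vx vx = (nsq c1 * (nsq c + nsq d))%:C%C.
Proof.
rewrite hdot_emb hdotZl hdotZr hdot_gz_gz mulr1 !conj_mul_nsq nsqN !nsqM nsq_conj.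
rewrite -rmorphD /=; congr (_%:C)%C; ring.
Qed.

Lemma hdot_vy_vy : hdot vy vy = (nsq d1 * (nsq c + nsq d))%:C%C.
Proof.
rewrite hdot_emb hdotZl hdotZr hdot_gz_gz mulr1 !conj_mul_nsq !nsqM nsq_conj.
rewrite -rmorphD /=; congr (_%:C)%C; ring.
Qed.

(** The last coordinates contribute - c conj (c1) conj (d) d1, exactly the opposite of the
    contribution of the first block. *)
Lemma hdot_vx_vy : hdot vx vy = 0.
Proof.
rewrite hdot_emb hdotZl hdotZr hdot_gz_gz mulr1 rmorphN !rmorphM /= conjCK.
by apply/eqP; rewrite mulNr subr_eq0; apply/eqP; ring.
Qed.

Lemma hdot_vx_vg Y : lie G Y -> hdot vx (vg Y) = 0.
Proof. by move=> lY; rewrite hdot_emb hdotZl hdotZr hdot_gz_gY // !mulr0 addr0. Qed.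

Lemma hdot_vy_vg Y : lie G Y -> hdot vy (vg Y) = 0.
Proof. by move=> lY; rewrite hdot_emb hdotZl hdotZr hdot_gz_gY // !mulr0 addr0. Qed.

Lemma hdot_vg_vg i j : hdot (vg (X i)) (vg (X j)) = (nsq c * nsq d)%:C%C * (i == j)%:R.
Proof.
by rewrite hdot_emb hdotZl hdotZr hdot_gX_gX mulr0 addr0 mulrA conj_mul_nsq nsqM.
Qed.

Let lX j : lie G (X j).
Proof. by have := lieZ 1 j; rewrite scale1r. Qed.

Let unitZ (l s : R) : 0 < s -> l * l = s^-1 -> (l * l)%:C%C * s%:C%C = 1 :> C.
Proof. by move=> s0 ->; rewrite -rmorphM /= mulVf // gt_eqF. Qed.

Lemma tframe_orthonormal : orthonormal_frame tframe.
Proof.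
have sym i j : hdot (tframe i) (tframe j) = (i == j)%:R ->
    hdot (tframe j) (tframe i) = (j == i)%:R.
  by move=> H; rewrite -hdot_conj H eq_sym; case: (j == i); rewrite ?conjC0 ?conjC1.
have xf j : hdot (tframe (idx_x k)) (tframe (idx_f j)) = (idx_x k == idx_f j)%:R.
  by rewrite /tframe blocks_x blocks_f hdotZZ (hdot_vx_vg (lX j)) mulr0.
have xy : hdot (tframe (idx_x k)) (tframe (idx_y k)) = (idx_x k == idx_y k)%:R.
  by rewrite /tframe blocks_x blocks_y hdotZZ hdot_vx_vy mulr0 /idx_x /idx_y eq_lrshift.
have yf j : hdot (tframe (idx_y k)) (tframe (idx_f j)) = (idx_y k == idx_f j)%:R.
  by rewrite /tframe blocks_y blocks_f hdotZZ (hdot_vy_vg (lX j)) mulr0 /idx_y /idx_f eq_rlshift.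
apply: blocks_ind => [|i|]; apply: blocks_ind => [|j|].
- rewrite /tframe !blocks_x hdotZZ hdot_vx_vx eqxx unitZ ?lx_sq //.
  by rewrite mulr_gt0 // addr_gt0.
- exact: xf.
- exact: xy.
- exact: (sym _ _ (xf i)).
- rewrite /tframe !blocks_f hdotZZ hdot_vg_vg mulrA unitZ ?lg_sq ?mulr_gt0 // mul1r.
  by rewrite /idx_f eq_lshift (inj_eq lift_inj).
- exact: (sym _ _ (yf i)).
- exact: (sym _ _ xy).
- exact: yf.
- rewrite /tframe !blocks_y hdotZZ hdot_vy_vy eqxx unitZ ?ly_sq //.
  by rewrite mulr_gt0 // addr_gt0.
Qed.

Lemma rlincomb_tframe (r : 'I_(k.+1 + 1) -> R) :
  rlincomb r tframe =
  vel (g *m rlincomb (fun j => r (idx_f j) * lg) X)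
      (r (idx_x k) * lx) (r (idx_y k) * ly).
Proof.
rewrite velocityE /rlincomb sum_blocks /tframe blocks_x blocks_y.
rewrite !scalerA -!rmorphM /= -addrA [X in _ + X]addrC addrA; congr (_ + _ + _).
have -> : vg (\sum_i (r (idx_f i) * lg)%:C%C *: X i) =
    \sum_i (r (idx_f i) * lg)%:C%C *: vg (X i).
  rewrite /vg mulmx_suml mulmx_sumr scaler_sumr.
  under [RHS]eq_bigr do rewrite embZ mulr0.
  rewrite emb_sum; apply: emb_congr; last by rewrite big1.
  apply: eq_bigr => i _.
  by rewrite -scalemxAl -scalemxAr !scalerA mulrC.
by apply: eq_bigr => j _; rewrite blocks_f scalerA -rmorphM.
Qed.

Lemma vel_rlincomb Y (s : 'I_k -> R) (dx dy : R) : Y *m z = rlincomb s (fun j => X j *m z) ->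
  vel (g *m Y) dx dy =
  rlincomb (blocks (dx / lx) (fun j => s j / lg) (dy / ly)) tframe.
Proof.
move=> Yz; rewrite rlincomb_tframe blocks_x blocks_y !divfK; first last.
- by rewrite gt_eqF // lx_gt0.
- by rewrite gt_eqF // ly_gt0.
rewrite !velocityE; congr (_ + _); rewrite /vg Yz; congr (emb (_ *: (_ *m _)) _).
rewrite /rlincomb mulmx_suml; apply: eq_bigr => j _.
by rewrite blocks_f divfK ?gt_eqF ?lg_gt0 // -scalemxAl.
Qed.

Lemma tangent_space_span u : T u <-> exists r, u = rlincomb r tframe.
Proof.
split=> [[c' [Dc c0 ->]]|[r ->]].
  have [Y [dx [dy [lY _ _ _ DF]]]] :=
    param_curve_velocity PsiE oI1 iI1 I10 oI2 iI2 I20 rg.1 rx.1 sG Dc.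
  rewrite (is_mxderive_mxderiv DF) c0 /=.
  have [s Ys] := lie_frame_span fX lY.
  by eexists; exact: vel_rlincomb Ys.
rewrite rlincomb_tframe; set Y := rlincomb _ X.
have lY : lie G Y := lie_frame_lie fX _.
set dx := r (idx_x k) * lx; set dy := r (idx_y k) * ly.
exists (geodesic_curve g x y Y dx dy); split.
- exact: (geodesic_curve_in oI1 oI2 sG clG dx dy pgxy lY).
- exact: geodesic_curve0.
- by have [-> _] := geodesic_curve_derivatives PsiE oI1 iI1 I10 oI2 iI2 I20
    rg.1 rx.1 sG dx dy pgxy lY.
Qed.

Lemma Lagrangian_at_regular : Lagrangian_at G I1 I2 F (g, x, y).
Proof.
split.
  exact: (has_dim_rlincomb (orthonormal_frame_real tframe_orthonormal) tangent_space_span).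
exact: (omega0_frame tframe_orthonormal tangent_space_span).
Qed.

Local Notation c2 := (cderiv (cderiv gamma) x).
Local Notation d2 := (cderiv (cderiv xi) y).

Definition ax : 'cV[C]_(k.+1 + 1) :=
  emb ((c2 * d) *: (g *m z)) (- (c1^* * c1 + c^* * c2)).
Definition ay : 'cV[C]_(k.+1 + 1) :=
  emb ((c * d2) *: (g *m z)) (d1^* * d1 + d^* * d2).
Definition ag (W : 'cV[C]_k.+1) : 'cV[C]_(k.+1 + 1) := emb ((c * d) *: (g *m W)) 0.

Lemma acceleration_x (r : R) : acc 0 r 0 = (r * r)%:C%C *: ax.
Proof.
rewrite /acceleration /ax embZ !mul0mx !mulmx0 !scaler0 !addr0 scalerA.
move: (g *m z) => u; move: c1 c2 d1 d2 => p p' q q'.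
rewrite rmorphM rmorph0 /=; move: (r%:C%C) => s; apply: emb_congr; last first.
  by rewrite mul0r sub0r !mulrN mulrA.
by congr (_ *: u); rewrite !(mul0r, mulr0, addr0) !mulrA.
Qed.

Lemma acceleration_y (r : R) : acc 0 0 r = (r * r)%:C%C *: ay.
Proof.
rewrite /acceleration /ay embZ !mul0mx !mulmx0 !scaler0 !addr0 scalerA.
move: (g *m z) => u; move: c1 c2 d1 d2 => p p' q q'.
rewrite rmorphM rmorph0 /=; move: (r%:C%C) => s; apply: emb_congr; last first.
  by rewrite mul0r subr0 mulrA.
by congr (_ *: u); rewrite !(mul0r, mulr0, add0r, addr0); ring.
Qed.

Lemma acceleration_g (r : R) Y :
  acc (r%:C%C *: Y) 0 0 = (r * r)%:C%C *: ag (Y *m (Y *m z)).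
Proof.
rewrite /acceleration /ag embZ mulr0 -!scalemxAl -!scalemxAr !scalerA.
move: (g *m z) (g *m (Y *m z)) (g *m (Y *m (Y *m z))) => u v w.
move: c1 c2 d1 d2 => p p' q q'.
rewrite rmorphM rmorph0 /=; move: (r%:C%C) => s; apply: emb_congr; last first.
  by rewrite !mul0r subrr.
rewrite !(mul0r, mulr0, add0r, addr0, scale0r); congr (_ *: w); ring.
Qed.

Definition principal_curves : 'I_(k.+1 + 1) -> R -> 'M[C]_k.+1 * R * R :=
  blocks (geodesic_curve g x y 0 lx 0)
    (fun j => geodesic_curve g x y (lg%:C%C *: X j) 0 0) (geodesic_curve g x y 0 0 ly).

Lemma principal_curves_in i :
  param_curves G I1 I2 (principal_curves i) /\ principal_curves i 0 = (g, x, y).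
Proof.
rewrite /principal_curves; split; move: i; apply: blocks_ind => [|j|];
  rewrite ?blocks_x ?blocks_f ?blocks_y ?geodesic_curve0 //;
  apply: geodesic_curve_in => //; (exact: lie0 || exact: lieZ).
Qed.

Let derivs := geodesic_curve_derivatives PsiE oI1 iI1 I10 oI2 iI2 I20 rg.1 rx.1 sG.

Lemma principal_curves_velocity i : mxderiv (F \o principal_curves i) 0 = tframe i.
Proof.
have vg0 : vg 0 = 0 by rewrite /vg mul0mx mulmx0 scaler0 emb0.
move: i; rewrite /principal_curves /tframe; apply: blocks_ind => [|j|].
- rewrite !blocks_x (derivs lx 0 pgxy lie0).1 velocityE vg0 rmorph0.
  by rewrite scale0r !addr0.
- rewrite !blocks_f (derivs 0 0 pgxy (lieZ lg j)).1 velocityE rmorph0 !scale0r !add0r.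
  by rewrite /vg embZ mulr0 -scalemxAl -scalemxAr !scalerA mulrC.
- rewrite !blocks_y (derivs 0 ly pgxy lie0).1 velocityE vg0 rmorph0.
  by rewrite scale0r add0r addr0.
Qed.

Let Q := \sum_j X j *m (X j *m z).

Local Notation pacc i := (mxderiv (mxderiv (F \o principal_curves i)) 0).

Lemma principal_acceleration_x : pacc (idx_x k) = (lx * lx)%:C%C *: ax.
Proof.
rewrite /principal_curves blocks_x (derivs lx 0 pgxy lie0).2.
exact: acceleration_x.
Qed.

Lemma principal_acceleration_y : pacc (idx_y k) = (ly * ly)%:C%C *: ay.
Proof.
rewrite /principal_curves blocks_y (derivs 0 ly pgxy lie0).2.
exact: acceleration_y.
Qed.

Lemma principal_acceleration_f j :
  pacc (idx_f j) = (lg * lg)%:C%C *: ag (X j *m (X j *m z)).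
Proof.
rewrite /principal_curves blocks_f (derivs 0 0 pgxy (lieZ lg j)).2.
exact: acceleration_g.
Qed.

Lemma sum_principal_accelerations :
  \sum_i pacc i =
  (lx * lx)%:C%C *: ax + (lg * lg)%:C%C *: ag Q + (ly * ly)%:C%C *: ay.
Proof.
have Af : \sum_j pacc (idx_f j) = (lg * lg)%:C%C *: ag Q.
  rewrite (eq_bigr _ (fun j _ => principal_acceleration_f j)) -scaler_sumr.
  rewrite /ag emb_sum; congr (_ *: _); apply: emb_congr; last by rewrite big1.
  by rewrite /Q mulmx_sumr scaler_sumr.
rewrite sum_blocks.
exact: (f_equal2 +%R (f_equal2 +%R principal_acceleration_x Af) principal_acceleration_y).
Qed.

Let skX j : ((X j)^t*)%sesqui = - X j.
Proof. exact: (lie_skew (SU_unitary sG) (lX j)). Qed.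

(** Each X j is skew and X j z is a unit vector, so every summand is - 1. This produces the m - 2 of
    the curve equations. *)
Lemma hdot_gz_gQ : hdot (g *m z) (g *m Q) = - k%:R.
Proof.
rewrite hdot_unitary // /Q hdot_sumr -[k in RHS]card_ord -sumr_const -sumrN.
apply: eq_bigr => j _; rewrite (hdot_skew _ _ (skX j)).
by rewrite [hdot _ _](lie_frame_orthonormal fX) eqxx.
Qed.

Lemma Im_hdot_gX_gQ l : complex.Im (hdot (g *m (X l *m z)) (g *m Q)) = 0.
Proof. by rewrite hdot_unitary //; exact: (lie_frame_minimal fX (lX l)). Qed.

Let Im_hdotZl (r : R) (u v : 'cV[C]_(k.+1 + 1)) :
  complex.Im (hdot (r%:C%C *: u) v) = r * complex.Im (hdot u v).
Proof. by rewrite hdotZl conjR ImZ. Qed.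

Lemma hdot_emb_gz (p q al be : C) :
  hdot (emb (p *: (g *m z)) al) (emb (q *: (g *m z)) be) = p^* * q + al^* * be.
Proof. by rewrite hdot_emb hdotZl hdotZr hdot_gz_gz mulr1. Qed.

Lemma hdot_emb_gQ (p al : C) :
  hdot (emb (p *: (g *m z)) al) (ag Q) = k%:R * - (p^* * (c * d)).
Proof.
rewrite hdot_emb hdotZl hdotZr hdot_gz_gQ mulr0 addr0 !mulrN mulrA.
by rewrite [k%:R * _]mulrC.
Qed.

Lemma hdot_emb_last (u : 'cV[C]_k.+1) (al be : C) :
  hdot (emb u al) (emb 0 be) = al^* * be.
Proof. by rewrite hdot_emb hdot0r add0r. Qed.

Lemma hdot_vg_gz j (q be : C) : hdot (vg (X j)) (emb (q *: (g *m z)) be) = 0.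
Proof.
by rewrite hdot_emb hdotZl hdotZr (hdot_gY_gz (lX j)) conjC0 !mulr0 add0r mul0r.
Qed.

Lemma Im_hdot_vg_gQ j : complex.Im (hdot (vg (X j)) (ag Q)) = 0.
Proof.
rewrite hdot_emb hdotZl hdotZr mulr0 addr0 mulrA conj_mul_nsq ImZ.
by rewrite Im_hdot_gX_gQ mulr0.
Qed.

Let Im_natM (w : C) : complex.Im (k%:R * w) = k%:R * complex.Im w.
Proof. by rewrite -(rmorph_nat (real_complex R)) ImZ. Qed.

Let Im_hdot_sum (u v1 v2 v3 : 'cV[C]_(k.+1 + 1)) (r1 r2 r3 : R) :
  complex.Im (hdot u (r1%:C%C *: v1 + r2%:C%C *: v2 + r3%:C%C *: v3)) =
  r1 * complex.Im (hdot u v1) + r3 * complex.Im (hdot u v3)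
  + r2 * complex.Im (hdot u v2).
Proof. by rewrite !hdotDr !hdotZr !ImD !ImZ addrAC. Qed.

Lemma Im_hdot_tframe (a : R) l :
  curve_equation k.+2 a I1 gamma -> curve_equation k.+2 (- a) I2 xi ->
  complex.Im (hdot (tframe l)
    ((lx * lx)%:C%C *: ax + (lg * lg)%:C%C *: ag Q + (ly * ly)%:C%C *: ay)) =
  complex.Im (hdot (tframe l) (emb 0 (- a%:C%C))).
Proof.
move=> eqg eqx.
have Hx := curve_equation_Im oI1 rg eqg Ix.
have Hy := curve_equation_Im oI2 rx eqx Iy.
rewrite opprK in Hy; rewrite -[(k.+2 - 2)%N]/(k - 0)%N subn0 in Hx Hy.
rewrite lx_sq ly_sq lg_sq.
move: l; rewrite /tframe; apply: blocks_ind => [|j|].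
- rewrite blocks_x !Im_hdotZl; congr (_ * _); rewrite Im_hdot_sum.
  rewrite hdot_emb_gz hdot_emb_gz hdot_emb_gQ hdot_emb_last Im_natM.
  exact: (mean_curvature_x d2 gx0 xy0 c10 d10 Hx).
- rewrite blocks_f !Im_hdotZl; congr (_ * _); rewrite Im_hdot_sum.
  by rewrite !hdot_vg_gz Im_hdot_vg_gQ Im0 !mulr0 !addr0 hdot_emb_last conjC0 mul0r Im0.
- rewrite blocks_y !Im_hdotZl; congr (_ * _); rewrite Im_hdot_sum.
  rewrite hdot_emb_gz hdot_emb_gz hdot_emb_gQ hdot_emb_last Im_natM.
  exact: (mean_curvature_y c2 gx0 xy0 c10 d10 Hy).
Qed.

Lemma mean_curvature_regular (a : R) :
  curve_equation k.+2 a I1 gamma -> curve_equation k.+2 (- a) I2 xi ->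
  mean_curvature_at G I1 I2 F (g, x, y) (normal_part T (emb 0 (- a%:C%C))).
Proof.
move=> eqg eqx; exists (k.+1 + 1)%N, principal_curves; split.
- exact: Lagrangian_at_regular.1.
- exact: principal_curves_in.
- move=> i j; exact: (etrans
    (f_equal2 (@mxinner R _ _) (principal_curves_velocity i) (principal_curves_velocity j))
    (orthonormal_frame_real tframe_orthonormal i j)).
apply: (sum_normal_part_frame tframe_orthonormal tangent_space_span) => l.
exact: (etrans (congr1 (fun v => complex.Im (hdot (tframe l) v)) sum_principal_accelerations)
  (Im_hdot_tframe l eqg eqx)).
Qed.

(** A zero velocity has zero coordinates in [tframe], which gives dx = dy = 0 and Y z = 0. Then exp
    (t Y) fixes z, so it stays in the common stabiliser and Y lies in its Lie algebra. *)
Lemma immersed_at_regular : immersed_at G (common_stabiliser G I1 I2 Psi gamma xi)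
  I1 I2 F (g, x, y).
Proof.
move=> c' Dc c'0 DF0.
have [Y [dx [dy [lY EW Ex Ey DF]]]] :=
  param_curve_velocity PsiE oI1 iI1 I10 oI2 iI2 I20 rg.1 rx.1 sG Dc.
rewrite EW Ex Ey c'0 /=; rewrite c'0 /= in DF.
have [s Ys] := lie_frame_span fX lY.
have V0 : rlincomb (blocks (dx / lx) (fun j => s j / lg) (dy / ly)) tframe = 0.
  by rewrite -(vel_rlincomb dx dy Ys) -(is_mxderive_mxderiv DF).
have coord0 i : blocks (dx / lx) (fun j => s j / lg) (dy / ly) i = 0.
  have := hdot_rlincomb_frame tframe_orthonormal (blocks (dx / lx) (fun j => s j / lg) (dy / ly)) i.
  by rewrite V0 hdot0r => /(congr1 (@complex.Re R)).
have div0 (r l : R) : 0 < l -> r / l = 0 -> r = 0.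
  by move=> l0 /eqP; rewrite mulf_eq0 invr_eq0 (gt_eqF l0) orbF => /eqP.
have Yz0 : Y *m z = 0.
  rewrite Ys /rlincomb big1 // => j _.
  have /(div0 _ _ lg_gt0) -> : s j / lg = 0 by have := coord0 (idx_f j); rewrite blocks_f.
  exact: scale0r.
split.
(* Y is written as 1 Y 1, so that [lie_stabiliser] applies with a trivial conjugation. *)
- rewrite (mulKmx (unitarymx_unit Ug)) -[Y]mul1mx -[_ *m Y]mulmx1.
  apply: (lie_stabiliser sG _ _ lY); first by rewrite mulmx1.
  move=> t; rewrite mul1mx mulmx1; split; first exact: skew_exp_in_SU.
  move=> x' y' _ _ _; rewrite PsiE actC_emb -scalemxAr.
  by rewrite (skew_exp_fix (lie_skew (SU_unitary sG) lY) _ Yz0).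
- by apply: (div0 _ _ lx_gt0); have := coord0 (idx_x k); rewrite blocks_x.
- by apply: (div0 _ _ ly_gt0); have := coord0 (idx_y k); rewrite blocks_y.
Qed.

End RegularPoint.

(** * Conclusion *)

Section Embedding.
Variable R : realType.
Local Notation C := R[i].

Definition embedding_mx n (z : 'cV[C]_n) : 'M[C]_(n + 1, 2) :=
  block_mx z 0 0 1%:M : 'M[C]_(n + 1, 1 + 1).

Lemma embedding_mxE n (z : 'cV[C]_n) w :
  embedding_mx z *m w = emb (w 0 0 *: z) (w 1 0).
Proof.
have wE : w = col_mx (w 0 0)%:M (w 1 0)%:M :> 'cV[C]_(1 + 1).
  apply/colP => i; case: (split_ordP i) => j -> ; rewrite (ord1 j).
    by rewrite col_mxEu mxE eqxx; congr (w _ 0); exact: val_inj.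
  by rewrite col_mxEd mxE eqxx; congr (w _ 0); exact: val_inj.
transitivity ((block_mx z 0 0 1%:M : 'M[C]_(n + 1, 1 + 1)) *m
    col_mx (w 0 0)%:M (w 1 0)%:M); first by rewrite -wE.
rewrite mul_block_col !mul0mx mul1mx addr0 add0r.
by rewrite mul_mx_scalar.
Qed.

Lemma embedding_mx_inj n (z : 'cV[C]_n) : z != 0 -> 
  injective (fun w : 'cV[C]_2 => embedding_mx z *m w).
Proof.
move=> z0 u v /=; rewrite !embedding_mxE => /emb_inj[/eqP].
rewrite -subr_eq0 -scalerBl scaler_eq0 (negbTE z0) orbF subr_eq0 => /eqP E0 E1.
apply/colP => i; case: (unliftP ord0 i) => [j ->|-> //].
by rewrite (ord1 j); have -> : lift ord0 0 = 1 :> 'I_2 by exact: val_inj.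
Qed.

End Embedding.

Section Conclusion.
Variables (R : realType) (k : nat) (G : set 'M[R[i]]_k.+1) (z : 'cV[R[i]]_k.+1).
Variable X : 'I_k -> 'M[R[i]]_k.+1.
Local Notation C := R[i].
Hypotheses (sG : subgroup_SU G) (clG : closed (@realify R k.+1 k.+1 @` G)).
Hypothesis fX : lie_frame G z X.
Variable Psi : 'cV[C]_2 -> 'cV[C]_(k.+1 + 1).
Hypothesis PsiE : forall w, Psi w = emb (w 0 0 *: z) (w 1 0).
Variables (I1 I2 : set R) (gamma xi : R -> C).
Hypotheses (oI1 : open I1) (iI1 : is_interval I1) (I10 : I1 0).
Hypotheses (oI2 : open I2) (iI2 : is_interval I2) (I20 : I2 0).
Hypotheses (rg : regular_curve I1 gamma) (rx : regular_curve I2 xi).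

Local Notation F := (Fmap Psi gamma xi).
Local Notation H := (common_stabiliser G I1 I2 Psi gamma xi).

(** The right-hand condition does not involve x and y, which is why all these points have the same
    stabiliser. *)
Lemma stabiliser_point h x y : gamma x * xi y != 0 ->
  actC h (Psi (Fcheck gamma xi x y)) = Psi (Fcheck gamma xi x y) <-> h *m z = z.
Proof.
move=> gx0; rewrite PsiE actC_emb -scalemxAr; split=> [/emb_inj[+ _]|-> //].
by rewrite !mxE /= => /(scalerI gx0).
Qed.

Lemma regular_point g x y : regular_points G I1 I2 Psi gamma xi (g, x, y) ->
  [/\ param_space G I1 I2 (g, x, y), gamma x != 0 & xi y != 0].
Proof.
move=> [pgxy]; rewrite (FmapE PsiE) col_mxKu scaler_eq0 negb_or mulf_eq0 negb_or.
by case/andP => /andP[].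
Qed.

Lemma exact_Lagrangian : exact_Lagrangian_immersion G I1 I2 Psi gamma xi.
Proof.
split.
- move=> x y Ix Iy gx0; apply/seteqP; split => h [Gh].
    move=> /(stabiliser_point _ gx0) hz; split => // x' y' _ _ g'x0.
    exact/(stabiliser_point _ g'x0).
  by move=> /(_ x y Ix Iy gx0).
- move=> g h x y [/= _ Ix Iy] [_ Hh]; rewrite !(FmapE PsiE).
  (* Invariance is also due at singular points; there the first block of F is 0 for every group
     element. *)
  have [->|gx0] := eqVneq (gamma x * xi y) 0; first by rewrite !scale0r.
  by rewrite -mulmxA ((stabiliser_point h gx0).1 (Hh x y Ix Iy gx0)).
- move=> [[g x] y] /regular_point[pgxy gx0 xy0].
  exact: (immersed_at_regular sG clG fX PsiE).
- move=> [[g x] y] /regular_point[pgxy gx0 xy0].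
  exact: (Lagrangian_at_regular sG clG fX PsiE).
- exact: (exact_map_Fmap PsiE oI1 iI1 I10 oI2 iI2 I20 rg.1 rx.1 sG
    (lie_frame_unit fX) (lie_frame_moment fX)).
Qed.

Lemma mean_curvature_regular_points a p :
  curve_equation k.+2 a I1 gamma -> curve_equation k.+2 (- a) I2 xi ->
  regular_points G I1 I2 Psi gamma xi p ->
  mean_curvature_at G I1 I2 F p
    (normal_part (velocities (param_curves G I1 I2) F p) (emb 0 (- a%:C%C))).
Proof.
case: p => [[g x] y] eqg eqx /regular_point[pgxy gx0 xy0].
exact: (mean_curvature_regular sG clG fX PsiE).
Qed.

(** For a = 0 the vector T is 0, and this turns H = T^perp into H = 0. The projection being chosen
    by [xget], even its value at 0 is read off the frame. *)
Lemma normal_part_regular0 p : regular_points G I1 I2 Psi gamma xi p ->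
  normal_part (velocities (param_curves G I1 I2) F p) 0 = 0.
Proof.
case: p => [[g x] y] /regular_point[pgxy gx0 xy0].
have oe := tframe_orthonormal sG fX rg rx pgxy gx0 xy0.
have span := tangent_space_span sG clG fX PsiE oI1 iI1 I10 oI2 iI2 I20 rg rx pgxy gx0 xy0.
rewrite (normal_part_frame oe span) big1 // => i _.
by rewrite hdot0r mulr0 scale0r.
Qed.

End Conclusion.

Unset Implicit Arguments.

Theorem theorem1p1 (R : realType) (m : nat) (G : set 'M[R[i]]_(m.-1)) :
  (2 <= m)%N -> subgroup_SU G -> admissible G ->
  exists Psi : {linear 'cV[R[i]]_2 -> 'cV[R[i]]_(m.-1 + 1)},
    injective Psi /\
    forall (I1 I2 : set R) (a : R) (gamma xi : R -> R[i]),
      open I1 -> is_interval I1 -> I1 0 ->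
      open I2 -> is_interval I2 -> I2 0 ->
      regular_curve I1 gamma -> regular_curve I2 xi ->
      curve_equation m a I1 gamma -> curve_equation m (- a) I2 xi ->
      (0 < a -> exact_Lagrangian_translator G I1 I2 Psi gamma xi) /\
      (a = 0 -> exact_special_Lagrangian G I1 I2 Psi gamma xi).
Proof.
(* From here on m = k + 2, so G acts on C^(k+1) and its orbits of interest have dimension k. *)
case: m G => [|[|k]] G // _ sG adm.
have clG : closed (@realify R k.+1 k.+1 @` G).
  by case: adm => cG _ _; apply: compact_closed => //; exact: norm_hausdorff.
have [z [X fX]] := admissible_lie_frame sG adm.
have z0 : z != 0.
  apply/eqP => z0; have /eqP := lie_frame_unit fX.
  by rewrite z0 hdot0r eq_sym oner_eq0.
exists (mulmx (embedding_mx z)); split; first exact: embedding_mx_inj.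
move=> I1 I2 a gamma xi oI1 iI1 I10 oI2 iI2 I20 rg rx eqg eqx.
have PsiE := embedding_mxE z.
have EL := exact_Lagrangian sG clG fX PsiE oI1 iI1 I10 oI2 iI2 I20 rg rx.
have MC p := @mean_curvature_regular_points R k G z X sG clG fX _ PsiE I1 I2
  gamma xi oI1 iI1 I10 oI2 iI2 I20 rg rx a p eqg eqx.
split=> [a_gt0|a0]; split => //.
  exists (emb 0 (- a%:C%C)) => //; apply/eqP.
  rewrite -emb0 => /emb_inj[_ /(congr1 (@complex.Re R))].
  by rewrite ReN ReC Re0 => /eqP; rewrite oppr_eq0 (gt_eqF a_gt0).
move=> p rp; have := MC p rp; rewrite a0.
have -> : emb 0 (- (0 : R)%:C%C) = 0 :> 'cV[R[i]]_(k.+1 + 1).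
  by rewrite -[RHS]emb0; apply: emb_congr => //; rewrite oppr0.
by rewrite (normal_part_regular0 sG clG fX PsiE oI1 iI1 I10 oI2 iI2 I20 rg rx rp).
Qed.
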